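(* Let $s\ge2$ be an integer. $I_s^\infty$ is closed under the holomorphic functional calculus: for any $a\in I_s^\infty$ and any function $f$ holomorphic on an open set containing the spectrum of $a$ with $f(0)=0$, we have $f(a)\in I_s^\infty$.
   Context: $\mathbb{Z}_s$ is the compact ring of $s$-adic integers $x=\sum_{j\ge0}x_js^j$, $0\le x_j\le s-1$ (i.e. $\varprojlim\mathbb{Z}/s^n\mathbb{Z}$), and $\mathbb{Z}_s^\times=\{x\in\mathbb{Z}_s: x_0\ne0\}$ (a clopen subset; the elements of $s$-adic norm $1$). $H=\ell^2(\mathbb{Z})$ has canonical basis $\{E_l\}_{l\in\mathbb{Z}}$; $VE_l=E_{sl}$ and $M_fE_l=f(l)E_l$ for $f\in C(\mathbb{Z}_s)$. $HS(s)\subseteq B(H)$ is the C$^*$-algebra generated by $V$ and all $M_f$, $f\in C(\mathbb{Z}_s)$. Every nonzero $l\in\mathbb{Z}$ is written uniquely as $l=s^ml'$ with $m\ge0$, $s\nmid l'$. For $F\in C_0(\mathbb{Z}_{\ge0}\times\mathbb{Z}_s^\times)$ put $M_FE_{s^ml'}=F(m,l')E_{s^ml'}$, $M_FE_0=0$. RD (rapid decay) means decaying faster than any inverse polynomial in the indices. $I_s^\infty\subseteq HS(s)$ is the set of norm-convergent sums $a=\sum_{n\ge0}V^nM_{F_n}+\sum_{n<0}M_{F_n}(V^* )^{-n}$ with $F_n\in C_0(\mathbb{Z}_{\ge0}\times\mathbb{Z}_s^\times)$ and $\{\sup_x|F_n(m,x)|\}_{m,n}$ RD in $(m,n)$. The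 spectrum and $f(a)$ (defined by the Cauchy integral formula) are taken in the unital C$^*$-algebra $HS(s)$. *)

(* Defs.v *)
From Stdlib Require Import Reals ZArith List Permutation Lra Lia.
From Stdlib Require Import ProofIrrelevance FunctionalExtensionality.
From Coquelicot Require Import Coquelicot.

Open Scope R_scope.

(** [realify E] is [E] regarded as a real normed space:
    [is_RInt] only integrates functions with values in a real normed space. *)

Section RestrictScalars.

Context (E : NormedModule C_AbsRing).

Definition realify_scal (r : R) (x : E) : E := scal (RtoC r) x.

Definition realify_ModuleSpace_mixin :
  ModuleSpace.mixin_of R_Ring (NormedModule.AbelianGroup _ E).
Proof.
apply (ModuleSpace.Mixin R_Ring _ realify_scal); unfold realify_scal.
- intros x y u. rewrite scal_assoc. f_equal. unfold mult; simpl.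
  now rewrite RtoC_mult.
- intros u. exact (scal_one u).
- intros x u v. exact (scal_distr_l (RtoC x) u v).
- intros x y u.
  transitivity (scal (plus (RtoC x : C_Ring) (RtoC y)) u).
  + f_equal. unfold plus; simpl. now rewrite RtoC_plus.
  + exact (scal_distr_r (RtoC x : C_Ring) (RtoC y) u).
Defined.

Definition realify_ModuleSpace : ModuleSpace R_Ring :=
  ModuleSpace.Pack R_Ring E
    (ModuleSpace.Class _ _ _ realify_ModuleSpace_mixin) E.

Definition realify_NormedModuleAux : NormedModuleAux R_AbsRing :=
  NormedModuleAux.Pack R_AbsRing E
    (NormedModuleAux.Class R_AbsRing _ (ModuleSpace.class _ realify_ModuleSpace)
       (UniformSpace.class (NormedModule.UniformSpace _ E))) E.

Definition realify_NormedModule_mixin :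
  NormedModule.mixin_of R_AbsRing realify_NormedModuleAux.
Proof.
apply (NormedModule.Mixin R_AbsRing realify_NormedModuleAux
         (fun x : E => norm x) (@norm_factor _ E)).
- exact (@norm_triangle _ E).
- intros r x. eapply Rle_trans; [apply (@norm_scal _ E)|].
  apply Rmult_le_compat_r; [apply norm_ge_0|].
  right. exact (Cmod_R r).
- exact (@norm_compat1 _ E).
- exact (@norm_compat2 _ E).
- exact (@norm_eq_zero _ E).
Defined.

Definition realify : NormedModule R_AbsRing :=
  NormedModule.Pack R_AbsRing E
    (NormedModule.Class _ _ _ realify_NormedModule_mixin) E.

End RestrictScalars.

Section NormBuild.

Context (V : ModuleSpace C_Ring) (N : V -> R)
  (N_plus : forall x y : V, N (plus x y) <= N x + N y)
  (N_scal : forall (c : C_Ring) (x : V), N (scal c x) <= Cmod c * N x)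
  (N_eq0 : forall x : V, N x = 0 -> x = zero).

Lemma N_opp_le (x : V) : N (opp x) <= N x.
Proof.
rewrite <- (scal_opp_one x).
eapply Rle_trans; [apply N_scal|].
change (opp (one : C_Ring)) with (- RtoC 1)%C.
rewrite Cmod_opp, Cmod_1. lra.
Qed.

Lemma N_opp (x : V) : N (opp x) = N x.
Proof.
apply Rle_antisym; [apply N_opp_le|].
rewrite <- (opp_opp x) at 1. apply N_opp_le.
Qed.

Lemma N_zero : N zero = 0.
Proof.
apply Rle_antisym.
- rewrite <- (scal_zero_l (zero : V)).
  eapply Rle_trans; [apply N_scal|].
  assert (h0 : Cmod (zero : C_Ring) = 0) by exact Cmod_0.
  rewrite h0. lra.
- generalize (N_plus zero zero). rewrite plus_zero_l. lra.
Qed.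

Definition norm_ball (x : V) (e : R) (y : V) : Prop := N (minus y x) < e.

Definition norm_UniformSpace_mixin : UniformSpace.mixin_of V.
Proof.
apply (UniformSpace.Mixin V zero norm_ball); unfold norm_ball.
- intros x e. rewrite minus_eq_zero.
  eapply Rle_lt_trans; [right; exact N_zero|apply cond_pos].
- intros x y e h. now rewrite <- opp_minus, N_opp.
- intros x y z e1 e2 h1 h2. rewrite (minus_trans y z x).
  eapply Rle_lt_trans; [apply N_plus|]. lra.
Defined.

Definition norm_NormedModuleAux : NormedModuleAux C_AbsRing :=
  NormedModuleAux.Pack C_AbsRing V
    (NormedModuleAux.Class C_AbsRing _ (ModuleSpace.class _ V)
       norm_UniformSpace_mixin) V.

Definition norm_NormedModule_mixin :
  NormedModule.mixin_of C_AbsRing norm_NormedModuleAux.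
Proof.
apply (NormedModule.Mixin C_AbsRing norm_NormedModuleAux N 1
         N_plus N_scal).
- intros x y eps h. exact h.
- intros x y eps h. rewrite Rmult_1_l. exact h.
- exact N_eq0.
Defined.

End NormBuild.

Definition compact_set {T : UniformSpace} (K : T -> Prop) : Prop :=
  forall (I : Type) (O : I -> T -> Prop),
    (forall i, open (O i)) ->
    (forall x, K x -> exists i, O i x) ->
    exists l : list I, forall x, K x -> exists i, In i l /\ O i x.

(** Functions on a subspace [D] are represented by total functions whose values
    outside [D] are irrelevant. *)
Definition C0_on {T : UniformSpace} (D : T -> Prop) (F : T -> C) : Prop :=
  @continuous_on T C_UniformSpace D F /\
  (forall eps : posreal,
     exists K : T -> Prop,
       compact_set K /\ (forall x, K x -> D x) /\
       (forall x, D x -> ~ K x -> Cmod (F x) < eps)).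

Definition nat_ball (m : nat) (e : R) (n : nat) : Prop := m = n.

Definition nat_UniformSpace_mixin : UniformSpace.mixin_of nat.
Proof.
apply (UniformSpace.Mixin nat 0%nat nat_ball); unfold nat_ball; congruence.
Defined.

Definition nat_UniformSpace : UniformSpace :=
  UniformSpace.Pack nat nat_UniformSpace_mixin nat.

(** Sums over [Z] are series over [nat] whose [n]-th term collects the indices
    [n] and [- n - 1]; they are only used for absolutely convergent families. *)
Definition fold_Z (g : Z -> R) (n : nat) : R :=
  g (Z.of_nat n) + g (- Z.of_nat (S n))%Z.

Definition zsum (g : Z -> R) : R := Series (fold_Z g).

Definition square_summable (u : Z -> C) : Prop :=
  ex_series (fold_Z (fun l => Cmod (u l) ^ 2)).

Record l2 : Type := L2 { coord :> Z -> C; coord_sq : square_summable coord }.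

Lemma l2_ext (u v : l2) : (forall l, u l = v l) -> u = v.
Proof.
destruct u as [u hu], v as [v hv]; simpl; intros h.
assert (e : u = v) by now apply functional_extensionality.
subst v. f_equal. apply proof_irrelevance.
Qed.

Lemma ex_series_nonneg_le (a b : nat -> R) :
  (forall n, 0 <= a n <= b n) -> ex_series b -> ex_series a.
Proof.
intros h hb. apply (@ex_series_le _ R_CompleteNormedModule a b); [|exact hb].
intros n. specialize (h n). change (Rabs (a n) <= b n).
rewrite Rabs_pos_eq; lra.
Qed.

Lemma fold_Z_le (g h : Z -> R) :
  (forall l, 0 <= g l <= h l) -> forall n, 0 <= fold_Z g n <= fold_Z h n.
Proof.
intros H n. unfold fold_Z.
generalize (H (Z.of_nat n)) (H (- Z.of_nat (S n))%Z); lra.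
Qed.

Lemma fold_Z_lin (a b : R) (g h : Z -> R) (n : nat) :
  a * fold_Z g n + b * fold_Z h n = fold_Z (fun l => a * g l + b * h l) n.
Proof. unfold fold_Z; ring. Qed.

Lemma ex_fold_Z_lin (a b : R) (g h : Z -> R) :
  ex_series (fold_Z g) -> ex_series (fold_Z h) ->
  ex_series (fold_Z (fun l => a * g l + b * h l)).
Proof.
intros hg hh.
apply (ex_series_ext (fun n => a * fold_Z g n + b * fold_Z h n)).
- intros n. apply fold_Z_lin.
- exact (@ex_series_plus _ R_NormedModule _ _
    (@ex_series_scal_l _ R_NormedModule a _ hg)
    (@ex_series_scal_l _ R_NormedModule b _ hh)).
Qed.

Lemma zsum_lin (a b : R) (g h : Z -> R) :
  ex_series (fold_Z g) -> ex_series (fold_Z h) ->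
  zsum (fun l => a * g l + b * h l) = a * zsum g + b * zsum h.
Proof.
intros hg hh. unfold zsum.
rewrite <- !Series_scal_l, <- Series_plus.
- apply Series_ext. intros n. symmetry. apply fold_Z_lin.
- exact (@ex_series_scal_l _ R_NormedModule a _ hg).
- exact (@ex_series_scal_l _ R_NormedModule b _ hh).
Qed.

Lemma zsum_le (g h : Z -> R) :
  (forall l, 0 <= g l <= h l) -> ex_series (fold_Z h) -> zsum g <= zsum h.
Proof. intros H hh. apply Series_le; [now apply fold_Z_le|exact hh]. Qed.

Lemma zsum_ge0 (g : Z -> R) :
  (forall l, 0 <= g l) -> ex_series (fold_Z g) -> 0 <= zsum g.
Proof.
intros H hg. replace 0 with (zsum (fun _ => 0)).
- apply zsum_le; [|exact hg]. intros l; split; [lra|apply H].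
- unfold zsum. rewrite (Series_ext _ (fun n => 0 * 0)).
  + rewrite Series_scal_l. ring.
  + intros n. unfold fold_Z. ring.
Qed.

Lemma ex_series_finite_support (a : nat -> R) (N : nat) :
  (forall n, (N <= n)%nat -> a n = 0) -> ex_series a.
Proof.
intros h. exists (sum_n a N).
apply (filterlim_ext_loc (fun _ => sum_n a N)); [|apply filterlim_const].
exists N. intros n hn. induction hn as [|n hn IH]; [reflexivity|].
rewrite sum_Sn, h by lia. rewrite <- IH.
exact (eq_sym (Rplus_0_r (sum_n a N))).
Qed.

Lemma Series_zero_terms (a : nat -> R) :
  (forall n, 0 <= a n) -> ex_series a -> Series a = 0 -> forall n, a n = 0.
Proof.
intros h ha h0 n.
assert (hs : is_lim_seq (sum_n a) 0).
{ rewrite <- h0. exact (Series_correct a ha). }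
assert (hi : forall k, sum_n a k <= sum_n a (S k)).
{ intros k. rewrite sum_Sn. unfold plus; simpl. specialize (h (S k)); lra. }
assert (hn : sum_n a n <= 0).
{ exact (is_lim_seq_incr_compare (sum_n a) 0 hs hi n). }
assert (hp : forall k, 0 <= sum_n a k).
{ induction k as [|k IH]; [rewrite sum_O; apply h|].
  eapply Rle_trans; [apply IH|apply hi]. }
destruct n as [|n].
- rewrite sum_O in hn. specialize (h 0%nat); lra.
- rewrite sum_Sn in hn. unfold plus in hn; simpl in hn.
  specialize (h (S n)); specialize (hp n); lra.
Qed.

Lemma zsum_zero (g : Z -> R) :
  (forall l, 0 <= g l) -> ex_series (fold_Z g) -> zsum g = 0 ->
  forall l, g l = 0.
Proof.
intros H hg h0 l.
assert (hf : forall n, fold_Z g n = 0).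
{ apply Series_zero_terms; auto.
  intros n. unfold fold_Z. generalize (H (Z.of_nat n)) (H (- Z.of_nat (S n))%Z); lra. }
destruct (Z_le_gt_dec 0 l) as [hl|hl].
- specialize (hf (Z.to_nat l)). unfold fold_Z in hf.
  rewrite Z2Nat.id in hf by lia.
  generalize (H l) (H (- Z.of_nat (S (Z.to_nat l)))%Z); lra.
- specialize (hf (Z.to_nat (- l - 1))). unfold fold_Z in hf.
  replace (- Z.of_nat (S (Z.to_nat (- l - 1))))%Z with l in hf by lia.
  generalize (H l) (H (Z.of_nat (Z.to_nat (- l - 1)))); lra.
Qed.

Lemma le_of_sq (x y : R) : 0 <= y -> x ^ 2 <= y ^ 2 -> x <= y.
Proof. intros hy h. nra. Qed.

Lemma Cmod_plus_sq (t : R) (x y : C) :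
  0 < t -> Cmod (x + y) ^ 2 <= (1 + t) * Cmod x ^ 2 + (1 + / t) * Cmod y ^ 2.
Proof.
intros ht.
assert (h1 : Cmod (x + y) ^ 2 <= (Cmod x + Cmod y) ^ 2).
{ apply pow_incr. split; [apply Cmod_ge_0|apply Cmod_triangle]. }
eapply Rle_trans; [exact h1|].
assert (h2 : 0 <= / t * (t * Cmod x - Cmod y) ^ 2).
{ apply Rmult_le_pos; [left; now apply Rinv_0_lt_compat|apply pow2_ge_0]. }
replace (/ t * (t * Cmod x - Cmod y) ^ 2)
  with (t * Cmod x ^ 2 - 2 * Cmod x * Cmod y + / t * Cmod y ^ 2) in h2
  by (field; lra).
nra.
Qed.

Definition l2_zero : l2.
Proof.
exists (fun _ => RtoC 0). exists 0.
apply (is_series_ext (fun _ => 0)).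
- intros n. unfold fold_Z. rewrite Cmod_0. simpl; ring.
- apply (filterlim_ext (fun _ => 0)).
  + intros n. rewrite sum_n_const. simpl; ring.
  + apply filterlim_const.
Defined.

Definition l2_plus (u v : l2) : l2.
Proof.
exists (fun l => (u l + v l)%C). unfold square_summable.
eapply ex_series_nonneg_le; cycle 1.
- exact (ex_fold_Z_lin (1 + 1) (1 + / 1) _ _ (coord_sq u) (coord_sq v)).
- apply fold_Z_le. intros l. split; [apply pow2_ge_0|].
  apply Cmod_plus_sq; lra.
Defined.

Definition l2_scal (c : C) (u : l2) : l2.
Proof.
exists (fun l => (c * u l)%C). unfold square_summable.
eapply ex_series_nonneg_le; cycle 1.
- exact (ex_fold_Z_lin (Cmod c ^ 2) 0 _ _ (coord_sq u) (coord_sq u)).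
- apply fold_Z_le. intros l. split; [apply pow2_ge_0|].
  rewrite Cmod_mult, Rpow_mult_distr. lra.
Defined.

Definition l2_opp (u : l2) : l2 := l2_scal (RtoC (-1)) u.

Definition l2_AbelianMonoid_mixin : AbelianMonoid.mixin_of l2.
Proof.
apply (AbelianMonoid.Mixin l2 l2_plus l2_zero);
  intros; apply l2_ext; intros l; simpl; ring.
Defined.

Canonical l2_AbelianMonoid :=
  AbelianMonoid.Pack l2 l2_AbelianMonoid_mixin l2.

Definition l2_AbelianGroup_mixin : AbelianGroup.mixin_of l2_AbelianMonoid.
Proof.
apply (AbelianGroup.Mixin l2_AbelianMonoid l2_opp).
intros; apply l2_ext; intros l; simpl; ring.
Defined.

Canonical l2_AbelianGroup :=
  AbelianGroup.Pack l2
    (AbelianGroup.Class _ l2_AbelianMonoid_mixin l2_AbelianGroup_mixin) l2.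

Definition l2_ModuleSpace_mixin : ModuleSpace.mixin_of C_Ring l2_AbelianGroup.
Proof.
apply (ModuleSpace.Mixin C_Ring l2_AbelianGroup l2_scal);
  intros; apply l2_ext; intros l; simpl; unfold mult, plus, one; simpl; ring.
Defined.

Canonical l2_ModuleSpace :=
  ModuleSpace.Pack C_Ring l2
    (ModuleSpace.Class _ _ (AbelianGroup.class l2_AbelianGroup)
       l2_ModuleSpace_mixin) l2.

Definition l2_norm (u : l2) : R := sqrt (zsum (fun l => Cmod (u l) ^ 2)).

Lemma l2_norm_ge0 (u : l2) : 0 <= l2_norm u.
Proof. apply sqrt_pos. Qed.

Lemma l2_norm_sq (u : l2) : l2_norm u ^ 2 = zsum (fun l => Cmod (u l) ^ 2).
Proof.
unfold l2_norm. rewrite pow2_sqrt; [reflexivity|].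
apply zsum_ge0; [intros; apply pow2_ge_0|apply coord_sq].
Qed.

Lemma l2_norm_eq0 (u : l2) : l2_norm u = 0 -> u = l2_zero.
Proof.
intros h. apply l2_ext. intros l. simpl. apply Cmod_eq_0.
assert (h2 : Cmod (u l) ^ 2 = 0).
{ apply (zsum_zero (fun l => Cmod (u l) ^ 2)).
  - intros; apply pow2_ge_0.
  - apply coord_sq.
  - rewrite <- l2_norm_sq, h. ring. }
apply Rsqr_0_uniq. unfold Rsqr. rewrite <- h2. ring.
Qed.

Lemma l2_norm_triangle (u v : l2) :
  l2_norm (l2_plus u v) <= l2_norm u + l2_norm v.
Proof.
destruct (Req_dec (l2_norm u) 0) as [hu|hu].
{ rewrite hu, (l2_norm_eq0 u hu). right. rewrite Rplus_0_l. f_equal.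
  apply l2_ext. intros l. simpl. ring. }
destruct (Req_dec (l2_norm v) 0) as [hv|hv].
{ rewrite hv, (l2_norm_eq0 v hv). right. rewrite Rplus_0_r. f_equal.
  apply l2_ext. intros l. simpl. ring. }
assert (pu : 0 < l2_norm u) by (generalize (l2_norm_ge0 u); lra).
assert (pv : 0 < l2_norm v) by (generalize (l2_norm_ge0 v); lra).
assert (pt : 0 < l2_norm v / l2_norm u) by now apply Rdiv_lt_0_compat.
apply le_of_sq; [lra|].
rewrite l2_norm_sq.
eapply Rle_trans.
- apply (zsum_le _ (fun l => (1 + l2_norm v / l2_norm u) * Cmod (u l) ^ 2
                    + (1 + / (l2_norm v / l2_norm u)) * Cmod (v l) ^ 2)).
  + intros l. split; [apply pow2_ge_0|]. now apply Cmod_plus_sq.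
  + apply ex_fold_Z_lin; apply coord_sq.
- rewrite zsum_lin by apply coord_sq.
  rewrite <- !l2_norm_sq. right. field. lra.
Qed.

Lemma l2_norm_scal (c : C) (u : l2) : l2_norm (l2_scal c u) <= Cmod c * l2_norm u.
Proof.
apply le_of_sq;
  [apply Rmult_le_pos; [apply Cmod_ge_0|apply l2_norm_ge0]|].
rewrite l2_norm_sq, Rpow_mult_distr, l2_norm_sq.
eapply Rle_trans.
- apply (zsum_le _ (fun l => Cmod c ^ 2 * Cmod (u l) ^ 2 + 0 * Cmod (u l) ^ 2)).
  + intros l. split; [apply pow2_ge_0|]. simpl.
    rewrite Cmod_mult. lra.
  + apply ex_fold_Z_lin; apply coord_sq.
- rewrite zsum_lin by apply coord_sq. lra.
Qed.

Definition l2_UniformSpace_mixin : UniformSpace.mixin_of l2 :=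
  norm_UniformSpace_mixin l2_ModuleSpace l2_norm l2_norm_triangle l2_norm_scal.

Canonical l2_UniformSpace := UniformSpace.Pack l2 l2_UniformSpace_mixin l2.

Canonical l2_NormedModuleAux :=
  NormedModuleAux.Pack C_AbsRing l2
    (NormedModuleAux.Class C_AbsRing _ (ModuleSpace.class _ l2_ModuleSpace)
       l2_UniformSpace_mixin) l2.

Definition l2_NormedModule_mixin :
  NormedModule.mixin_of C_AbsRing l2_NormedModuleAux :=
  norm_NormedModule_mixin l2_ModuleSpace l2_norm l2_norm_triangle l2_norm_scal
    l2_norm_eq0.

Canonical l2_NormedModule :=
  NormedModule.Pack C_AbsRing l2
    (NormedModule.Class _ _ _ l2_NormedModule_mixin) l2.

Definition l2_inner (u v : l2) : C :=
  (zsum (fun l => Re (u l * Cconj (v l))), zsum (fun l => Im (u l * Cconj (v l)))).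

Definition l2_basis (l : Z) : l2.
Proof.
exists (fun k => if Z.eqb k l then RtoC 1 else RtoC 0).
apply ex_series_finite_support with (Z.abs_nat l + 1)%nat.
intros n hn. unfold fold_Z.
rewrite (proj2 (Z.eqb_neq (Z.of_nat n) l)) by lia.
rewrite (proj2 (Z.eqb_neq (- Z.of_nat (S n)) l)) by lia.
rewrite Cmod_0. ring.
Defined.

Section Operators.

Context (E : NormedModule C_AbsRing).

(** [is_linear] is Coquelicot's notion of a bounded linear map. *)
Record bounded_op : Type := BoundedOp { op_fun :> E -> E; op_linear : is_linear op_fun }.

Lemma op_ext (S T : bounded_op) : (forall x, S x = T x) -> S = T.
Proof.
destruct S as [S hS], T as [T hT]; simpl; intros h.
assert (e : S = T) by now apply functional_extensionality.
subst T. f_equal. apply proof_irrelevance.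
Qed.

Definition op_zero : bounded_op := BoundedOp (fun _ => zero) is_linear_zero.

Definition op_one : bounded_op := BoundedOp (fun x => x) is_linear_id.

Definition op_plus (S T : bounded_op) : bounded_op.
Proof.
exists (fun x => plus (S x) (T x)).
exact (is_linear_comp (fun x => (S x, T x)) (fun p => plus (fst p) (snd p))
  (is_linear_prod S T (op_linear S) (op_linear T)) is_linear_plus).
Defined.

Definition op_scal (c : C) (T : bounded_op) : bounded_op.
Proof.
exists (fun x => scal c (T x)).
exact (is_linear_comp T (fun y => scal c y) (op_linear T)
  (is_linear_scal_r c Cmult_comm)).
Defined.

Definition op_opp (T : bounded_op) : bounded_op :=
  BoundedOp (fun x => opp (T x)) (is_linear_comp T opp (op_linear T) is_linear_opp).

Definition op_mult (S T : bounded_op) : bounded_op :=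
  BoundedOp (fun x => S (T x)) (is_linear_comp T S (op_linear T) (op_linear S)).

Fixpoint op_pow (T : bounded_op) (n : nat) : bounded_op :=
  match n with
  | O => op_one
  | S n => op_mult T (op_pow T n)
  end.

Definition op_AbelianMonoid_mixin : AbelianMonoid.mixin_of bounded_op.
Proof.
apply (AbelianMonoid.Mixin bounded_op op_plus op_zero);
  intros; apply op_ext; intros w; simpl.
- apply plus_comm.
- apply plus_assoc.
- apply plus_zero_r.
Defined.

Canonical op_AbelianMonoid :=
  AbelianMonoid.Pack bounded_op op_AbelianMonoid_mixin bounded_op.

Definition op_AbelianGroup_mixin : AbelianGroup.mixin_of op_AbelianMonoid.
Proof.
apply (AbelianGroup.Mixin op_AbelianMonoid op_opp).
intros; apply op_ext; intros w; simpl.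
exact (@plus_opp_r (NormedModule.AbelianGroup _ E) _).
Defined.

Canonical op_AbelianGroup :=
  AbelianGroup.Pack bounded_op
    (AbelianGroup.Class _ op_AbelianMonoid_mixin op_AbelianGroup_mixin) bounded_op.

Definition op_ModuleSpace_mixin : ModuleSpace.mixin_of C_Ring op_AbelianGroup.
Proof.
apply (ModuleSpace.Mixin C_Ring op_AbelianGroup op_scal);
  intros; apply op_ext; intros w; simpl.
- apply scal_assoc.
- apply (@scal_one C_Ring).
- apply (@scal_distr_l C_Ring).
- apply (@scal_distr_r C_Ring).
Defined.

Canonical op_ModuleSpace :=
  ModuleSpace.Pack C_Ring bounded_op
    (ModuleSpace.Class _ _ (AbelianGroup.class op_AbelianGroup)
       op_ModuleSpace_mixin) bounded_op.

Definition op_bound (T : bounded_op) (M : R) : Prop :=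
  0 <= M /\ forall x, norm (T x) <= M * norm x.

Definition op_norm (T : bounded_op) : R := real (Glb_Rbar (op_bound T)).

Lemma op_norm_glb (T : bounded_op) : is_glb_Rbar (op_bound T) (op_norm T).
Proof.
unfold op_norm.
generalize (Glb_Rbar_correct (op_bound T)). intros h.
destruct (linear_norm T (op_linear T)) as [M [hM0 hM]].
assert (hB : op_bound T M) by (split; [lra|exact hM]).
assert (h1 : Rbar_le (Glb_Rbar (op_bound T)) M) by (apply (proj1 h); exact hB).
assert (h2 : Rbar_le 0 (Glb_Rbar (op_bound T))).
{ apply (proj2 h). intros x hx. exact (proj1 hx). }
destruct (Glb_Rbar (op_bound T)); simpl in *; tauto.
Qed.

Lemma op_norm_ge0 (T : bounded_op) : 0 <= op_norm T.
Proof.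
apply (proj2 (op_norm_glb T) (Finite 0)). intros x hx. exact (proj1 hx).
Qed.

Lemma op_norm_le (T : bounded_op) (M : R) : op_bound T M -> op_norm T <= M.
Proof. intros h. exact (proj1 (op_norm_glb T) M h). Qed.

Lemma op_norm_spec (T : bounded_op) (x : E) : norm (T x) <= op_norm T * norm x.
Proof.
destruct (Req_dec (norm x) 0) as [h|h].
- destruct (linear_norm T (op_linear T)) as [M [hM0 hM]].
  specialize (hM x). rewrite h in *. lra.
- assert (hp : 0 < norm x) by (generalize (norm_ge_0 x); lra).
  assert (hq : norm (T x) / norm x <= op_norm T).
  { apply (proj2 (op_norm_glb T) (Finite (norm (T x) / norm x))).
    intros M [_ hM]. simpl. apply Rle_div_l; [exact hp|apply hM]. }
  apply Rle_div_l in hq; [exact hq|exact hp].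
Qed.

Lemma op_norm_triangle (S T : bounded_op) :
  op_norm (op_plus S T) <= op_norm S + op_norm T.
Proof.
apply op_norm_le. split.
- generalize (op_norm_ge0 S) (op_norm_ge0 T); lra.
- intros x. simpl. eapply Rle_trans; [apply (@norm_triangle _ E)|].
  generalize (op_norm_spec S x) (op_norm_spec T x); lra.
Qed.

Lemma op_norm_scal (c : C) (T : bounded_op) :
  op_norm (op_scal c T) <= Cmod c * op_norm T.
Proof.
apply op_norm_le. split.
- apply Rmult_le_pos; [apply Cmod_ge_0|apply op_norm_ge0].
- intros x. simpl. eapply Rle_trans; [apply (@norm_scal _ E)|].
  rewrite Rmult_assoc. apply Rmult_le_compat_l; [apply Cmod_ge_0|].
  apply op_norm_spec.
Qed.

Lemma op_norm_eq0 (T : bounded_op) : op_norm T = 0 -> T = op_zero.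
Proof.
intros h. apply op_ext. intros x. simpl. apply (@norm_eq_zero _ E).
generalize (op_norm_spec T x) (norm_ge_0 (T x)). rewrite h. lra.
Qed.

Definition op_UniformSpace_mixin : UniformSpace.mixin_of bounded_op :=
  norm_UniformSpace_mixin op_ModuleSpace op_norm op_norm_triangle
    op_norm_scal.

Canonical op_UniformSpace := UniformSpace.Pack bounded_op op_UniformSpace_mixin bounded_op.

Canonical op_NormedModuleAux :=
  NormedModuleAux.Pack C_AbsRing bounded_op
    (NormedModuleAux.Class C_AbsRing _ (ModuleSpace.class _ op_ModuleSpace)
       op_UniformSpace_mixin) bounded_op.

Definition op_NormedModule_mixin :
  NormedModule.mixin_of C_AbsRing op_NormedModuleAux :=
  norm_NormedModule_mixin op_ModuleSpace op_norm op_norm_triangle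
    op_norm_scal op_norm_eq0.

Canonical op_NormedModule :=
  NormedModule.Pack C_AbsRing bounded_op
    (NormedModule.Class _ _ _ op_NormedModule_mixin) bounded_op.

End Operators.

Notation BH := (bounded_op l2_NormedModule).

Definition is_adjoint (T S : BH) : Prop :=
  forall u v : l2, l2_inner (T u) v = l2_inner u (S v).

Record Zs (s : nat) : Type :=
  MkZs { digit :> nat -> nat; digit_le : forall j, (digit j <= s - 1)%nat }.

Lemma Zs_ext (s : nat) (x y : Zs s) : (forall j, x j = y j) -> x = y.
Proof.
destruct x as [x hx], y as [y hy]; simpl; intros h.
assert (e : x = y) by now apply functional_extensionality.
subst y. f_equal. apply proof_irrelevance.
Qed.

Definition Zs_zero (s : nat) : Zs s := MkZs s (fun _ => 0%nat) (fun _ => Nat.le_0_l _).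

(** For [0 < e], this says that the [s]-adic distance of [x] and [y], which is
    [s ^ - j] for the first [j] such that [x j <> y j], is less than [e]. *)
Definition Zs_ball (s : nat) (x : Zs s) (e : R) (y : Zs s) : Prop :=
  0 < e /\ forall j, x j <> y j -> / INR s ^ j < e.

Definition Zs_UniformSpace_mixin (s : nat) : UniformSpace.mixin_of (Zs s).
Proof.
apply (UniformSpace.Mixin (Zs s) (Zs_zero s) (Zs_ball s)); unfold Zs_ball.
- intros x e. split; [apply cond_pos|]. intros j h. now destruct h.
- intros x y e [he h]. split; [exact he|]. intros j hj. apply h. congruence.
- intros x y z e1 e2 [he1 h1] [he2 h2]. split; [lra|]. intros j hj.
  destruct (Nat.eq_dec (x j) (y j)) as [e|e].
  + specialize (h2 j ltac:(congruence)). lra.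
  + specialize (h1 j e). lra.
Defined.

Definition Zs_UniformSpace (s : nat) : UniformSpace :=
  UniformSpace.Pack (Zs s) (Zs_UniformSpace_mixin s) (Zs s).

Definition Zs_units (s : nat) (x : Zs s) : Prop := x 0%nat <> 0%nat.

Fixpoint Zs_trunc (s : nat) (x : Zs s) (n : nat) : Z :=
  match n with
  | O => 0
  | S n => Zs_trunc s x n + Z.of_nat (x n) * Z.of_nat s ^ Z.of_nat n
  end%Z.

(** [x] is the image in [Zs s] of the integer [l]. *)
Definition Zs_repr (s : nat) (x : Zs s) (l : Z) : Prop :=
  forall n, (Z.of_nat s ^ Z.of_nat n | l - Zs_trunc s x n)%Z.

Lemma Zs_repr_ex (s : nat) (l : Z) : (2 <= s)%nat -> exists x, Zs_repr s x l.
Proof.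
intros hs.
assert (hd : forall j,
  (Z.to_nat ((l / Z.of_nat s ^ Z.of_nat j) mod Z.of_nat s) <= s - 1)%nat).
{ intros j.
  generalize (Z.mod_pos_bound (l / Z.of_nat s ^ Z.of_nat j) (Z.of_nat s)
                ltac:(lia)). lia. }
exists (MkZs s _ hd). intros n.
exists (l / Z.of_nat s ^ Z.of_nat n)%Z.
induction n as [|n IH].
- simpl. rewrite Z.div_1_r. lia.
- simpl Zs_trunc.
  set (p := (Z.of_nat s ^ Z.of_nat n)%Z) in *.
  replace (Z.of_nat s ^ Z.of_nat (S n))%Z with (p * Z.of_nat s)%Z
    by (rewrite Nat2Z.inj_succ, Z.pow_succ_r by lia; unfold p; ring).
  assert (hp : (0 < p)%Z) by (apply Z.pow_pos_nonneg; lia).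
  rewrite Z2Nat.id by (apply Z.mod_pos_bound; lia).
  rewrite <- Z.div_div by lia.
  generalize (Z.div_mod (l / p) (Z.of_nat s) ltac:(lia)). intros hq.
  set (q := (l / p)%Z) in *. nia.
Qed.

Lemma Zs_repr_uniq (s : nat) (x y : Zs s) (l : Z) :
  (2 <= s)%nat -> Zs_repr s x l -> Zs_repr s y l -> x = y.
Proof.
intros hs hx hy.
assert (h : forall n, Zs_trunc s x n = Zs_trunc s y n -> x n = y n).
{ intros n e. generalize (hx (S n)) (hy (S n)). simpl Zs_trunc.
  rewrite e. intros [a ha] [b hb].
  set (p := (Z.of_nat s ^ Z.of_nat n)%Z) in *.
  replace (Z.of_nat s ^ Z.of_nat (S n))%Z with (p * Z.of_nat s)%Z in ha, hb
    by (rewrite Nat2Z.inj_succ, Z.pow_succ_r by lia; unfold p; ring).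
  assert (hp : (0 < p)%Z) by (apply Z.pow_pos_nonneg; lia).
  assert (hz : (Z.of_nat (x n) - Z.of_nat (y n) = (b - a) * Z.of_nat s)%Z).
  { apply (Z.mul_reg_r _ _ p); [lia|]. lia. }
  generalize (digit_le s x n) (digit_le s y n). intros h1 h2.
  assert (b - a = 0)%Z by nia. nia. }
assert (h' : forall n, Zs_trunc s x n = Zs_trunc s y n).
{ induction n as [|n IH]; [reflexivity|]. simpl. now rewrite IH, (h n IH). }
apply Zs_ext. intros n. apply h, h'.
Qed.

Definition is_shift (s : nat) (V : BH) : Prop :=
  forall l : Z, V (l2_basis l) = l2_basis (Z.of_nat s * l).

Definition is_mult (s : nat) (f : Zs s -> C) (M : BH) : Prop :=
  forall (l : Z) (x : Zs s),
    Zs_repr s x l -> M (l2_basis l) = scal (f x) (l2_basis l).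

Record Cstar_subalgebra (A : BH -> Prop) : Prop := {
  Cstar_zero : A zero;
  Cstar_plus : forall S T, A S -> A T -> A (plus S T);
  Cstar_scal : forall (c : C) T, A T -> A (scal c T);
  Cstar_mult : forall S T, A S -> A T -> A (op_mult _ S T);
  Cstar_adjoint : forall S T, A T -> is_adjoint T S -> A S;
  Cstar_closed : closed A
}.

Definition HS (s : nat) (T : BH) : Prop :=
  forall A : BH -> Prop,
    Cstar_subalgebra A ->
    (forall V, is_shift s V -> A V) ->
    (forall (f : Zs s -> C) M,
       (forall x, @continuous (Zs_UniformSpace s) C_UniformSpace f x) ->
       is_mult s f M -> A M) ->
    A T.

Definition is_resolvent (s : nat) (a : BH) (z : C) (r : BH) : Prop :=
  HS s r /\
  op_mult _ (minus (scal z (op_one _)) a) r = op_one _ /\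
  op_mult _ r (minus (scal z (op_one _)) a) = op_one _.

Definition spectrum (s : nat) (a : BH) (z : C) : Prop :=
  ~ exists r, is_resolvent s a z r.

(** Contours are finite families of oriented segments, given by their end points. *)
Definition contour : Type := list (C * C).

Definition segment (p q : C) (t : R) : C := (p + RtoC t * (q - p))%C.

Definition on_contour (G : contour) (z : C) : Prop :=
  exists p q t, In (p, q) G /\ 0 <= t <= 1 /\ z = segment p q t.

Fixpoint is_contour_int {E : NormedModule C_AbsRing} (phi : C -> E)
    (G : contour) (J : E) : Prop :=
  match G with
  | nil => J = zero
  | (p, q) :: G' =>
      exists J1 J2 : E,
        @is_RInt (realify E)
          (fun t => scal (q - p)%C (phi (segment p q t))) 0 1 J1 /\
        is_contour_int phi G' J2 /\ J = plus J1 J2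
  end.

Definition two_pi_i : C := (RtoC (2 * PI) * Ci)%C.

(** The first clause says that the segments fit together into closed polygons;
    the last two, that the winding number is 1 at the points of [K] and 0 at
    the points outside [U]. *)
Definition surrounds (G : contour) (K U : C -> Prop) : Prop :=
  Permutation (map fst G) (map snd G) /\
  (forall z, on_contour G z -> U z /\ ~ K z) /\
  (forall z, K z ->
     @is_contour_int C_NormedModule (fun w => / (w - z))%C G two_pi_i) /\
  (forall z, ~ U z ->
     @is_contour_int C_NormedModule (fun w => / (w - z))%C G (RtoC 0)).

(** [b] is [f(a)], for [f] holomorphic on the open neighborhood [U] of the
    spectrum of [a]. *)
Definition is_holo_calc (s : nat) (a : BH) (U : C -> Prop) (f : C -> C)
    (b : BH) : Prop :=
  exists (G : contour) (r : C -> BH) (J : BH),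
    surrounds G (spectrum s a) U /\
    (forall z, on_contour G z -> is_resolvent s a z (r z)) /\
    is_contour_int (fun z => scal (f z) (r z)) G J /\
    b = scal (/ two_pi_i)%C J.

Definition nat_Zs_UniformSpace (s : nat) : UniformSpace :=
  prod_UniformSpace nat_UniformSpace (Zs_UniformSpace s).

Definition nat_units (s : nat) (p : nat * Zs s) : Prop := Zs_units s (snd p).

Definition is_mult0 (s : nat) (F : nat * Zs s -> C) (M : BH) : Prop :=
  M (l2_basis 0) = zero /\
  forall (m : nat) (l : Z) (x : Zs s),
    Zs_repr s x l -> Zs_units s x ->
    M (l2_basis (Z.of_nat s ^ Z.of_nat m * l)) =
    scal (F (m, x)) (l2_basis (Z.of_nat s ^ Z.of_nat m * l)).

Definition sup_units (s : nat) (F : nat * Zs s -> C) (m : nat) : Rbar :=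
  Lub_Rbar (fun y => exists x, Zs_units s x /\ y = Cmod (F (m, x))).

Definition rapid_decay (c : nat -> Z -> Rbar) : Prop :=
  forall j k : nat, exists M : R, forall (m : nat) (n : Z),
    Rbar_le (c m n) (M / ((1 + INR m) ^ j * (1 + Rabs (IZR n)) ^ k)).

Definition I_infty (s : nat) (a : BH) : Prop :=
  HS s a /\
  exists (V W : BH) (F : Z -> nat * Zs s -> C) (M : Z -> BH) (b c : BH),
    is_shift s V /\ is_adjoint V W /\
    (forall n, @C0_on (nat_Zs_UniformSpace s) (nat_units s) (F n)) /\
    (forall n, is_mult0 s (F n) (M n)) /\
    rapid_decay (fun m n => sup_units s (F n) m) /\
    is_series (fun n : nat =>
      op_mult _ (op_pow _ V n) (M (Z.of_nat n))) b /\
    is_series (fun n : nat =>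
      op_mult _ (M (- Z.of_nat (S n))%Z) (op_pow _ W (S n))) c /\
    a = plus b c.

(* Main.v *)
(** [HS(s)] acts on [E_0] and on the blocks spanned by [E_{s^i p}], [i >= 0], one for each
    integer [p] not divisible by [s]; an element of [I_s^infty] is, on these blocks, a matrix
    whose entries decay rapidly and extend continuously in [p] to the units of [Z_s]. Since
    [r(z) = 1/z + a r(z)/z = 1/z + r(z) a/z], the entries of [r(z) - 1/z] decay like those
    of [a], uniformly on the contour, and the scalar term contributes the integral of
    [f(z)/z], which is [2 pi i f(0) = 0] by Cauchy's formula for contours given by winding
    numbers. Continuity of the entries of [f(a)] needs no resolvent estimate: every element
    of [HS(s)] almost commutes with the operators that exchange two blocks whose units are
    [s]-adically close, because [V] and the [M_f] do. *)

Require Import Defs.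
From Stdlib Require Import Reals ZArith List Permutation Lra Lia.
From Stdlib Require Import Classical ClassicalEpsilon.
From Coquelicot Require Import Coquelicot.

Open Scope R_scope.

(** * Complex differentiability *)

(** Only decay in the larger of the two levels of an entry has to be proved. On the diagonal [n], an
    entry with smaller level [m] has larger level [m + |n|], and [1 + m + |n|] dominates both
    [1 + m] and [1 + |n|]; order [j + k] in it gives order [j] in [m] and [k] in [n]. Row decay
    comes from [a r(z)], column decay from [r(z) a]; beyond one row or column of [a] they use just a
    norm bound for [r(z)] on the contour, which follows from the resolvent identity and the
    compactness of [[0, 1]]. Division by [z] is legitimate because [a] kills [E_0]: this puts [0] in
    the spectrum, hence in [U] and off the contour. Holomorphy is complex differentiability at each
    point of an open set of any shape, and the contour is a finite family of segments known through
    its winding numbers. Goursat's lemma gives Cauchy's theorem on discs; Dixon's entire function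
    passes from discs to such contours without any topology of the plane. Operator integrals are
    read through matrix coefficients, so that only scalar integrals are estimated. *)

Definition ccont (f : C -> C) (z : C) : Prop :=
  forall eps, 0 < eps -> exists d, 0 < d /\
    forall w, Cmod (w - z) < d -> Cmod (f w - f z) < eps.

(** The product form admits [w = z], so that no punctured neighbourhoods are needed in sums,
    products and compositions. *)
Definition cderiv (f : C -> C) (z l : C) : Prop :=
  forall eps, 0 < eps -> exists d, 0 < d /\
    forall w, Cmod (w - z) < d ->
      Cmod (f w - f z - l * (w - z)) <= eps * Cmod (w - z).

Definition cdiff (f : C -> C) (z : C) : Prop := exists l, cderiv f z l.

Lemma Cmod_minus_sym (x y : C) : Cmod (x - y) = Cmod (y - x).
Proof. rewrite <- Cmod_opp. f_equal. ring. Qed.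

Lemma Cmod_minus_triangle (x y z : C) : Cmod (x - z) <= Cmod (x - y) + Cmod (y - z).
Proof. replace (x - z)%C with ((x - y) + (y - z))%C by ring. apply Cmod_triangle. Qed.

Lemma Cmod_minus_le (x y : C) : Cmod (x - y) <= Cmod x + Cmod y.
Proof. unfold Cminus. rewrite <- (Cmod_opp y). apply Cmod_triangle. Qed.

Lemma Cmod_rev_triangle (x y : C) : Cmod x - Cmod y <= Cmod (x - y).
Proof.
generalize (Cmod_triangle (x - y) y). replace (x - y + y)%C with x by ring. lra.
Qed.

Lemma Cminus_eq_0 (x y : C) : (x - y = 0)%C -> x = y.
Proof. intros h. replace x with ((x - y) + y)%C by ring. rewrite h. ring. Qed.

Lemma Cminus_neq_0 (x y : C) : x <> y -> (x - y <> 0)%C.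
Proof. intros h e. apply h, Cminus_eq_0, e. Qed.

Lemma Cmod_minus_pos (x y : C) : x <> y -> 0 < Cmod (x - y).
Proof. intros h. now apply Cmod_gt_0, Cminus_neq_0. Qed.

Lemma Cmod_minus_self (x : C) : Cmod (x - x) = 0.
Proof. replace (x - x)%C with (RtoC 0) by ring. apply Cmod_0. Qed.

Lemma cdiff_ccont (f : C -> C) (z : C) : cdiff f z -> ccont f z.
Proof.
intros [l h] eps heps. destruct (h 1 ltac:(lra)) as [d [hd H]].
generalize (Cmod_ge_0 l). intros hl.
assert (hp : 0 < eps / (1 + Cmod l)) by (apply Rdiv_lt_0_compat; lra).
exists (Rmin d (eps / (1 + Cmod l))). split; [now apply Rmin_pos|].
intros w hw. specialize (H w (Rlt_le_trans _ _ _ hw (Rmin_l _ _))).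
assert (hw2 := Rlt_le_trans _ _ _ hw (Rmin_r _ _)).
replace (f w - f z)%C with ((f w - f z - l * (w - z)) + l * (w - z))%C by ring.
eapply Rle_lt_trans; [apply Cmod_triangle|]. rewrite Cmod_mult.
apply Rlt_div_r in hw2; [|lra]. nra.
Qed.

Lemma cderiv_ext_loc (f g : C -> C) (z l : C) (d0 : R) :
  0 < d0 -> (forall w, Cmod (w - z) < d0 -> f w = g w) ->
  cderiv f z l -> cderiv g z l.
Proof.
intros hd0 he h eps heps. destruct (h eps heps) as [d [hd H]].
exists (Rmin d0 d). split; [now apply Rmin_pos|]. intros w hw.
rewrite <- !he; [|rewrite Cmod_minus_self; lra|eapply Rlt_le_trans; [apply hw|apply Rmin_l]].
apply H. eapply Rlt_le_trans; [apply hw|apply Rmin_r].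
Qed.

Lemma cdiff_ext_loc (f g : C -> C) (z : C) (d0 : R) :
  0 < d0 -> (forall w, Cmod (w - z) < d0 -> f w = g w) -> cdiff f z -> cdiff g z.
Proof. intros h1 h2 [l h]. exists l. now apply (cderiv_ext_loc f g z l d0). Qed.

Lemma ccont_ext_loc (f g : C -> C) (z : C) (d0 : R) :
  0 < d0 -> (forall w, Cmod (w - z) < d0 -> f w = g w) -> ccont f z -> ccont g z.
Proof.
intros hd0 he h eps heps. destruct (h eps heps) as [d [hd H]].
exists (Rmin d0 d). split; [now apply Rmin_pos|]. intros w hw.
rewrite <- !he; [|rewrite Cmod_minus_self; lra|eapply Rlt_le_trans; [apply hw|apply Rmin_l]].
apply H. eapply Rlt_le_trans; [apply hw|apply Rmin_r].
Qed.

Lemma cderiv_const (c z : C) : cderiv (fun _ => c) z 0.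
Proof.
intros eps heps. exists 1. split; [lra|]. intros w _.
replace (c - c - 0 * (w - z))%C with (RtoC 0) by ring. rewrite Cmod_0.
apply Rmult_le_pos; [lra|apply Cmod_ge_0].
Qed.

Lemma cderiv_id (z : C) : cderiv (fun w => w) z 1.
Proof.
intros eps heps. exists 1. split; [lra|]. intros w _.
replace (w - z - 1 * (w - z))%C with (RtoC 0) by ring. rewrite Cmod_0.
apply Rmult_le_pos; [lra|apply Cmod_ge_0].
Qed.

Lemma cderiv_plus (f g : C -> C) (z l m : C) :
  cderiv f z l -> cderiv g z m -> cderiv (fun w => f w + g w)%C z (l + m).
Proof.
intros hf hg eps heps.
destruct (hf (eps / 2) ltac:(lra)) as [d1 [h1 H1]].
destruct (hg (eps / 2) ltac:(lra)) as [d2 [h2 H2]].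
exists (Rmin d1 d2). split; [now apply Rmin_pos|]. intros w hw.
specialize (H1 w (Rlt_le_trans _ _ _ hw (Rmin_l _ _))).
specialize (H2 w (Rlt_le_trans _ _ _ hw (Rmin_r _ _))).
replace (f w + g w - (f z + g z) - (l + m) * (w - z))%C
  with ((f w - f z - l * (w - z)) + (g w - g z - m * (w - z)))%C by ring.
eapply Rle_trans; [apply Cmod_triangle|]. lra.
Qed.

Lemma cderiv_mult (f g : C -> C) (z l m : C) :
  cderiv f z l -> cderiv g z m ->
  cderiv (fun w => f w * g w)%C z (l * g z + f z * m).
Proof.
intros hf hg eps heps.
(* [K] dominates [|g w|] for [w] near [z], [|f z|] and [|l|], so each of the three remainder terms
   below costs at most a third of [eps * |w - z|]. *)
assert (hK : 0 < 1 + Cmod (g z) + Cmod (f z) + Cmod l)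
  by (generalize (Cmod_ge_0 (g z)) (Cmod_ge_0 (f z)) (Cmod_ge_0 l); lra).
set (K := 1 + Cmod (g z) + Cmod (f z) + Cmod l) in *.
assert (he : 0 < eps / (3 * K)) by (apply Rdiv_lt_0_compat; lra).
destruct (hf _ he) as [d1 [h1 H1]].
destruct (hg _ he) as [d2 [h2 H2]].
destruct (cdiff_ccont g z (ex_intro _ m hg) (Rmin 1 (eps / (3 * K)))
  ltac:(apply Rmin_pos; lra)) as [d3 [h3 H3]].
exists (Rmin d1 (Rmin d2 d3)). split; [repeat apply Rmin_pos; assumption|]. intros w hw.
assert (w1 := Rlt_le_trans _ _ _ hw (Rmin_l _ _)).
assert (w2 := Rlt_le_trans _ _ _ hw (Rmin_r _ _)).
assert (w3 := Rlt_le_trans _ _ _ w2 (Rmin_r _ _)).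
assert (w4 := Rlt_le_trans _ _ _ w2 (Rmin_l _ _)).
specialize (H1 w w1). specialize (H2 w w4). specialize (H3 w w3).
assert (a3 := Rlt_le_trans _ _ _ H3 (Rmin_l _ _)).
assert (b3 := Rlt_le_trans _ _ _ H3 (Rmin_r _ _)).
assert (hg1 : Cmod (g w) <= K).
{ generalize (Cmod_rev_triangle (g w) (g z)).
  generalize (Cmod_ge_0 (f z)) (Cmod_ge_0 l). unfold K. lra. }
assert (hlK : Cmod l <= K) by (generalize (Cmod_ge_0 (g z)) (Cmod_ge_0 (f z)); unfold K; lra).
assert (hfK : Cmod (f z) <= K) by (generalize (Cmod_ge_0 (g z)) (Cmod_ge_0 l); unfold K; lra).
replace (f w * g w - f z * g z - (l * g z + f z * m) * (w - z))%C
  with ((f w - f z - l * (w - z)) * g w + f z * (g w - g z - m * (w - z))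
        + l * (w - z) * (g w - g z))%C by ring.
assert (hh := Cmod_ge_0 (w - z)).
assert (e1 : Cmod ((f w - f z - l * (w - z)) * g w) <= eps / (3 * K) * Cmod (w - z) * K).
{ rewrite Cmod_mult. apply Rmult_le_compat; auto using Cmod_ge_0. }
assert (e2 : Cmod (f z * (g w - g z - m * (w - z))) <= K * (eps / (3 * K) * Cmod (w - z))).
{ rewrite Cmod_mult. apply Rmult_le_compat; auto using Cmod_ge_0. }
assert (e3 : Cmod (l * (w - z) * (g w - g z)) <= K * Cmod (w - z) * (eps / (3 * K))).
{ rewrite !Cmod_mult. apply Rmult_le_compat; auto using Cmod_ge_0.
  - apply Rmult_le_pos; apply Cmod_ge_0.
  - apply Rmult_le_compat_r; auto.
  - lra. }
eapply Rle_trans; [apply Cmod_triangle|].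
eapply Rle_trans; [apply Rplus_le_compat_r, Cmod_triangle|].
replace (eps * Cmod (w - z)) with
  (eps / (3 * K) * Cmod (w - z) * K + K * (eps / (3 * K) * Cmod (w - z))
   + K * Cmod (w - z) * (eps / (3 * K))) by (field; lra).
lra.
Qed.

Lemma cderiv_inv (z : C) : z <> 0%C -> cderiv Cinv z (- / (z * z)).
Proof.
intros hz eps heps.
assert (pz := proj1 (Cmod_gt_0 z) hz).
set (r := Cmod z) in *.
(* The remainder is [(w - z)^2 / (z^2 w)]. The first radius keeps [|w| >= r / 2]; the second then
   absorbs one factor [|w - z|] over [r^3 / 2]. *)
exists (Rmin (r / 2) (eps * r ^ 3 / 2)).
split. { apply Rmin_pos; [lra|]. assert (0 < r ^ 3) by (apply pow_lt; lra). nra. }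
intros w hw.
assert (w1 := Rlt_le_trans _ _ _ hw (Rmin_l _ _)).
assert (w2 := Rlt_le_trans _ _ _ hw (Rmin_r _ _)).
assert (hwr : r / 2 <= Cmod w).
{ generalize (Cmod_rev_triangle z w). rewrite Cmod_minus_sym. fold r. lra. }
assert (hw0 : w <> 0%C) by (apply Cmod_gt_0; lra).
replace (/ w - / z - - / (z * z) * (w - z))%C
  with ((w - z) * (w - z) / (z * z * w))%C by (field; auto).
rewrite Cmod_div by (repeat apply Cmult_neq_0; auto).
rewrite !Cmod_mult. fold r.
assert (hh := Cmod_ge_0 (w - z)).
assert (0 < r * r * Cmod w) by (repeat apply Rmult_lt_0_compat; lra).
apply Rle_div_l; [lra|].
assert (hr3 : eps * r ^ 3 / 2 <= eps * (r * r * Cmod w)).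
{ replace (eps * r ^ 3 / 2) with (eps * (r * r * (r / 2))) by field.
  apply Rmult_le_compat_l; [lra|]. apply Rmult_le_compat_l; [nra|lra]. }
nra.
Qed.

Lemma cderiv_comp (f g : C -> C) (z l m : C) :
  cderiv g z m -> cderiv f (g z) l -> cderiv (fun w => f (g w)) z (l * m).
Proof.
intros hg hf eps heps.
assert (hl := Cmod_ge_0 l). assert (hm := Cmod_ge_0 m).
assert (h2 : 0 < eps / (2 * (1 + Cmod l))) by (apply Rdiv_lt_0_compat; lra).
assert (h1 : 0 < eps / (2 * (1 + Cmod m))) by (apply Rdiv_lt_0_compat; lra).
destruct (hf _ h1) as [d1 [p1 H1]].
destruct (hg _ h2) as [d2 [p2 H2]].
destruct (hg 1 ltac:(lra)) as [d3 [p3 H3]].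
destruct (cdiff_ccont g z (ex_intro _ m hg) d1 p1) as [d4 [p4 H4]].
exists (Rmin d2 (Rmin d3 d4)). split; [repeat apply Rmin_pos; assumption|]. intros w hw.
assert (w1 := Rlt_le_trans _ _ _ hw (Rmin_l _ _)).
assert (w2 := Rlt_le_trans _ _ _ hw (Rmin_r _ _)).
assert (w3 := Rlt_le_trans _ _ _ w2 (Rmin_r _ _)).
assert (w4 := Rlt_le_trans _ _ _ w2 (Rmin_l _ _)).
specialize (H2 w w1). specialize (H3 w w4). specialize (H1 (g w) (H4 w w3)).
assert (hh := Cmod_ge_0 (w - z)).
assert (hgw : Cmod (g w - g z) <= (1 + Cmod m) * Cmod (w - z)).
{ replace (g w - g z)%C with ((g w - g z - m * (w - z)) + m * (w - z))%C by ring.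
  eapply Rle_trans; [apply Cmod_triangle|]. rewrite Cmod_mult. lra. }
replace (f (g w) - f (g z) - l * m * (w - z))%C
  with ((f (g w) - f (g z) - l * (g w - g z)) + l * (g w - g z - m * (w - z)))%C by ring.
eapply Rle_trans; [apply Cmod_triangle|]. rewrite Cmod_mult.
assert (e1 : Cmod (f (g w) - f (g z) - l * (g w - g z))
  <= eps / (2 * (1 + Cmod m)) * ((1 + Cmod m) * Cmod (w - z))).
{ eapply Rle_trans; [apply H1|]. apply Rmult_le_compat_l; lra. }
assert (e2 : Cmod l * Cmod (g w - g z - m * (w - z))
  <= (1 + Cmod l) * (eps / (2 * (1 + Cmod l)) * Cmod (w - z))).
{ apply Rmult_le_compat; auto using Cmod_ge_0. lra. }
replace (eps / (2 * (1 + Cmod m)) * ((1 + Cmod m) * Cmod (w - z)))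
  with (eps / 2 * Cmod (w - z)) in e1 by (field; lra).
replace ((1 + Cmod l) * (eps / (2 * (1 + Cmod l)) * Cmod (w - z)))
  with (eps / 2 * Cmod (w - z)) in e2 by (field; lra).
lra.
Qed.

Lemma cdiff_const (c z : C) : cdiff (fun _ => c) z.
Proof. exists 0%C. apply cderiv_const. Qed.

Lemma cdiff_id (z : C) : cdiff (fun w => w) z.
Proof. exists 1%C. apply cderiv_id. Qed.

Lemma cdiff_mult (f g : C -> C) (z : C) :
  cdiff f z -> cdiff g z -> cdiff (fun w => f w * g w)%C z.
Proof. intros [l hl] [m hm]. eexists. now apply cderiv_mult; eassumption. Qed.

Lemma cdiff_plus (f g : C -> C) (z : C) :
  cdiff f z -> cdiff g z -> cdiff (fun w => f w + g w)%C z.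
Proof. intros [l hl] [m hm]. eexists. now apply cderiv_plus; eassumption. Qed.

Lemma cdiff_opp (f : C -> C) (z : C) : cdiff f z -> cdiff (fun w => - f w)%C z.
Proof.
intros h. apply (cdiff_ext_loc (fun w => (- (1)) * f w)%C _ z 1); [lra|intros; ring|].
apply cdiff_mult; [apply cdiff_const|exact h].
Qed.

Lemma cdiff_minus (f g : C -> C) (z : C) :
  cdiff f z -> cdiff g z -> cdiff (fun w => f w - g w)%C z.
Proof. intros hf hg. apply (cdiff_plus f (fun w => - g w)%C); [exact hf|now apply cdiff_opp]. Qed.

Lemma cdiff_inv (f : C -> C) (z : C) :
  cdiff f z -> f z <> 0%C -> cdiff (fun w => / f w)%C z.
Proof.
intros [l hl] hz. eexists. apply (cderiv_comp Cinv f); [exact hl|now apply cderiv_inv].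
Qed.

Lemma cdiff_div (f g : C -> C) (z : C) :
  cdiff f z -> cdiff g z -> g z <> 0%C -> cdiff (fun w => f w / g w)%C z.
Proof. intros hf hg h. apply (cdiff_mult f (fun w => / g w)%C); auto using cdiff_inv. Qed.

Lemma cdiff_inv_minus (c z : C) : z <> c -> cdiff (fun w => / (w - c))%C z.
Proof.
intros h. apply (cdiff_inv (fun w => w - c)%C); [|now apply Cminus_neq_0].
apply cdiff_minus; [apply cdiff_id|apply cdiff_const].
Qed.

Lemma im_le_Cmod (c : C) : Rabs (Im c) <= Cmod c.
Proof. eapply Rle_trans; [|apply Rmax_Cmod]. apply Rmax_r. Qed.

Lemma C_complete (u : nat -> C) :
  (forall eps, 0 < eps -> exists N, forall n m, (N <= n)%nat -> (N <= m)%nat ->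
     Cmod (u n - u m) <= eps) ->
  exists c, forall eps, 0 < eps -> exists N, forall n, (N <= n)%nat -> Cmod (u n - c) <= eps.
Proof.
intros h.
assert (hre : Cauchy_crit (fun n => Re (u n))).
{ intros eps heps. destruct (h (eps / 2) ltac:(lra)) as [N hN]. exists N.
  intros n m hn hm. unfold Rdist.
  replace (Re (u n) - Re (u m)) with (Re (u n - u m)%C) by (unfold Re, Im; simpl; ring).
  eapply Rle_lt_trans; [apply re_le_Cmod|]. specialize (hN n m hn hm). lra. }
assert (him : Cauchy_crit (fun n => Im (u n))).
{ intros eps heps. destruct (h (eps / 2) ltac:(lra)) as [N hN]. exists N.
  intros n m hn hm. unfold Rdist.
  replace (Im (u n) - Im (u m)) with (Im (u n - u m)%C) by (unfold Re, Im; simpl; ring).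
  eapply Rle_lt_trans; [apply im_le_Cmod|].
  specialize (hN n m hn hm). lra. }
destruct (Rcomplete.R_complete _ hre) as [x hx]. destruct (Rcomplete.R_complete _ him) as [y hy].
exists (x, y). intros eps heps.
destruct (h (eps / 2) ltac:(lra)) as [N1 h1].
destruct (hx (eps / 2) ltac:(lra)) as [N2 h2].
destruct (hy (eps / 2) ltac:(lra)) as [N3 h3].
exists (max N1 (max N2 N3)). intros n hn.
specialize (h2 n ltac:(lia)). specialize (h3 n ltac:(lia)). unfold Rdist in *.
replace (u n - (x, y))%C with (RtoC (Re (u n) - x) + Ci * RtoC (Im (u n) - y))%C
  by (apply injective_projections; simpl; unfold Re, Im; ring).
eapply Rle_trans; [apply Cmod_triangle|].
rewrite Cmod_mult, !Cmod_R, Cmod_Ci. lra.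
Qed.

(** * Integrals along segments *)

(** Taken componentwise so that substitution, Chasles' relation and the fundamental theorem are
    those of real integrals. *)
Definition cint (g : R -> C) : C :=
  (RInt (fun t => Re (g t)) 0 1, RInt (fun t => Im (g t)) 0 1).

Definition cintegrable (g : R -> C) : Prop :=
  ex_RInt (fun t => Re (g t)) 0 1 /\ ex_RInt (fun t => Im (g t)) 0 1.

Lemma cint_ext (g h : R -> C) :
  (forall t, 0 <= t <= 1 -> g t = h t) -> cint g = cint h.
Proof.
intros H. unfold cint. f_equal; apply RInt_ext; intros t ht;
  rewrite Rmin_left, Rmax_right in ht by lra; rewrite H; auto; lra.
Qed.

Lemma cintegrable_plus (g h : R -> C) :
  cintegrable g -> cintegrable h -> cintegrable (fun t => g t + h t)%C.
Proof.
intros [g1 g2] [h1 h2].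
split; [exact (@ex_RInt_plus R_NormedModule _ _ _ _ g1 h1)
       |exact (@ex_RInt_plus R_NormedModule _ _ _ _ g2 h2)].
Qed.

Lemma cint_plus (g h : R -> C) :
  cintegrable g -> cintegrable h -> cint (fun t => g t + h t)%C = (cint g + cint h)%C.
Proof.
intros [g1 g2] [h1 h2].
exact (f_equal2 pair (@RInt_plus R_CompleteNormedModule _ _ _ _ g1 h1)
         (@RInt_plus R_CompleteNormedModule _ _ _ _ g2 h2)).
Qed.

Lemma RInt_lin (a b : R) (g h : R -> R) :
  ex_RInt g 0 1 -> ex_RInt h 0 1 ->
  is_RInt (fun t => a * g t + b * h t) 0 1 (a * RInt g 0 1 + b * RInt h 0 1).
Proof.
intros hg hh.
exact (@is_RInt_plus R_NormedModule _ _ _ _ _ _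
  (@is_RInt_scal R_NormedModule _ _ _ a _ (@RInt_correct R_CompleteNormedModule _ _ _ hg))
  (@is_RInt_scal R_NormedModule _ _ _ b _ (@RInt_correct R_CompleteNormedModule _ _ _ hh))).
Qed.

Lemma cint_scal_aux (c : C) (g : R -> C) :
  cintegrable g -> cintegrable (fun t => c * g t)%C /\ cint (fun t => c * g t)%C = (c * cint g)%C.
Proof.
intros [g1 g2].
assert (h1 : is_RInt (fun t => Re (c * g t)%C) 0 1 (Re (c * cint g)%C)).
{ apply (is_RInt_ext (fun t => Re c * Re (g t) + (- Im c) * Im (g t))).
  - intros t _. unfold Re, Im; simpl. ring.
  - replace (Re (c * cint g)%C) with (Re c * Re (cint g) + (- Im c) * Im (cint g))
      by (unfold Re, Im; simpl; ring).
    apply RInt_lin; assumption. }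
assert (h2 : is_RInt (fun t => Im (c * g t)%C) 0 1 (Im (c * cint g)%C)).
{ apply (is_RInt_ext (fun t => Im c * Re (g t) + Re c * Im (g t))).
  - intros t _. unfold Re, Im; simpl. ring.
  - replace (Im (c * cint g)%C) with (Im c * Re (cint g) + Re c * Im (cint g))
      by (unfold Re, Im; simpl; ring).
    apply RInt_lin; assumption. }
split; [split; eexists; eassumption|].
apply injective_projections; simpl; [exact (is_RInt_unique _ _ _ _ h1)|exact (is_RInt_unique _ _ _ _ h2)].
Qed.

Lemma cintegrable_scal (c : C) (g : R -> C) :
  cintegrable g -> cintegrable (fun t => c * g t)%C.
Proof. intros h. now apply cint_scal_aux. Qed.

Lemma cint_scal (c : C) (g : R -> C) :
  cintegrable g -> cint (fun t => c * g t)%C = (c * cint g)%C.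
Proof. intros h. now apply cint_scal_aux. Qed.

Lemma Cmod_le_Re_Im (z : C) : Cmod z <= Rabs (Re z) + Rabs (Im z).
Proof.
replace z with (RtoC (Re z) + Ci * RtoC (Im z))%C at 1
  by (apply injective_projections; simpl; unfold Re, Im; ring).
eapply Rle_trans; [apply Cmod_triangle|]. rewrite Cmod_mult, !Cmod_R, Cmod_Ci. lra.
Qed.

Lemma RInt_abs_le (g : R -> R) (M : R) :
  (forall t, 0 <= t <= 1 -> Rabs (g t) <= M) -> ex_RInt g 0 1 -> Rabs (RInt g 0 1) <= M.
Proof.
intros h hg.
apply (@norm_RInt_le R_NormedModule g (fun _ => M) 0 1 _ M); [lra|exact h| |].
- exact (RInt_correct g 0 1 hg).
- assert (H := @is_RInt_const R_NormedModule 0 1 M).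
  change (is_RInt (fun _ : R => M) 0 1 ((1 - 0) * M)) in H.
  now rewrite Rminus_0_r, Rmult_1_l in H.
Qed.

(** Real and imaginary parts are bounded separately, whence the factor 2; the sharp constant never
    matters. *)
Lemma cint_le (g : R -> C) (M : R) :
  (forall t, 0 <= t <= 1 -> Cmod (g t) <= M) -> cintegrable g -> Cmod (cint g) <= 2 * M.
Proof.
intros h [g1 g2]. eapply Rle_trans; [apply Cmod_le_Re_Im|].
assert (a1 : Rabs (Re (cint g)) <= M).
{ apply RInt_abs_le; [|exact g1]. intros t ht.
  eapply Rle_trans; [apply re_le_Cmod|auto]. }
assert (a2 : Rabs (Im (cint g)) <= M).
{ apply RInt_abs_le; [|exact g2]. intros t ht.
  eapply Rle_trans; [apply im_le_Cmod|auto]. }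
lra.
Qed.

Lemma segment_minus (p q : C) (t x : R) :
  (segment p q t - segment p q x = RtoC (t - x) * (q - p))%C.
Proof. unfold segment. rewrite RtoC_minus. ring. Qed.

Lemma segment_0 (p q : C) : segment p q 0 = p.
Proof. unfold segment. ring. Qed.

Lemma segment_1 (p q : C) : segment p q 1 = q.
Proof. unfold segment. ring. Qed.

Lemma segment_near (p q : C) (x d : R) : 0 < d ->
  exists e, 0 < e /\ forall t, Rabs (t - x) < e -> Cmod (segment p q t - segment p q x) < d.
Proof.
intros hd. generalize (Cmod_ge_0 (q - p)). intros hc.
exists (d / (1 + Cmod (q - p))). split; [apply Rdiv_lt_0_compat; lra|].
intros t ht. rewrite segment_minus, Cmod_mult, Cmod_R.
apply Rlt_div_r in ht; [|lra].
generalize (Rabs_pos (t - x)). nra.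
Qed.

Lemma ccont_segment (phi : C -> C) (p q c : C) (t : R) :
  ccont phi (segment p q t) ->
  continuous (fun t => Re (c * phi (segment p q t))%C) t /\
  continuous (fun t => Im (c * phi (segment p q t))%C) t.
Proof.
intros h.
assert (H : forall eps, 0 < eps -> exists e, 0 < e /\ forall x, Rabs (x - t) < e ->
   Cmod (c * phi (segment p q x) - c * phi (segment p q t)) < eps).
{ intros eps heps. generalize (Cmod_ge_0 c). intros hc.
  destruct (h (eps / (1 + Cmod c))) as [d [hd Hd]]; [apply Rdiv_lt_0_compat; lra|].
  destruct (segment_near p q t d hd) as [e [he He]]. exists e. split; [exact he|].
  intros x hx. specialize (Hd _ (He x hx)).
  replace (c * phi (segment p q x) - c * phi (segment p q t))%C
    with (c * (phi (segment p q x) - phi (segment p q t)))%C by ring.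
  rewrite Cmod_mult. apply Rlt_div_r in Hd; [|lra].
  generalize (Cmod_ge_0 (phi (segment p q x) - phi (segment p q t))). nra. }
split; apply filterlim_locally; intros eps;
  destruct (H eps (cond_pos eps)) as [e [he He]];
  exists (mkposreal e he); intros x hx; specialize (He x hx).
- eapply Rle_lt_trans; [|exact He].
  eapply Rle_trans; [|apply re_le_Cmod]. right. reflexivity.
- eapply Rle_lt_trans; [|exact He].
  eapply Rle_trans; [|apply im_le_Cmod]. right. reflexivity.
Qed.

Definition seg_cont (phi : C -> C) (p q : C) : Prop :=
  forall t, 0 <= t <= 1 -> ccont phi (segment p q t).

Definition seg_int (phi : C -> C) (p q : C) : C :=
  cint (fun t => (q - p) * phi (segment p q t))%C.

Lemma seg_cintegrable (phi : C -> C) (p q c : C) :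
  seg_cont phi p q -> cintegrable (fun t => c * phi (segment p q t))%C.
Proof.
intros h. split; apply (@ex_RInt_continuous R_CompleteNormedModule); intros t ht;
  rewrite Rmin_left, Rmax_right in ht by lra.
- exact (proj1 (ccont_segment phi p q c t (h t ht))).
- exact (proj2 (ccont_segment phi p q c t (h t ht))).
Qed.

Lemma seg_int_ext (phi psi : C -> C) (p q : C) :
  (forall t, 0 <= t <= 1 -> phi (segment p q t) = psi (segment p q t)) ->
  seg_int phi p q = seg_int psi p q.
Proof. intros h. apply cint_ext. intros t ht. now rewrite h. Qed.

Lemma seg_int_plus (phi psi : C -> C) (p q : C) :
  seg_cont phi p q -> seg_cont psi p q ->
  seg_int (fun z => phi z + psi z)%C p q = (seg_int phi p q + seg_int psi p q)%C.
Proof.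
intros h1 h2. unfold seg_int.
rewrite <- cint_plus by now apply seg_cintegrable.
apply cint_ext. intros; ring.
Qed.

Lemma seg_int_scal (c : C) (phi : C -> C) (p q : C) :
  seg_cont phi p q -> seg_int (fun z => c * phi z)%C p q = (c * seg_int phi p q)%C.
Proof.
intros h. unfold seg_int. rewrite <- cint_scal by now apply seg_cintegrable.
apply cint_ext. intros; ring.
Qed.

Lemma seg_int_le (phi : C -> C) (p q : C) (M : R) :
  seg_cont phi p q -> (forall t, 0 <= t <= 1 -> Cmod (phi (segment p q t)) <= M) ->
  Cmod (seg_int phi p q) <= 2 * (Cmod (q - p) * M).
Proof.
intros h hM. apply cint_le; [|now apply seg_cintegrable].
intros t ht. rewrite Cmod_mult. apply Rmult_le_compat_l; [apply Cmod_ge_0|auto].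
Qed.

Lemma is_RInt_real_deriv (f df : R -> R) :
  (forall t, 0 <= t <= 1 -> is_derive f t (df t)) ->
  (forall t, 0 <= t <= 1 -> continuous df t) ->
  RInt df 0 1 = f 1 - f 0.
Proof.
intros h1 h2. apply is_RInt_unique.
apply (@is_RInt_derive R_CompleteNormedModule f df 0 1); intros t ht;
  rewrite Rmin_left, Rmax_right in ht by lra; auto.
Qed.

Lemma seg_int_deriv (Phi phi : C -> C) (p q : C) :
  seg_cont phi p q ->
  (forall t, 0 <= t <= 1 -> cderiv Phi (segment p q t) (phi (segment p q t))) ->
  seg_int phi p q = (Phi q - Phi p)%C.
Proof.
intros hc h.
(* The chain rule along the segment, in complex form; both real derivatives are read off it.
   [segment] is defined for every real parameter, so the derivatives at 0 and 1 are two-sided. *)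
assert (H : forall t, 0 <= t <= 1 -> forall eps, 0 < eps -> exists e, 0 < e /\
  forall x, x <> 0 -> Rabs x < e ->
   Cmod (/ RtoC x * (Phi (segment p q (t + x)) - Phi (segment p q t))
         - (q - p) * phi (segment p q t)) < eps).
{ intros t ht eps heps. generalize (Cmod_ge_0 (q - p)). intros hpq.
  destruct (h t ht (eps / (1 + Cmod (q - p)))) as [d [hd Hd]];
    [apply Rdiv_lt_0_compat; lra|].
  destruct (segment_near p q t d hd) as [e [he He]]. exists e. split; [exact he|].
  intros x hx0 hx. specialize (He (t + x)). replace (t + x - t) with x in He by ring.
  specialize (Hd _ (He hx)). rewrite segment_minus in Hd.
  replace (t + x - t) with x in Hd by ring.
  assert (hxC : RtoC x <> 0%C) by (intros e0; apply hx0; now apply RtoC_inj).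
  replace (/ RtoC x * (Phi (segment p q (t + x)) - Phi (segment p q t))
         - (q - p) * phi (segment p q t))%C
    with (/ RtoC x * (Phi (segment p q (t + x)) - Phi (segment p q t)
         - phi (segment p q t) * (RtoC x * (q - p))))%C by (field; exact hxC).
  rewrite Cmod_mult, Cmod_inv, Cmod_R by exact hxC.
  assert (hax : 0 < Rabs x) by now apply Rabs_pos_lt.
  apply (Rmult_lt_reg_l (Rabs x)); [exact hax|].
  rewrite <- Rmult_assoc, Rinv_r, Rmult_1_l by lra.
  eapply Rle_lt_trans; [exact Hd|]. rewrite Cmod_mult, Cmod_R.
  replace (eps / (1 + Cmod (q - p)) * (Rabs x * Cmod (q - p)))
    with (Rabs x * (eps * Cmod (q - p) / (1 + Cmod (q - p)))) by (field; lra).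
  apply Rmult_lt_compat_l; [exact hax|]. apply Rlt_div_l; [lra|]. nra. }
unfold seg_int, cint. apply injective_projections; simpl fst; simpl snd.
- rewrite (is_RInt_real_deriv (fun t => Re (Phi (segment p q t)))).
  + rewrite segment_0, segment_1. reflexivity.
  + intros t ht. apply is_derive_Reals. intros eps heps.
    destruct (H t ht eps heps) as [e [he He]]. exists (mkposreal e he). intros x hx0 hx.
    eapply Rle_lt_trans; [|apply (He x hx0 hx)].
    eapply Rle_trans; [|apply re_le_Cmod]. right. f_equal.
    assert (e1 : (/ RtoC x)%C = RtoC (/ x)) by (symmetry; now apply RtoC_inv).
    rewrite e1. unfold Re; simpl. unfold Rdiv. ring.
  + intros t ht. exact (proj1 (ccont_segment phi p q (q - p) t (hc t ht))).
- rewrite (is_RInt_real_deriv (fun t => Im (Phi (segment p q t)))).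
  + rewrite segment_0, segment_1. reflexivity.
  + intros t ht. apply is_derive_Reals. intros eps heps.
    destruct (H t ht eps heps) as [e [he He]]. exists (mkposreal e he). intros x hx0 hx.
    eapply Rle_lt_trans; [|apply (He x hx0 hx)].
    eapply Rle_trans; [|apply im_le_Cmod]. right. f_equal.
    assert (e1 : (/ RtoC x)%C = RtoC (/ x)) by (symmetry; now apply RtoC_inv).
    rewrite e1. unfold Im; simpl. unfold Rdiv. ring.
  + intros t ht. exact (proj2 (ccont_segment phi p q (q - p) t (hc t ht))).
Qed.

Lemma RInt_affine (g : R -> R) (u v : R) :
  ex_RInt g v (u + v) -> RInt (fun t => u * g (u * t + v)) 0 1 = RInt g v (u + v).
Proof.
intros h.
generalize (@RInt_comp_lin R_CompleteNormedModule g u v 0 1).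
replace (u * 0 + v) with v by ring. replace (u * 1 + v) with (u + v) by ring.
intros H. exact (H h).
Qed.

Lemma segment_segment_l (p q : C) (tau t : R) :
  segment p (segment p q tau) t = segment p q (tau * t + 0).
Proof. unfold segment. rewrite Rplus_0_r, RtoC_mult. ring. Qed.

Lemma segment_segment_r (p q : C) (tau t : R) :
  segment (segment p q tau) q t = segment p q ((1 - tau) * t + tau).
Proof. unfold segment. rewrite RtoC_plus, RtoC_mult, RtoC_minus. ring. Qed.

Lemma segment_rev (p q : C) (t : R) : segment q p t = segment p q (- 1 * t + 1).
Proof. unfold segment. rewrite RtoC_plus, RtoC_mult. unfold RtoC.
apply injective_projections; simpl; ring. Qed.

Lemma seg_int_split (phi : C -> C) (p q : C) (tau : R) :
  0 <= tau <= 1 -> seg_cont phi p q ->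
  seg_int phi p q =
  (seg_int phi p (segment p q tau) + seg_int phi (segment p q tau) q)%C.
Proof.
intros ht h.
destruct (seg_cintegrable phi p q (q - p) h) as [i1 i2].
(* The additivity is proved for real functions of the parameter, by two affine substitutions onto
   [[0, tau]] and [[tau, 1]]; it is then applied to both components. *)
assert (S : forall g : R -> R, ex_RInt g 0 1 ->
  RInt g 0 1 = RInt (fun t => tau * g (tau * t + 0)) 0 1
    + RInt (fun t => (1 - tau) * g ((1 - tau) * t + tau)) 0 1).
{ intros g hg.
  assert (g1 : ex_RInt g 0 tau) by now apply (ex_RInt_Chasles_1 g 0 tau 1).
  assert (g2 : ex_RInt g tau 1) by now apply (ex_RInt_Chasles_2 g 0 tau 1).
  rewrite (RInt_affine g tau 0) by (rewrite Rplus_0_r; exact g1).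
  rewrite (RInt_affine g (1 - tau) tau)
    by (replace (1 - tau + tau) with 1 by ring; exact g2).
  rewrite Rplus_0_r. replace (1 - tau + tau) with 1 by ring.
  symmetry. exact (RInt_Chasles g 0 tau 1 g1 g2). }
unfold seg_int at 1, cint. rewrite (S _ i1), (S _ i2).
assert (e1 : (segment p q tau - p = RtoC tau * (q - p))%C) by (unfold segment; ring).
assert (e2 : (q - segment p q tau = RtoC (1 - tau) * (q - p))%C)
  by (unfold segment; rewrite RtoC_minus; ring).
unfold seg_int, cint. rewrite e1, e2.
apply injective_projections; simpl; f_equal; apply RInt_ext; intros t _;
  rewrite ?segment_segment_l, ?segment_segment_r; unfold Re, Im; simpl; ring.
Qed.

Lemma seg_int_rev (phi : C -> C) (p q : C) :
  seg_cont phi p q -> seg_int phi q p = (- seg_int phi p q)%C.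
Proof.
intros h.
destruct (seg_cintegrable phi p q (q - p) h) as [i1 i2].
assert (S : forall g : R -> R, ex_RInt g 0 1 ->
  RInt (fun t => - 1 * g (- 1 * t + 1)) 0 1 = - RInt g 0 1).
{ intros g hg. rewrite (RInt_affine g (- 1) 1).
  - replace (- 1 + 1) with 0 by ring. symmetry. exact (opp_RInt_swap g 0 1 hg).
  - replace (- 1 + 1) with 0 by ring. now apply ex_RInt_swap. }
unfold seg_int, cint, Copp. apply injective_projections; unfold fst, snd.
- rewrite <- (S _ i1). apply RInt_ext. intros t _. rewrite segment_rev.
  unfold Re, Im; simpl; ring.
- rewrite <- (S _ i2). apply RInt_ext. intros t _. rewrite segment_rev.
  unfold Re, Im; simpl; ring.
Qed.

(** * Contours and Goursat's lemma *)

Fixpoint path_int (phi : C -> C) (G : contour) : C :=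
  match G with
  | nil => 0%C
  | (p, q) :: G' => (seg_int phi p q + path_int phi G')%C
  end.

Fixpoint path_length (G : contour) : R :=
  match G with
  | nil => 0
  | (p, q) :: G' => Cmod (q - p) + path_length G'
  end.

Definition path_cont (phi : C -> C) (G : contour) : Prop :=
  forall z, on_contour G z -> ccont phi z.

Definition closed_path (G : contour) : Prop := Permutation (map fst G) (map snd G).

Lemma on_contour_hd (p q : C) (G : contour) (t : R) :
  0 <= t <= 1 -> on_contour ((p, q) :: G) (segment p q t).
Proof. intros h. exists p, q, t. split; [now left|auto]. Qed.

Lemma on_contour_tl (pq : C * C) (G : contour) (z : C) :
  on_contour G z -> on_contour (pq :: G) z.
Proof. intros (p & q & t & h1 & h2). exists p, q, t. split; [now right|auto]. Qed.

Lemma path_cont_hd (phi : C -> C) (p q : C) (G : contour) :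
  path_cont phi ((p, q) :: G) -> seg_cont phi p q.
Proof. intros h t ht. now apply h, on_contour_hd. Qed.

Lemma path_cont_tl (phi : C -> C) (pq : C * C) (G : contour) :
  path_cont phi (pq :: G) -> path_cont phi G.
Proof. intros h z hz. now apply h, on_contour_tl. Qed.

Lemma path_length_ge0 (G : contour) : 0 <= path_length G.
Proof.
induction G as [|[p q] G IH]; simpl; [lra|]. generalize (Cmod_ge_0 (q - p)); lra.
Qed.

Lemma path_int_ext (phi psi : C -> C) (G : contour) :
  (forall z, on_contour G z -> phi z = psi z) -> path_int phi G = path_int psi G.
Proof.
induction G as [|[p q] G IH]; intros h; [reflexivity|]. simpl. f_equal.
- apply seg_int_ext. intros t ht. now apply h, on_contour_hd.
- apply IH. intros z hz. now apply h, on_contour_tl.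
Qed.

Lemma path_int_plus (phi psi : C -> C) (G : contour) :
  path_cont phi G -> path_cont psi G ->
  path_int (fun z => phi z + psi z)%C G = (path_int phi G + path_int psi G)%C.
Proof.
induction G as [|[p q] G IH]; intros h1 h2; simpl; [ring|].
rewrite IH, seg_int_plus by eauto using path_cont_hd, path_cont_tl. ring.
Qed.

Lemma path_int_scal (c : C) (phi : C -> C) (G : contour) :
  path_cont phi G -> path_int (fun z => c * phi z)%C G = (c * path_int phi G)%C.
Proof.
induction G as [|[p q] G IH]; intros h1; simpl; [ring|].
rewrite IH, seg_int_scal by eauto using path_cont_hd, path_cont_tl. ring.
Qed.

Lemma ccont_const (c z : C) : ccont (fun _ => c) z.
Proof. apply cdiff_ccont, cdiff_const. Qed.

Lemma ccont_scal (c : C) (f : C -> C) (z : C) : ccont f z -> ccont (fun w => c * f w)%C z.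
Proof.
intros h eps heps. generalize (Cmod_ge_0 c). intros hc.
destruct (h (eps / (1 + Cmod c))) as [d [hd Hd]]; [apply Rdiv_lt_0_compat; lra|].
exists d. split; [exact hd|]. intros w hw. specialize (Hd w hw).
replace (c * f w - c * f z)%C with (c * (f w - f z))%C by ring.
rewrite Cmod_mult. apply Rlt_div_r in Hd; [|lra].
generalize (Cmod_ge_0 (f w - f z)). nra.
Qed.

Lemma ccont_plus (f g : C -> C) (z : C) :
  ccont f z -> ccont g z -> ccont (fun w => f w + g w)%C z.
Proof.
intros hf hg eps heps.
destruct (hf (eps / 2) ltac:(lra)) as [d1 [h1 H1]].
destruct (hg (eps / 2) ltac:(lra)) as [d2 [h2 H2]].
exists (Rmin d1 d2). split; [now apply Rmin_pos|]. intros w hw.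
specialize (H1 w (Rlt_le_trans _ _ _ hw (Rmin_l _ _))).
specialize (H2 w (Rlt_le_trans _ _ _ hw (Rmin_r _ _))).
replace (f w + g w - (f z + g z))%C with ((f w - f z) + (g w - g z))%C by ring.
eapply Rle_lt_trans; [apply Cmod_triangle|]. lra.
Qed.

Lemma ccont_minus (f g : C -> C) (z : C) :
  ccont f z -> ccont g z -> ccont (fun w => f w - g w)%C z.
Proof.
intros hf hg. apply (ccont_ext_loc (fun w => f w + (- (1)) * g w)%C _ z 1); [lra|intros; ring|].
apply ccont_plus; [exact hf|now apply ccont_scal].
Qed.

Lemma path_int_minus (phi psi : C -> C) (G : contour) :
  path_cont phi G -> path_cont psi G ->
  path_int (fun z => phi z - psi z)%C G = (path_int phi G - path_int psi G)%C.
Proof.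
intros h1 h2.
rewrite (path_int_ext _ (fun z => phi z + (- (1)) * psi z)%C) by (intros; ring).
rewrite path_int_plus, path_int_scal; auto; [ring|].
intros z hz. now apply ccont_scal, h2.
Qed.

Lemma path_int_le (phi : C -> C) (G : contour) (M : R) :
  path_cont phi G -> (forall z, on_contour G z -> Cmod (phi z) <= M) ->
  Cmod (path_int phi G) <= 2 * (path_length G * M).
Proof.
induction G as [|[p q] G IH]; intros h1 h2; simpl.
- rewrite Cmod_0. lra.
- eapply Rle_trans; [apply Cmod_triangle|].
  assert (a1 : Cmod (seg_int phi p q) <= 2 * (Cmod (q - p) * M)).
  { apply seg_int_le; [eauto using path_cont_hd|]. intros t ht. now apply h2, on_contour_hd. }
  assert (a2 : Cmod (path_int phi G) <= 2 * (path_length G * M)).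
  { apply IH; [eauto using path_cont_tl|]. intros z hz. now apply h2, on_contour_tl. }
  lra.
Qed.

Lemma sum_perm (Phi : C -> C) (l l' : list C) : Permutation l l' ->
  fold_right (fun z s => Phi z + s)%C 0%C l = fold_right (fun z s => Phi z + s)%C 0%C l'.
Proof.
induction 1; simpl; try congruence. ring.
Qed.

(** Each segment contributes the value of the primitive at its end minus that at its start. The
    starts are a permutation of the ends, so the total cancels even if the segments are listed in
    disorder or form several polygons. *)
Lemma path_int_deriv_closed (Phi phi : C -> C) (G : contour) :
  closed_path G -> path_cont phi G ->
  (forall z, on_contour G z -> cderiv Phi z (phi z)) ->
  path_int phi G = 0%C.
Proof.
intros hG h1 h2.
assert (H : path_int phi G = (fold_right (fun z s => Phi z + s)%C 0%C (map snd G)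
   - fold_right (fun z s => Phi z + s)%C 0%C (map fst G))%C).
{ clear hG. induction G as [|[p q] G IH]; simpl; [ring|].
  rewrite IH, (seg_int_deriv Phi).
  - ring.
  - eauto using path_cont_hd.
  - intros t ht. now apply h2, on_contour_hd.
  - eauto using path_cont_tl.
  - intros z hz. now apply h2, on_contour_tl. }
rewrite H, (sum_perm Phi _ _ hG). ring.
Qed.

Lemma segment_bounded (phi : C -> C) (p q : C) :
  seg_cont phi p q -> exists M, forall t, 0 <= t <= 1 -> Cmod (phi (segment p q t)) <= M.
Proof.
intros h.
destruct (@bounded_continuity R_AbsRing R_NormedModule
  (fun t => Re (1 * phi (segment p q t))%C) 0 1) as [M1 H1].
{ intros t ht. exact (proj1 (ccont_segment phi p q 1 t (h t ht))). }
destruct (@bounded_continuity R_AbsRing R_NormedModule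
  (fun t => Im (1 * phi (segment p q t))%C) 0 1) as [M2 H2].
{ intros t ht. exact (proj2 (ccont_segment phi p q 1 t (h t ht))). }
exists (M1 + M2). intros t ht. specialize (H1 t ht). specialize (H2 t ht).
rewrite Cmult_1_l in H1, H2.
change (Rabs (Re (phi (segment p q t))) < M1) in H1.
change (Rabs (Im (phi (segment p q t))) < M2) in H2.
generalize (Cmod_le_Re_Im (phi (segment p q t))). lra.
Qed.

Lemma path_bounded (phi : C -> C) (G : contour) :
  path_cont phi G -> exists M, 0 < M /\ forall z, on_contour G z -> Cmod (phi z) <= M.
Proof.
induction G as [|[p q] G IH]; intros h.
- exists 1. split; [lra|]. intros z (p & q & t & [] & _).
- destruct IH as [M1 [h1 H1]]; [eauto using path_cont_tl|].
  destruct (segment_bounded phi p q) as [M2 H2]; [eauto using path_cont_hd|].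
  exists (Rmax M1 M2). split; [eapply Rlt_le_trans; [exact h1|apply Rmax_l]|].
  intros z (p' & q' & t & [e|hin] & ht & ->).
  + injection e as <- <-. eapply Rle_trans; [apply H2, ht|apply Rmax_r].
  + eapply Rle_trans; [apply H1; exists p', q', t; auto|apply Rmax_l].
Qed.

Definition tri_int (phi : C -> C) (p q r : C) : C :=
  (seg_int phi p q + seg_int phi q r + seg_int phi r p)%C.

Definition convex (D : C -> Prop) : Prop :=
  forall p q t, D p -> D q -> 0 <= t <= 1 -> D (segment p q t).

Definition cclosed (D : C -> Prop) : Prop :=
  forall z, (forall eps, 0 < eps -> exists w, D w /\ Cmod (w - z) < eps) -> D z.

Lemma convex_seg_cont (D : C -> Prop) (phi : C -> C) (p q : C) :
  convex D -> (forall z, D z -> ccont phi z) -> D p -> D q -> seg_cont phi p q.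
Proof. intros h1 h2 hp hq t ht. now apply h2, h1. Qed.

(** The sides of the medial triangle are each run twice, in opposite directions. *)
Lemma tri_int_subdiv (D : C -> Prop) (phi : C -> C) (p q r : C) :
  convex D -> (forall z, D z -> ccont phi z) -> D p -> D q -> D r ->
  let a := segment p q (1 / 2) in
  let b := segment q r (1 / 2) in
  let c := segment r p (1 / 2) in
  tri_int phi p q r =
  (tri_int phi p a c + tri_int phi a q b + tri_int phi c b r + tri_int phi a b c)%C.
Proof.
intros hD hc hp hq hr a b c.
assert (ha : D a) by (apply hD; auto; lra).
assert (hb : D b) by (apply hD; auto; lra).
assert (hc' : D c) by (apply hD; auto; lra).
assert (sc : forall x y, D x -> D y -> seg_cont phi x y).
{ intros x y hx hy. now apply (convex_seg_cont D). }
unfold tri_int.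
rewrite (seg_int_split phi p q (1 / 2)), (seg_int_split phi q r (1 / 2)),
  (seg_int_split phi r p (1 / 2)) by (auto; lra).
fold a b c.
rewrite (seg_int_rev phi a c), (seg_int_rev phi a b), (seg_int_rev phi b c) by auto.
ring.
Qed.

Definition tri_in (D : C -> Prop) (d : R) (T : C * C * C) : Prop :=
  let '(p, q, r) := T in
  D p /\ D q /\ D r /\ Cmod (q - p) <= d /\ Cmod (r - q) <= d /\ Cmod (p - r) <= d.

Lemma Cmod_half (z : C) : Cmod (RtoC (1 / 2) * z) = Cmod z / 2.
Proof. rewrite Cmod_mult, Cmod_R, Rabs_pos_eq by lra. lra. Qed.

(** The bisection step of Goursat's lemma. The bound on [p' - p] is what makes the first vertices of
    the successive triangles a Cauchy sequence. *)
Lemma tri_int_quarter (D : C -> Prop) (phi : C -> C) (d : R) (p q r : C) :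
  convex D -> (forall z, D z -> ccont phi z) -> tri_in D d (p, q, r) ->
  exists p' q' r', tri_in D (d / 2) (p', q', r') /\
    Cmod (tri_int phi p q r) <= 4 * Cmod (tri_int phi p' q' r') /\
    Cmod (p' - p) <= d.
Proof.
intros hD hc (hp & hq & hr & d1 & d2 & d3).
generalize (tri_int_subdiv D phi p q r hD hc hp hq hr). cbv zeta.
set (a := segment p q (1 / 2)). set (b := segment q r (1 / 2)).
set (c := segment r p (1 / 2)). intros e.
assert (ha : D a) by (apply hD; auto; lra).
assert (hb : D b) by (apply hD; auto; lra).
assert (hc' : D c) by (apply hD; auto; lra).
assert (half : forall x y u v, (y - x = RtoC (1 / 2) * (v - u))%C ->
   Cmod (v - u) <= d -> Cmod (y - x) <= d / 2).
{ intros x y u v -> h. rewrite Cmod_half. lra. }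
assert (ring2 : RtoC (1 / 2) = (/ 2)%C).
{ unfold Rdiv. rewrite RtoC_mult, RtoC_inv by lra. ring. }
assert (two0 : RtoC 2 <> RtoC 0) by (intros h; apply RtoC_inj in h; lra).
assert (d0 : 0 <= d) by (generalize (Cmod_ge_0 (q - p)); lra).
destruct (Rle_dec (Cmod (tri_int phi p q r)) (4 * Cmod (tri_int phi p a c))) as [h1|h1].
{ exists p, a, c. split; [|split; [exact h1|rewrite Cmod_minus_self; lra]].
  repeat split; auto.
  - apply (half _ _ p q); auto. unfold a, segment; ring.
  - apply (half _ _ q r); auto. unfold a, c, segment. rewrite ring2. field; auto.
  - apply (half _ _ r p); auto. unfold c, segment. rewrite ring2. field; auto. }
destruct (Rle_dec (Cmod (tri_int phi p q r)) (4 * Cmod (tri_int phi a q b))) as [h2|h2].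
{ exists a, q, b. split; [|split; [exact h2|]].
  - repeat split; auto.
    + apply (half _ _ p q); auto. unfold a, segment. rewrite ring2. field; auto.
    + apply (half _ _ q r); auto. unfold b, segment. ring.
    + apply (half _ _ r p); auto. unfold a, b, segment. rewrite ring2. field; auto.
  - apply Rle_trans with (d / 2); [|lra]. apply (half _ _ p q); auto. unfold a, segment; ring. }
destruct (Rle_dec (Cmod (tri_int phi p q r)) (4 * Cmod (tri_int phi c b r))) as [h3|h3].
{ exists c, b, r. split; [|split; [exact h3|]].
  - repeat split; auto.
    + apply (half _ _ p q); auto. unfold c, b, segment. rewrite ring2. field; auto.
    + apply (half _ _ q r); auto. unfold b, segment. rewrite ring2. field; auto.
    + apply (half _ _ r p); auto. unfold c, segment. ring.
  - apply Rle_trans with (d / 2); [|lra]. rewrite Cmod_minus_sym.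
    apply (half _ _ r p); auto. unfold c, segment. rewrite ring2. field; auto. }
exists a, b, c. split; [|split].
- repeat split; auto.
  + rewrite Cmod_minus_sym. apply (half _ _ r p); auto. unfold a, b, segment. rewrite ring2. field; auto.
  + rewrite Cmod_minus_sym. apply (half _ _ p q); auto. unfold c, b, segment. rewrite ring2. field; auto.
  + rewrite Cmod_minus_sym. apply (half _ _ q r); auto. unfold a, c, segment. rewrite ring2. field; auto.
(* If the three corner triangles each carry less than a quarter of the integral, the triangle
   inequality leaves at least a quarter for the middle one. *)
- rewrite e in h1, h2, h3 |- *.
  generalize (Cmod_triangle (tri_int phi p a c + tri_int phi a q b + tri_int phi c b r) (tri_int phi a b c)).
  generalize (Cmod_triangle (tri_int phi p a c + tri_int phi a q b) (tri_int phi c b r)).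
  generalize (Cmod_triangle (tri_int phi p a c) (tri_int phi a q b)). lra.
- apply Rle_trans with (d / 2); [|lra]. apply (half _ _ p q); auto. unfold a, segment; ring.
Qed.

Lemma geometric_limit (u : nat -> C) (d : R) :
  0 <= d -> (forall n, Cmod (u (S n) - u n) <= d * (/ 2) ^ n) ->
  exists c, forall n, Cmod (u n - c) <= 3 * d * (/ 2) ^ n.
Proof.
intros hd h.
assert (H : forall k n, Cmod (u (n + k)%nat - u n) <= 2 * d * (/ 2) ^ n).
(* The exact partial sum of the geometric series is what the induction on [k] can carry; the bound
   by 2 alone would not reproduce itself. *)
{ assert (H' : forall k n, Cmod (u (n + k)%nat - u n) <= d * (/ 2) ^ n * (2 - 2 * (/ 2) ^ k)).
  { induction k as [|k IH]; intros n.
    - rewrite Nat.add_0_r, Cmod_minus_self. simpl. lra.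
    - eapply Rle_trans; [apply (Cmod_minus_triangle _ (u (S n)))|].
      specialize (IH (S n)). rewrite <- Nat.add_succ_comm. specialize (h n).
      simpl pow in *. simpl Nat.add in *. lra. }
  intros k n. eapply Rle_trans; [apply H'|].
  assert (0 < (/ 2) ^ k) by (apply pow_lt; lra).
  assert (0 < (/ 2) ^ n) by (apply pow_lt; lra).
  assert (0 <= d * (/ 2) ^ n * (/ 2) ^ k) by (repeat apply Rmult_le_pos; lra). lra. }
assert (hp : forall eps, 0 < eps -> exists N, forall n, (N <= n)%nat -> 2 * d * (/ 2) ^ n < eps).
{ intros eps heps.
  destruct (pow_lt_1_zero (/ 2) ltac:(rewrite Rabs_pos_eq; lra) (eps / (2 * d + 1)))
    as [N hN]; [apply Rdiv_lt_0_compat; lra|].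
  exists N. intros n hn. specialize (hN n ltac:(lia)).
  assert (0 < (/ 2) ^ n) by (apply pow_lt; lra).
  rewrite Rabs_pos_eq in hN by lra. apply Rlt_div_r in hN; [|lra]. nra. }
destruct (C_complete u) as [c hc].
{ intros eps heps. destruct (hp (eps / 2) ltac:(lra)) as [N hN]. exists N.
  intros n m hn hm.
  eapply Rle_trans; [apply (Cmod_minus_triangle _ (u N))|].
  rewrite (Cmod_minus_sym (u N)).
  generalize (H (n - N)%nat N) (H (m - N)%nat N) (hN N (le_n N)).
  replace (N + (n - N))%nat with n by lia. replace (N + (m - N))%nat with m by lia. lra. }
exists c. intros n.
apply le_epsilon. intros eps heps.
destruct (hc eps heps) as [N hN].
eapply Rle_trans; [apply (Cmod_minus_triangle _ (u (n + N)%nat))|].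
rewrite Cmod_minus_sym. generalize (H N n) (hN (n + N)%nat ltac:(lia)).
assert (0 <= d * (/ 2) ^ n) by (apply Rmult_le_pos; [lra|left; apply pow_lt; lra]). lra.
Qed.

Lemma segment_dist_le (p q c : C) (t d : R) :
  0 <= t <= 1 -> Cmod (p - c) <= d -> Cmod (q - c) <= d -> Cmod (segment p q t - c) <= d.
Proof.
intros ht hp hq.
replace (segment p q t - c)%C with (RtoC (1 - t) * (p - c) + RtoC t * (q - c))%C
  by (unfold segment; rewrite RtoC_minus; ring).
eapply Rle_trans; [apply Cmod_triangle|]. rewrite !Cmod_mult, !Cmod_R.
rewrite !Rabs_pos_eq by lra. nra.
Qed.

Lemma segment_dist_lt (p q c : C) (t d : R) :
  0 <= t <= 1 -> Cmod (p - c) < d -> Cmod (q - c) < d -> Cmod (segment p q t - c) < d.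
Proof.
intros ht hp hq. apply Rle_lt_trans with (Rmax (Cmod (p - c)) (Cmod (q - c))).
- apply segment_dist_le; [exact ht|apply Rmax_l|apply Rmax_r].
- now apply Rmax_lub_lt.
Qed.

(** Three sides, each with the factor 2 of [cint_le]. *)
Lemma tri_int_le (D : C -> Prop) (phi : C -> C) (p q r : C) (d M : R) :
  convex D -> (forall z, D z -> ccont phi z) -> tri_in D d (p, q, r) ->
  (forall t, 0 <= t <= 1 -> Cmod (phi (segment p q t)) <= M) ->
  (forall t, 0 <= t <= 1 -> Cmod (phi (segment q r t)) <= M) ->
  (forall t, 0 <= t <= 1 -> Cmod (phi (segment r p t)) <= M) ->
  Cmod (tri_int phi p q r) <= 6 * (d * M).
Proof.
intros hD hc (hp & hq & hr & d1 & d2 & d3) m1 m2 m3.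
assert (sc : forall x y, D x -> D y -> seg_cont phi x y).
{ intros x y hx hy. now apply (convex_seg_cont D). }
assert (hM : 0 <= M) by (eapply Rle_trans; [apply Cmod_ge_0|apply (m1 0); lra]).
generalize (seg_int_le phi p q M (sc _ _ hp hq) m1) (seg_int_le phi q r M (sc _ _ hq hr) m2)
  (seg_int_le phi r p M (sc _ _ hr hp) m3).
generalize (Cmod_triangle (seg_int phi p q + seg_int phi q r) (seg_int phi r p)).
generalize (Cmod_triangle (seg_int phi p q) (seg_int phi q r)).
unfold tri_int. nra.
Qed.

Lemma tri_int_affine (c a l p q r : C) : tri_int (fun w => a + l * (w - c))%C p q r = 0%C.
Proof.
assert (h : forall z, cdiff (fun w => a + l * (w - c))%C z).
{ intros z. apply cdiff_plus; [apply cdiff_const|]. apply cdiff_mult; [apply cdiff_const|].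
  apply cdiff_minus; [apply cdiff_id|apply cdiff_const]. }
assert (two0 : RtoC 2 <> RtoC 0) by (intros h'; apply RtoC_inj in h'; lra).
(* An explicit primitive; its increments along the three sides telescope. *)
set (P := fun w => (a * w + (l / 2) * ((w + - c) * (w + - c)))%C).
assert (hP : forall z, cderiv P z (a + l * (z - c))%C).
{ intros z.
  assert (hw : cderiv (fun w => w + - c)%C z 1).
  { generalize (cderiv_plus _ _ _ _ _ (cderiv_id z) (cderiv_const (- c)%C z)).
    now rewrite Cplus_0_r. }
  generalize (cderiv_plus _ _ _ _ _
    (cderiv_mult _ _ _ _ _ (cderiv_const a z) (cderiv_id z))
    (cderiv_mult _ _ _ _ _ (cderiv_const (l / 2)%C z) (cderiv_mult _ _ _ _ _ hw hw))).
  match goal with |- cderiv _ _ ?x -> _ => replace x with (a + l * (z - c))%C; [now auto|] end.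
  field; exact two0. }
assert (S : forall x y, seg_int (fun w => a + l * (w - c))%C x y = (P y - P x)%C).
{ intros x y. apply seg_int_deriv; intros t ht; [apply cdiff_ccont, h|apply hP]. }
unfold tri_int. rewrite !S. ring.
Qed.

Lemma seg_int_minus (phi psi : C -> C) (p q : C) :
  seg_cont phi p q -> seg_cont psi p q ->
  seg_int (fun z => phi z - psi z)%C p q = (seg_int phi p q - seg_int psi p q)%C.
Proof.
intros h1 h2. rewrite (seg_int_ext _ (fun z => phi z + (- (1)) * psi z)%C) by (intros; ring).
rewrite seg_int_plus, seg_int_scal; auto; [ring|].
intros t ht. now apply ccont_scal, h2.
Qed.

(** Repeated bisection shrinks the triangles to a point of [D], by closedness. Near that point [phi]
    is affine up to an error small against the distance; the affine part integrates to 0 and the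
    error is quadratic in the size, which beats the growth [4 ^ n]. *)
Lemma goursat (D : C -> Prop) (phi : C -> C) (p q r : C) :
  convex D -> cclosed D -> (forall z, D z -> cdiff phi z) ->
  D p -> D q -> D r -> tri_int phi p q r = 0%C.
Proof.
intros hD hcl hphi hp hq hr.
assert (hc : forall z, D z -> ccont phi z) by auto using cdiff_ccont.
set (d := Cmod (q - p) + Cmod (r - q) + Cmod (p - r)).
assert (T0 : tri_in D d (p, q, r)).
{ generalize (Cmod_ge_0 (q - p)) (Cmod_ge_0 (r - q)) (Cmod_ge_0 (p - r)).
  repeat split; auto; unfold d; lra. }
assert (hd : 0 <= d).
{ generalize (Cmod_ge_0 (q - p)) (Cmod_ge_0 (r - q)) (Cmod_ge_0 (p - r)). unfold d; lra. }
set (ti := fun T : C * C * C => tri_int phi (fst (fst T)) (snd (fst T)) (snd T)).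
set (next := fun (n : nat) (T : C * C * C) => epsilon (inhabits T) (fun T' =>
   tri_in D (d * (/ 2) ^ S n) T' /\ Cmod (ti T) <= 4 * Cmod (ti T') /\
   Cmod (fst (fst T') - fst (fst T)) <= d * (/ 2) ^ n)).
set (Tn := fix Tn n := match n with O => (p, q, r) | S n => next n (Tn n) end).
assert (hstep : forall n, tri_in D (d * (/ 2) ^ n) (Tn n) ->
   tri_in D (d * (/ 2) ^ S n) (Tn (S n)) /\ Cmod (ti (Tn n)) <= 4 * Cmod (ti (Tn (S n))) /\
   Cmod (fst (fst (Tn (S n))) - fst (fst (Tn n))) <= d * (/ 2) ^ n).
{ intros n hn. change (Tn (S n)) with (next n (Tn n)). unfold next. apply epsilon_spec.
  destruct (Tn n) as [[x y] z].
  destruct (tri_int_quarter D phi _ x y z hD hc hn) as (x' & y' & z' & h1 & h2 & h3).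
  exists (x', y', z'). split; [|split; assumption].
  replace (d * (/ 2) ^ S n) with (d * (/ 2) ^ n / 2) by (simpl; field). exact h1. }
assert (hTn : forall n, tri_in D (d * (/ 2) ^ n) (Tn n)).
{ induction n as [|n IH]; [simpl; rewrite Rmult_1_r; exact T0|]. now apply hstep. }
destruct (geometric_limit (fun n => fst (fst (Tn n))) d hd) as [c hlim].
{ intros n. apply hstep, hTn. }
assert (hpow : forall eps, 0 < eps -> exists n, 4 * d * (/ 2) ^ n < eps).
{ intros eps heps.
  destruct (pow_lt_1_zero (/ 2) ltac:(rewrite Rabs_pos_eq; lra) (eps / (4 * d + 1)))
    as [N hN]; [apply Rdiv_lt_0_compat; lra|].
  exists N. specialize (hN N (le_n N)).
  assert (0 < (/ 2) ^ N) by (apply pow_lt; lra).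
  rewrite Rabs_pos_eq in hN by lra. apply Rlt_div_r in hN; [|lra]. nra. }
assert (hDc : D c).
{ apply hcl. intros eps heps. destruct (hpow eps heps) as [n hn].
  exists (fst (fst (Tn n))). split.
  - specialize (hTn n). destruct (Tn n) as [[x y] z]. apply hTn.
  - eapply Rle_lt_trans; [apply hlim|].
    assert (0 < (/ 2) ^ n) by (apply pow_lt; lra). nra. }
destruct (hphi c hDc) as [l hl].
assert (h4 : forall n, Cmod (ti (Tn 0%nat)) <= 4 ^ n * Cmod (ti (Tn n))).
{ induction n as [|n IH]; [simpl; lra|].
  eapply Rle_trans; [exact IH|]. destruct (hstep n (hTn n)) as (_ & h & _).
  eapply Rle_trans; [apply Rmult_le_compat_l; [left; apply pow_lt; lra|exact h]|].
  right. rewrite <- tech_pow_Rmult. ring. }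
apply Cmod_eq_0. apply Rle_antisym; [|apply Cmod_ge_0].
apply le_epsilon. intros eps heps. rewrite Rplus_0_l.
(* 24 is the 6 of [tri_int_le] times 4: the points of the [n]-th triangle lie within [4 * d / 2^n]
   of the limit, 3 from [geometric_limit] and 1 for a side. The added 1 covers [d = 0]. *)
assert (hd2 : 0 < eps / (24 * (d * d) + 1)) by (apply Rdiv_lt_0_compat; nra).
destruct (hl _ hd2) as [del [hdel Hdel]].
destruct (hpow del hdel) as [n hn].
eapply Rle_trans; [apply (h4 n)|].
set (e := (fun w => phi w - (phi c + l * (w - c)))%C).
specialize (hTn n). specialize (hlim n). unfold ti.
destruct (Tn n) as [[x y] z]. simpl fst in *; simpl snd in *.
assert (haff : forall w, ccont (fun w => phi c + l * (w - c))%C w).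
{ intros w. apply cdiff_ccont, cdiff_plus; [apply cdiff_const|].
  apply cdiff_mult; [apply cdiff_const|]. apply cdiff_minus; [apply cdiff_id|apply cdiff_const]. }
destruct (hTn) as (hx & hy & hz & d1 & d2 & d3).
assert (sc : forall u v, D u -> D v -> seg_cont phi u v).
{ intros u v hu hv. now apply (convex_seg_cont D). }
assert (ee : tri_int phi x y z = tri_int e x y z).
{ transitivity (tri_int phi x y z - tri_int (fun w => phi c + l * (w - c))%C x y z)%C.
  - rewrite tri_int_affine. ring.
  - unfold tri_int, e. rewrite !seg_int_minus; auto; try (intros t _; apply haff). ring. }
rewrite ee.
assert (hpn : 0 < (/ 2) ^ n) by (apply pow_lt; lra).
set (dn := d * (/ 2) ^ n) in *.
assert (hdn : 0 <= dn) by (unfold dn; nra).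
assert (xc : Cmod (x - c) <= 4 * dn) by (unfold dn in *; lra).
assert (yc : Cmod (y - c) <= 4 * dn).
{ generalize (Cmod_minus_triangle y x c). unfold dn in *; lra. }
assert (zc : Cmod (z - c) <= 4 * dn).
{ generalize (Cmod_minus_triangle z x c). rewrite (Cmod_minus_sym z x). unfold dn in *; lra. }
assert (E : forall u v t, Cmod (u - c) <= 4 * dn -> Cmod (v - c) <= 4 * dn -> 0 <= t <= 1 ->
  Cmod (e (segment u v t)) <= eps / (24 * (d * d) + 1) * (4 * dn)).
{ intros u v t hu hv ht.
  assert (hs := segment_dist_le u v c t _ ht hu hv).
  unfold e. replace (phi (segment u v t) - (phi c + l * (segment u v t - c)))%C
    with (phi (segment u v t) - phi c - l * (segment u v t - c))%C by ring.
  eapply Rle_trans; [apply Hdel; unfold dn in *; lra|]. apply Rmult_le_compat_l; lra. }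
assert (F : Cmod (tri_int e x y z) <= 6 * (dn * (eps / (24 * (d * d) + 1) * (4 * dn)))).
{ apply (tri_int_le D); auto.
  intros w hw. apply ccont_minus; auto. }
assert (p4 : 4 ^ n * ((/ 2) ^ n * (/ 2) ^ n) = 1).
{ rewrite <- !Rpow_mult_distr. replace (4 * (/ 2 * / 2)) with 1 by field. apply pow1. }
assert (0 < 4 ^ n) by (apply pow_lt; lra).
apply Rle_trans with (4 ^ n * (6 * (dn * (eps / (24 * (d * d) + 1) * (4 * dn))))).
{ apply Rmult_le_compat_l; lra. }
replace (4 ^ n * (6 * (dn * (eps / (24 * (d * d) + 1) * (4 * dn)))))
  with (4 ^ n * ((/ 2) ^ n * (/ 2) ^ n) * (24 * (d * d) * (eps / (24 * (d * d) + 1))))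
  by (unfold dn; ring).
rewrite p4, Rmult_1_l.
replace (24 * (d * d) * (eps / (24 * (d * d) + 1)))
  with ((24 * (d * d) * eps) / (24 * (d * d) + 1)) by (field; nra).
apply Rle_div_l; [nra|]. nra.
Qed.

(** * Cauchy's formula *)

Definition disc (c : C) (r : R) (z : C) : Prop := Cmod (z - c) <= r.

Lemma disc_convex (c : C) (r : R) : convex (disc c r).
Proof. intros p q t hp hq ht. now apply segment_dist_le. Qed.

Lemma disc_closed (c : C) (r : R) : cclosed (disc c r).
Proof.
intros z h. apply le_epsilon. intros eps heps. destruct (h eps heps) as [w [hw1 hw2]].
unfold disc in hw1. rewrite Cmod_minus_sym in hw2.
generalize (Cmod_minus_triangle z w c). lra.
Qed.

(** The real part is the Euclidean inner product of [z - e] with the direction [h]. *)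
Definition half_plane (e h : C) (k : R) (z : C) : Prop := k <= Re ((z - e) * Cconj h).

Lemma half_plane_convex (e h : C) (k : R) : convex (half_plane e h k).
Proof.
intros p q t hp hq ht. unfold half_plane in *.
replace (Re ((segment p q t - e) * Cconj h))
  with ((1 - t) * Re ((p - e) * Cconj h) + t * Re ((q - e) * Cconj h))
  by (unfold segment, Re; simpl; ring).
nra.
Qed.

Lemma half_plane_closed (e h : C) (k : R) : cclosed (half_plane e h k).
Proof.
intros z hz. unfold half_plane in *. apply le_epsilon. intros eps heps.
generalize (Cmod_ge_0 h). intros hh.
destruct (hz (eps / (1 + Cmod h))) as [w [h1 h2]]; [apply Rdiv_lt_0_compat; lra|].
apply Rlt_div_r in h2; [|lra].
assert (h3 : Rabs (Re ((w - z) * Cconj h)) <= eps).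
{ eapply Rle_trans; [apply re_le_Cmod|]. rewrite Cmod_mult, Cmod_conj.
  generalize (Cmod_ge_0 (w - z)). nra. }
assert (h4 : Re ((w - e) * Cconj h) = Re ((w - z) * Cconj h) + Re ((z - e) * Cconj h))
  by (unfold Re; simpl; ring).
apply Rabs_le_between in h3. lra.
Qed.

Lemma Re_mult_conj (h : C) : Re (h * Cconj h) = Cmod h ^ 2.
Proof. rewrite Cmod2_alt. unfold Re, Im; simpl; ring. Qed.

Lemma seg_int_refl (phi : C -> C) (p : C) : seg_cont phi p p -> seg_int phi p p = 0%C.
Proof.
intros h. destruct (segment_bounded phi p p h) as [M hM].
apply Cmod_eq_0, Rle_antisym; [|apply Cmod_ge_0].
eapply Rle_trans; [apply (seg_int_le phi p p M h hM)|].
rewrite Cmod_minus_self. lra.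
Qed.

(* Goursat's lemma applies to the part of the triangle away from [e], which lies in
   a half plane; the remaining small triangle at [e] contributes O(tau). *)
Lemma tri_int_vertex (D : C -> Prop) (psi : C -> C) (e z0 z : C) :
  convex D -> cclosed D -> (forall w, D w -> ccont psi w) ->
  (forall w, D w -> w <> e -> cdiff psi w) ->
  D e -> D z0 -> D z -> Cmod (z - z0) < Cmod (z0 - e) / 2 ->
  tri_int psi e z0 z = 0%C.
Proof.
intros hD hcl hc hd he hz0 hz hnear.
set (h := (z0 - e)%C) in *.
assert (hh : 0 < Cmod h) by (generalize (Cmod_ge_0 (z - z0)); lra).
(* Nearness of [z] to [z0] keeps [z] at least half as far from [e] as [z0] in the direction [h], so
   one half plane separates [e] from both. *)
assert (hre : Cmod h ^ 2 / 2 <= Re ((z - e) * Cconj h)).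
{ replace ((z - e) * Cconj h)%C with ((z - z0) * Cconj h + h * Cconj h)%C by (unfold h; ring).
  assert (r1 : Rabs (Re ((z - z0) * Cconj h)) <= Cmod h ^ 2 / 2).
  { eapply Rle_trans; [apply re_le_Cmod|]. rewrite Cmod_mult, Cmod_conj. nra. }
  apply Rabs_le_between in r1.
  replace (Re ((z - z0) * Cconj h + h * Cconj h))
    with (Re ((z - z0) * Cconj h) + Re (h * Cconj h)) by (unfold Re; simpl; ring).
  rewrite Re_mult_conj. lra. }
assert (small : forall tau, 0 < tau <= 1 ->
  tri_int psi e z0 z = tri_int psi e (segment e z0 tau) (segment e z tau)).
{ intros tau ht.
  set (q' := segment e z0 tau). set (r' := segment e z tau).
  assert (hq' : D q') by (apply hD; auto; lra).
  assert (hr' : D r') by (apply hD; auto; lra).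
  set (k := tau * (Cmod h ^ 2 / 2)).
  assert (hh2 : 0 < Cmod h ^ 2) by (apply pow_lt; exact hh).
  assert (hk : 0 < k) by (unfold k; apply Rmult_lt_0_compat; lra).
  set (D' := fun w => D w /\ half_plane e h k w).
  assert (D'c : convex D').
  { intros p q t [p1 p2] [q1 q2] t01. split; [now apply hD|now apply half_plane_convex]. }
  assert (D'cl : cclosed D').
  { intros w hw. split.
    - apply hcl. intros eps heps. destruct (hw eps heps) as [x [[x1 _] x2]]. eauto.
    - apply half_plane_closed. intros eps heps. destruct (hw eps heps) as [x [[_ x1] x2]]. eauto. }
  assert (D'd : forall w, D' w -> cdiff psi w).
  { intros w [w1 w2]. apply hd; [exact w1|]. intros ->. unfold half_plane in w2.
    replace ((e - e) * Cconj h)%C with (RtoC 0) in w2 by ring. simpl in w2. lra. }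
  assert (dz0 : D' z0).
  { split; [exact hz0|]. unfold half_plane. fold h. rewrite Re_mult_conj. unfold k. nra. }
  assert (dz : D' z).
  { split; [exact hz|]. unfold half_plane. unfold k. nra. }
  assert (dq : D' q').
  { split; [exact hq'|]. unfold half_plane, q'.
    replace (Re ((segment e z0 tau - e) * Cconj h)) with (tau * Re (h * Cconj h))
      by (unfold h, segment, Re; simpl; ring).
    rewrite Re_mult_conj. unfold k. nra. }
  assert (dr : D' r').
  { split; [exact hr'|]. unfold half_plane, r'.
    replace (Re ((segment e z tau - e) * Cconj h)) with (tau * Re ((z - e) * Cconj h))
      by (unfold h, segment, Re; simpl; ring).
    unfold k. nra. }
  assert (g1 := goursat D' psi q' z0 z D'c D'cl D'd dq dz0 dz).
  assert (g2 := goursat D' psi q' z r' D'c D'cl D'd dq dz dr).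
  assert (sc : forall x y, D x -> D y -> seg_cont psi x y).
  { intros x y hx hy. now apply (convex_seg_cont D). }
  assert (s1 : seg_int psi e z0 = (seg_int psi e q' + seg_int psi q' z0)%C)
    by (apply seg_int_split; auto; lra).
  assert (s2 : seg_int psi e z = (seg_int psi e r' + seg_int psi r' z)%C)
    by (apply seg_int_split; auto; lra).
  (* The part cut off from the corner is a quadrilateral, split by the diagonal from [q'] to [z]
     into two triangles inside the half plane. *)
  transitivity (tri_int psi e q' r' + tri_int psi q' z0 z + tri_int psi q' z r')%C;
    [|rewrite g1, g2; ring].
  unfold tri_int. rewrite (seg_int_rev psi e z), s1, s2 by auto.
  rewrite (seg_int_rev psi r' z), (seg_int_rev psi q' r'), (seg_int_rev psi e r'),
    (seg_int_rev psi q' z) by auto. ring. }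
apply Cmod_eq_0, Rle_antisym; [|apply Cmod_ge_0].
apply le_epsilon. intros eps heps. rewrite Rplus_0_l.
set (S := Cmod (z0 - e) + Cmod (z - z0) + Cmod (z - e)).
assert (hS : 0 < S).
{ unfold S. fold h. generalize (Cmod_ge_0 (z - z0)) (Cmod_ge_0 (z - e)). lra. }
destruct (hc e he 1 ltac:(lra)) as [d [hd0 Hd]].
set (M := Cmod (psi e) + 1).
assert (hM : 0 < M) by (generalize (Cmod_ge_0 (psi e)); unfold M; lra).
(* The second bound brings the corner triangle into the region where continuity at [e] gives
   [|psi| <= M]; the third makes its integral at most [eps]. *)
set (tau := Rmin 1 (Rmin (d / (2 * S)) (eps / (6 * S * M)))).
assert (ht : 0 < tau <= 1).
{ split; [|apply Rmin_l]. repeat apply Rmin_pos; [lra|apply Rdiv_lt_0_compat; lra|].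
  apply Rdiv_lt_0_compat; [lra|]. apply Rmult_lt_0_compat; lra. }
assert (ht1 : tau * S < d).
{ assert (t1 : tau <= d / (2 * S)) by (unfold tau; eapply Rle_trans; [apply Rmin_r|apply Rmin_l]).
  apply Rle_div_r in t1; [|lra]. lra. }
assert (ht2 : 6 * (tau * S * M) <= eps).
{ assert (t1 : tau <= eps / (6 * S * M)) by (unfold tau; eapply Rle_trans; [apply Rmin_r|apply Rmin_r]).
  apply Rle_div_r in t1; [|apply Rmult_lt_0_compat; lra]. lra. }
rewrite (small tau ht).
eapply Rle_trans; [|exact ht2].
assert (hq' : D (segment e z0 tau)) by (apply hD; auto; lra).
assert (hr' : D (segment e z tau)) by (apply hD; auto; lra).
assert (n1 : Cmod (segment e z0 tau - e) <= tau * S).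
{ replace (segment e z0 tau - e)%C with (RtoC tau * (z0 - e))%C by (unfold segment; ring).
  rewrite Cmod_mult, Cmod_R, Rabs_pos_eq by lra. apply Rmult_le_compat_l; [lra|].
  unfold S. generalize (Cmod_ge_0 (z - z0)) (Cmod_ge_0 (z - e)). lra. }
assert (n2 : Cmod (segment e z tau - e) <= tau * S).
{ replace (segment e z tau - e)%C with (RtoC tau * (z - e))%C by (unfold segment; ring).
  rewrite Cmod_mult, Cmod_R, Rabs_pos_eq by lra. apply Rmult_le_compat_l; [lra|].
  unfold S. generalize (Cmod_ge_0 (z - z0)) (Cmod_ge_0 (z0 - e)). lra. }
assert (n0 : Cmod (e - e) <= tau * S).
{ rewrite Cmod_minus_self. apply Rmult_le_pos; lra. }
assert (B : forall u v t, Cmod (u - e) <= tau * S -> Cmod (v - e) <= tau * S -> 0 <= t <= 1 ->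
   Cmod (psi (segment u v t)) <= M).
{ intros u v t hu hv t01. assert (hs := segment_dist_le u v e t _ t01 hu hv).
  specialize (Hd (segment u v t) ltac:(lra)).
  generalize (Cmod_rev_triangle (psi (segment u v t)) (psi e)). unfold M. lra. }
apply (tri_int_le D); auto.
repeat split; auto.
- replace (segment e z tau - segment e z0 tau)%C with (RtoC tau * (z - z0))%C by (unfold segment; ring).
  rewrite Cmod_mult, Cmod_R, Rabs_pos_eq by lra. apply Rmult_le_compat_l; [lra|].
  unfold S. generalize (Cmod_ge_0 (z0 - e)) (Cmod_ge_0 (z - e)). lra.
- rewrite Cmod_minus_sym. exact n2.
Qed.

(** The primitive is based at the one point where [psi] may fail to be differentiable. Every
    triangle that occurs then has this point as a vertex, which is the case treated by
    [tri_int_vertex]. *)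
Lemma primitive_convex (D : C -> Prop) (psi : C -> C) (e z0 : C) (d0 : R) :
  convex D -> cclosed D -> (forall w, D w -> ccont psi w) ->
  (forall w, D w -> w <> e -> cdiff psi w) ->
  D e -> 0 < d0 -> (forall w, Cmod (w - z0) < d0 -> D w) ->
  cderiv (fun z => seg_int psi e z) z0 (psi z0).
Proof.
intros hD hcl hc hd he hd0 hb eps heps.
assert (hz0 : D z0) by (apply hb; rewrite Cmod_minus_self; lra).
assert (sc : forall x y, D x -> D y -> seg_cont psi x y).
{ intros x y hx hy. now apply (convex_seg_cont D). }
destruct (hc z0 hz0 (eps / 2) ltac:(lra)) as [d1 [hd1 Hd1]].
(* For [z0 = e] the triangle degenerates and any radius works. *)
set (d2 := if excluded_middle_informative (z0 = e) then 1 else Cmod (z0 - e) / 2).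
assert (hd2 : 0 < d2).
{ unfold d2. destruct (excluded_middle_informative (z0 = e)) as [h|h]; [lra|].
  generalize (Cmod_minus_pos z0 e h). lra. }
exists (Rmin d0 (Rmin d1 d2)). split; [repeat apply Rmin_pos; assumption|]. intros w hw.
assert (w1 := Rlt_le_trans _ _ _ hw (Rmin_l _ _)).
assert (w2 := Rlt_le_trans _ _ _ hw (Rmin_r _ _)).
assert (w3 := Rlt_le_trans _ _ _ w2 (Rmin_r _ _)).
assert (w4 := Rlt_le_trans _ _ _ w2 (Rmin_l _ _)).
assert (hDw : D w) by now apply hb.
assert (T : (seg_int psi e w - seg_int psi e z0 = seg_int psi z0 w)%C).
{ unfold d2 in w3. destruct (excluded_middle_informative (z0 = e)) as [h|h].
  - subst e. rewrite (seg_int_refl psi z0) by auto. ring.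
  - assert (t := tri_int_vertex D psi e z0 w hD hcl hc hd he hz0 hDw w3).
    unfold tri_int in t. rewrite (seg_int_rev psi e w) in t by auto.
    replace (seg_int psi e w) with (seg_int psi e w + 0)%C by ring. rewrite <- t. ring. }
rewrite T.
assert (E : (seg_int psi z0 w - psi z0 * (w - z0))%C = seg_int (fun x => psi x - psi z0)%C z0 w).
{ rewrite seg_int_minus; auto; [|intros t _; apply ccont_const]. f_equal.
  rewrite (seg_int_deriv (fun x => psi z0 * x)%C (fun _ => psi z0)); [ring|intros t _; apply ccont_const|].
  intros t _. generalize (cderiv_mult _ _ _ _ _ (cderiv_const (psi z0) (segment z0 w t)) (cderiv_id (segment z0 w t))).
  now replace (0 * segment z0 w t + psi z0 * 1)%C with (psi z0) by ring. }
rewrite E.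
eapply Rle_trans.
- apply (seg_int_le _ z0 w (eps / 2)).
  + intros t ht. apply ccont_minus; [now apply sc|apply ccont_const].
  + intros t ht. left. apply Hd1. apply segment_dist_lt; auto. rewrite Cmod_minus_self. lra.
- right. field.
Qed.

(** The exceptional point [e] is there for difference quotients, which at first are known only to be
    continuous at their base point. *)
Lemma cauchy_disc (psi : C -> C) (c e : C) (r : R) (G : contour) :
  (forall w, disc c r w -> ccont psi w) ->
  (forall w, disc c r w -> w <> e -> cdiff psi w) -> disc c r e ->
  closed_path G -> (forall z, on_contour G z -> Cmod (z - c) < r) ->
  path_int psi G = 0%C.
Proof.
intros hc hd he hG hr. apply (path_int_deriv_closed (fun z => seg_int psi e z)); auto.
- intros z hz. apply hc. left. auto.
- intros z hz. apply (primitive_convex (disc c r) psi e z (r - Cmod (z - c)));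
    auto using disc_convex, disc_closed.
  + generalize (hr z hz). lra.
  + intros w hw. unfold disc. generalize (Cmod_minus_triangle w z c). lra.
Qed.

(** The integral of [1/w] from 1 is a branch of the logarithm on a disc that avoids 0; this is the
    only logarithm that winding numbers require. *)
Lemma cderiv_log (z : C) : Cmod (z - 1) < 3 / 4 -> cderiv (fun w => seg_int Cinv 1 w) z (/ z).
Proof.
intros hz.
assert (h0 : forall w, disc 1 (3 / 4) w -> w <> 0%C).
{ intros w hw ->. unfold disc in hw. rewrite Cmod_minus_sym in hw.
  replace (1 - 0)%C with (RtoC 1) in hw by ring. rewrite Cmod_1 in hw. lra. }
apply (primitive_convex (disc 1 (3 / 4)) Cinv 1 z (3 / 4 - Cmod (z - 1)));
  auto using disc_convex, disc_closed.
- intros w hw. apply cdiff_ccont. eexists. now apply cderiv_inv, h0.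
- intros w hw _. eexists. now apply cderiv_inv, h0.
- unfold disc. rewrite Cmod_minus_self. lra.
- lra.
- intros w hw. unfold disc. generalize (Cmod_minus_triangle w z 1). lra.
Qed.

(** The difference of the integrands is the derivative of [log ((w - z) / (w - z0))]. The quotient
    is [1 - h / (w - z0)] with [|h| <= d / 2], so it stays within 1/2 of 1, where [cderiv_log]
    applies. *)
Lemma winding_locally_const (G : contour) (z0 z : C) (d : R) :
  closed_path G -> (forall w, on_contour G w -> d <= Cmod (w - z0)) ->
  0 < d -> Cmod (z - z0) <= d / 2 ->
  path_int (fun w => / (w - z))%C G = path_int (fun w => / (w - z0))%C G.
Proof.
intros hG hd d0 hz.
assert (n0 : forall w, on_contour G w -> w <> z0).
{ intros w hw ->. specialize (hd _ hw). rewrite Cmod_minus_self in hd. lra. }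
assert (n1 : forall w, on_contour G w -> w <> z).
{ intros w hw ->. specialize (hd _ hw). lra. }
assert (c0 : forall u, (forall w, on_contour G w -> w <> u) -> path_cont (fun w => / (w - u))%C G).
{ intros u hu w hw. now apply cdiff_ccont, cdiff_inv_minus, hu. }
apply Cminus_eq_0. rewrite <- path_int_minus by auto.
set (h := (z - z0)%C) in *.
apply (path_int_deriv_closed (fun w => seg_int Cinv 1 (1 + (- h) * / (w + - z0)))%C); auto.
{ intros w hw. apply ccont_minus; now apply c0. }
intros w hw.
assert (m0 := Cminus_neq_0 _ _ (n0 w hw)). assert (m1 := Cminus_neq_0 _ _ (n1 w hw)).
assert (D1 : cderiv (fun w => w + - z0)%C w 1).
{ generalize (cderiv_plus _ _ _ _ _ (cderiv_id w) (cderiv_const (- z0)%C w)).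
  now rewrite Cplus_0_r. }
assert (D2 := cderiv_comp Cinv _ _ _ _ D1 (cderiv_inv _ m0)).
assert (D3 := cderiv_plus _ _ _ _ _ (cderiv_const 1 w)
   (cderiv_mult _ _ _ _ _ (cderiv_const (- h)%C w) D2)).
assert (H : (1 + - h * / (w + - z0) = (w - z) / (w - z0))%C) by (unfold h; field; exact m0).
assert (D4 := cderiv_comp (fun u => seg_int Cinv 1 u) _ _ (/ (1 + - h * / (w + - z0))) _ D3).
refine (_ (D4 _)).
- match goal with |- cderiv _ _ ?x -> cderiv _ _ ?y => replace x with y; [now auto|] end.
  rewrite H. unfold h. field. auto.
- apply cderiv_log.
  replace (1 + - h * / (w + - z0) - 1)%C with (- (h / (w - z0)))%C by (field; exact m0).
  rewrite Cmod_opp, Cmod_div by exact m0. specialize (hd w hw).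
  apply Rle_lt_trans with (1 / 2); [|lra]. apply Rle_div_l; lra.
Qed.

(* Multiplication by [Ci] permutes the sides, so the winding number at the centre is four times
   one elementary integral. *)
Definition diamond (c : C) (r : R) : contour :=
  (c + RtoC r, c + Ci * RtoC r)%C :: (c + Ci * RtoC r, c - RtoC r)%C ::
  (c - RtoC r, c - Ci * RtoC r)%C :: (c - Ci * RtoC r, c + RtoC r)%C :: nil.

Lemma diamond_closed (c : C) (r : R) : closed_path (diamond c r).
Proof. exact (Permutation_cons_append (_ :: _ :: _ :: nil) _). Qed.

Lemma diamond_sides (c : C) (r : R) (p q : C) : In (p, q) (diamond c r) ->
  exists u, Cmod u = Rabs r /\ (p = c + u)%C /\ (q = c + Ci * u)%C.
Proof.
assert (hr : Cmod (RtoC r) = Rabs r) by apply Cmod_R.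
assert (hir : Cmod (Ci * RtoC r) = Rabs r) by (rewrite Cmod_mult, Cmod_Ci; lra).
intros [e|[e|[e|[e|[]]]]]; injection e as <- <-.
- exists (RtoC r). auto.
- exists (Ci * RtoC r)%C. repeat split; auto.
  apply injective_projections; simpl; ring.
- exists (- RtoC r)%C. rewrite Cmod_opp. repeat split; auto; ring.
- exists (- (Ci * RtoC r))%C. rewrite Cmod_opp. repeat split; auto.
  apply injective_projections; simpl; ring.
Qed.

Lemma Cmod_sq_side (t : R) : Cmod (1 - t, t)%R ^ 2 = 2 * t ^ 2 - 2 * t + 1.
Proof. rewrite Cmod2_alt. unfold Re, Im; simpl; ring. Qed.

Lemma diamond_dist (c : C) (r : R) (z : C) : 0 <= r -> on_contour (diamond c r) z ->
  r / 2 <= Cmod (z - c) <= r.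
Proof.
intros hr (p & q & t & hin & ht & ->).
destruct (diamond_sides c r p q hin) as (u & hu & -> & ->).
rewrite Rabs_pos_eq in hu by lra.
replace (segment (c + u) (c + Ci * u) t - c)%C with (u * (1 - t, t)%R)%C
  by (unfold segment; apply injective_projections; simpl; ring).
rewrite Cmod_mult, hu.
assert (h := Cmod_sq_side t). assert (h0 := Cmod_ge_0 (1 - t, t)%R).
assert (h1 : Cmod (1 - t, t)%R <= 1) by (apply le_of_sq; [lra|]; rewrite h; nra).
assert (h2 : 1 / 2 <= Cmod (1 - t, t)%R) by (apply le_of_sq; [lra|]; rewrite h; nra).
nra.
Qed.

Lemma diamond_length (c : C) (r : R) : 0 <= r -> path_length (diamond c r) <= 8 * r.
Proof.
intros hr.
assert (H : forall p q, In (p, q) (diamond c r) -> Cmod (q - p) <= 2 * r).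
{ intros p q hin. destruct (diamond_sides c r p q hin) as (u & hu & -> & ->).
  rewrite Rabs_pos_eq in hu by lra.
  replace (c + Ci * u - (c + u))%C with (Ci * u - u)%C by ring.
  eapply Rle_trans; [apply Cmod_minus_le|]. rewrite Cmod_mult, Cmod_Ci. lra. }
unfold diamond in *. simpl path_length.
generalize (H _ _ (or_introl eq_refl)) (H _ _ (or_intror (or_introl eq_refl)))
  (H _ _ (or_intror (or_intror (or_introl eq_refl))))
  (H _ _ (or_intror (or_intror (or_intror (or_introl eq_refl))))). lra.
Qed.

(** With [D = 2 t^2 - 2 t + 1 = |(1 - t) + i t|^2], the integrand [(i - 1) / ((1 - t) + i t)] of a
    side has real part [(2 t - 1) / D] and imaginary part [1 / D]; the latter integrates to a
    quarter turn. *)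
Lemma RInt_side_im : RInt (fun t => / (2 * t ^ 2 - 2 * t + 1)) 0 1 = PI / 2.
Proof.
rewrite (is_RInt_real_deriv (fun t => atan (2 * t - 1))).
- replace (2 * 1 - 1) with 1 by ring. replace (2 * 0 - 1) with (- (1)) by ring.
  rewrite atan_opp, atan_1. match goal with |- ?a = ?b => change (@eq R a b) end. field.
- intros t _. auto_derive; [exact I|]. field.
  repeat split; nra.
- intros t _. apply (@ex_derive_continuous R_AbsRing R_NormedModule).
  auto_derive. nra.
Qed.

Lemma RInt_side_re : RInt (fun t => (2 * t - 1) / (2 * t ^ 2 - 2 * t + 1)) 0 1 = 0.
Proof.
rewrite (is_RInt_real_deriv (fun t => ln (2 * t ^ 2 - 2 * t + 1) / 2)).
- replace (2 * 1 ^ 2 - 2 * 1 + 1) with 1 by ring.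
  replace (2 * 0 ^ 2 - 2 * 0 + 1) with 1 by ring. rewrite ln_1.
  match goal with |- ?a = ?b => change (@eq R a b) end. field.
- intros t _. auto_derive; [nra|]. field. nra.
- intros t _. apply (@ex_derive_continuous R_AbsRing R_NormedModule).
  auto_derive. nra.
Qed.

Lemma seg_int_side (c u : C) : u <> 0%C ->
  seg_int (fun w => / (w - c))%C (c + u) (c + Ci * u) = (Ci * RtoC (PI / 2))%C.
Proof.
intros hu. unfold seg_int.
rewrite (cint_ext _ (fun t => ((2 * t - 1) / (2 * t ^ 2 - 2 * t + 1), / (2 * t ^ 2 - 2 * t + 1))%R)).
- unfold cint, Re, Im, fst, snd. rewrite RInt_side_re, RInt_side_im.
  apply injective_projections; simpl; ring.
- intros t _. set (D := 2 * t ^ 2 - 2 * t + 1). assert (hD : D <> 0) by (unfold D; nra).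
  assert (h0 : (1 - t, t)%R <> RtoC 0).
  { intros e. assert (h := Cmod_sq_side t). rewrite e, Cmod_0 in h. fold D in h. apply hD. rewrite <- h. ring. }
  replace (segment (c + u) (c + Ci * u) t - c)%C with (u * (1 - t, t)%R)%C
    by (unfold segment; apply injective_projections; simpl; ring).
  replace (c + Ci * u - (c + u))%C with (u * (Ci - 1))%C by ring.
  replace (Ci - 1)%C with (((2 * t - 1) / D, / D)%R * (1 - t, t)%R)%C.
  + field. split; assumption.
  + unfold D in *. apply injective_projections; simpl; field; nra.
Qed.

(** The diamond stays at distance at least [r / 2] from [c], so local constancy moves [z] to the
    centre, where the four sides contribute [i PI / 2] each. *)
Lemma winding_diamond (c z : C) (r : R) : 0 < r -> Cmod (z - c) <= r / 4 ->
  path_int (fun w => / (w - z))%C (diamond c r) = two_pi_i.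
Proof.
intros hr hz.
rewrite (winding_locally_const _ c z (r / 2));
  [|apply diamond_closed|intros w hw; apply diamond_dist in hw; lra|lra|lra].
assert (hr0 : RtoC r <> 0%C) by (intros h; apply RtoC_inj in h; lra).
assert (hi0 : Ci <> 0%C) by (intros h; injection h; lra).
assert (e1 : (Ci * (Ci * RtoC r) = - RtoC r)%C) by (apply injective_projections; simpl; ring).
assert (e2 : (Ci * (- RtoC r) = - (Ci * RtoC r))%C) by ring.
assert (e3 : (Ci * (- (Ci * RtoC r)) = RtoC r)%C) by (apply injective_projections; simpl; ring).
assert (s1 := seg_int_side c (RtoC r) hr0).
assert (s2 := seg_int_side c (Ci * RtoC r)%C (Cmult_neq_0 _ _ hi0 hr0)). rewrite e1 in s2.
assert (nz : forall u : C, u <> 0%C -> (- u <> 0)%C).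
{ intros u h h'. apply h. replace u with (- - u)%C by ring. rewrite h'. ring. }
assert (s3 := seg_int_side c (- RtoC r)%C (nz _ hr0)). rewrite e2 in s3.
assert (s4 := seg_int_side c (- (Ci * RtoC r))%C (nz _ (Cmult_neq_0 _ _ hi0 hr0))). rewrite e3 in s4.
unfold diamond, Cminus at 2 3 4 5. simpl path_int.
unfold Cminus in *. rewrite s1, s2, s3, s4. unfold two_pi_i.
apply injective_projections; simpl; field.
Qed.

Definition diff_quot (f : C -> C) (l z w : C) : C :=
  if excluded_middle_informative (w = z) then l else ((f w - f z) / (w - z))%C.

Lemma diff_quot_ne (f : C -> C) (l z w : C) : w <> z ->
  diff_quot f l z w = ((f w - f z) / (w - z))%C.
Proof. intros h. unfold diff_quot. destruct (excluded_middle_informative (w = z)); tauto. Qed.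

Lemma diff_quot_eq (f : C -> C) (l z : C) : diff_quot f l z z = l.
Proof. unfold diff_quot. destruct (excluded_middle_informative (z = z)); tauto. Qed.

Lemma diff_quot_cdiff (f : C -> C) (l z w : C) :
  w <> z -> cdiff f w -> cdiff (diff_quot f l z) w.
Proof.
intros h hf. apply (cdiff_ext_loc (fun w => (f w - f z) / (w - z))%C _ w (Cmod (w - z))).
- now apply Cmod_minus_pos.
- intros x hx. rewrite diff_quot_ne; [reflexivity|]. intros ->.
  rewrite Cmod_minus_sym in hx. lra.
- apply cdiff_div.
  + apply cdiff_minus; [exact hf|apply cdiff_const].
  + apply cdiff_minus; [apply cdiff_id|apply cdiff_const].
  + now apply Cminus_neq_0.
Qed.

Lemma diff_quot_ccont (f : C -> C) (l z w : C) :
  cderiv f z l -> cdiff f w -> ccont (diff_quot f l z) w.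
Proof.
intros hz hw. destruct (excluded_middle_informative (w = z)) as [->|h];
  [|now apply cdiff_ccont, diff_quot_cdiff].
intros eps heps. destruct (hz (eps / 2) ltac:(lra)) as [d [hd Hd]].
exists d. split; [exact hd|]. intros x hx. rewrite diff_quot_eq.
destruct (excluded_middle_informative (x = z)) as [->|hxz].
- rewrite diff_quot_eq, Cmod_minus_self. exact heps.
- rewrite diff_quot_ne by exact hxz. specialize (Hd x hx).
  assert (hp := Cmod_minus_pos x z hxz).
  replace ((f x - f z) / (x - z) - l)%C with ((f x - f z - l * (x - z)) / (x - z))%C
    by (field; now apply Cminus_neq_0).
  rewrite Cmod_div by now apply Cminus_neq_0.
  apply Rle_lt_trans with (eps / 2); [|lra]. apply Rle_div_l; lra.
Qed.

Lemma two_pi_i_neq_0 : two_pi_i <> 0%C.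
Proof.
unfold two_pi_i. intros h. injection h as h1 h2. generalize PI_RGT_0. lra.
Qed.

(** The difference quotient of [f] at [z] is continuous on the disc and differentiable off [z],
    hence integrates to 0; splitting it leaves [f z] times the winding integral. *)
Lemma cauchy_formula (f : C -> C) (c z : C) (r R0 : R) :
  (forall w, disc c R0 w -> cdiff f w) -> 0 < r < R0 -> Cmod (z - c) <= r / 4 ->
  path_int (fun w => f w / (w - z))%C (diamond c r) = (two_pi_i * f z)%C.
Proof.
intros hf hr hz.
assert (hzd : disc c R0 z) by (unfold disc; lra).
destruct (hf z hzd) as [l hl].
assert (on : forall w, on_contour (diamond c r) w -> r / 2 <= Cmod (w - c) <= r).
{ intros w hw. apply diamond_dist; auto; lra. }
assert (ne : forall w, on_contour (diamond c r) w -> w <> z).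
{ intros w hw ->. specialize (on _ hw). lra. }
assert (H : path_int (diff_quot f l z) (diamond c r) = 0%C).
{ apply (cauchy_disc _ c z R0); auto using diamond_closed.
  - intros w hw. apply diff_quot_ccont; auto.
  - intros w hw hne. apply diff_quot_cdiff; auto.
  - intros w hw. specialize (on w hw). lra. }
assert (cinv : path_cont (fun w => / (w - z))%C (diamond c r)).
{ intros w hw. now apply cdiff_ccont, cdiff_inv_minus, ne. }
assert (cf : path_cont (fun w => f w / (w - z))%C (diamond c r)).
{ intros w hw. apply cdiff_ccont, (cdiff_mult f (fun w => / (w - z))%C).
  - apply hf. unfold disc. specialize (on w hw). lra.
  - now apply cdiff_inv_minus, ne. }
rewrite (path_int_ext _ (fun w => f w / (w - z) - f z * / (w - z))%C) in H.
2: { intros w hw. rewrite diff_quot_ne by now apply ne. field. now apply Cminus_neq_0, ne. }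
rewrite path_int_minus, path_int_scal, winding_diamond in H; auto; try lra.
- apply Cminus_eq_0 in H. rewrite H. ring.
- intros w hw. now apply ccont_scal, cinv.
Qed.

(** * Cauchy's theorem for contours with prescribed winding numbers *)

Lemma two_pi_i_pos : 0 < Cmod two_pi_i.
Proof. apply Cmod_gt_0, two_pi_i_neq_0. Qed.

Lemma diamond_far (c z w : C) (r : R) : 0 < r -> on_contour (diamond c r) w ->
  Cmod (z - c) <= r / 4 -> r / 4 <= Cmod (w - z).
Proof.
intros hr hw hz. apply diamond_dist in hw; [|lra].
generalize (Cmod_minus_triangle w z c). lra.
Qed.

Lemma Cmod_inv_le (z : C) (d : R) : 0 < d -> d <= Cmod z -> Cmod (/ z) <= / d.
Proof.
intros hd h. rewrite Cmod_inv by (apply Cmod_gt_0; lra).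
apply Rinv_le_contravar; lra.
Qed.

(** [K] depends on the radii alone. This uniformity in [f] and [c] is what permits differentiation
    under a contour integral, where [f] runs over a family of functions. *)
Lemma cauchy_quotients (r R0 : R) : 0 < r < R0 ->
  exists K, 0 < K /\ forall (f : C -> C) (c : C) (M : R),
    (forall w, disc c R0 w -> cdiff f w) -> (forall w, disc c R0 w -> Cmod (f w) <= M) ->
    forall z z', Cmod (z - c) <= r / 4 -> Cmod (z' - c) <= r / 4 ->
    Cmod (f z - f z') <= K * M * Cmod (z - z') /\
    (z <> c -> z' <> c ->
     Cmod ((f z - f c) / (z - c) - (f z' - f c) / (z' - c)) <= K * M * Cmod (z - z')).
Proof.
intros hr.
assert (h2 := two_pi_i_pos). assert (n2 := two_pi_i_neq_0).
set (K0 := / (r / 4) * / (r / 4)). set (K1 := / (r / 4) * / (r / 4) * / (r / 4)).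
assert (hi : 0 < / (r / 4)) by (apply Rinv_0_lt_compat; lra).
assert (hK0 : 0 < K0) by (unfold K0; now apply Rmult_lt_0_compat).
assert (hK1 : 0 < K1) by (unfold K1; repeat apply Rmult_lt_0_compat; auto).
(* Twice the length bound [8 * r], times the bounds of products of two or three kernels, each at
   most [1 / (r / 4)]. *)
exists (16 * r * (K0 + K1) / Cmod two_pi_i). split.
{ apply Rdiv_lt_0_compat; [|exact h2]. repeat apply Rmult_lt_0_compat; lra. }
intros f c M hf hM z z' hz hz'.
set (G := diamond c r).
assert (far : forall u w, Cmod (u - c) <= r / 4 -> on_contour G w -> r / 4 <= Cmod (w - u)).
{ intros u w hu hw. apply (diamond_far c u w r); auto; lra. }
assert (hcc : Cmod (c - c) <= r / 4) by (rewrite Cmod_minus_self; lra).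
assert (ne : forall u w, Cmod (u - c) <= r / 4 -> on_contour G w -> (w - u <> 0)%C).
{ intros u w hu hw. apply Cmod_gt_0. specialize (far u w hu hw). lra. }
assert (inD : forall w, on_contour G w -> disc c R0 w).
{ intros w hw. apply diamond_dist in hw; [|lra]. unfold disc. lra. }
assert (M0 : 0 <= M).
{ eapply Rle_trans; [apply Cmod_ge_0|apply (hM c)]. unfold disc. rewrite Cmod_minus_self. lra. }
assert (ker : forall u, Cmod (u - c) <= r / 4 -> forall w, on_contour G w -> cdiff (fun w => / (w - u))%C w).
{ intros u hu w hw. apply cdiff_inv_minus. intros ->. apply (ne u u hu hw). ring. }
assert (kerle : forall u w, Cmod (u - c) <= r / 4 -> on_contour G w -> Cmod (/ (w - u)) <= / (r / 4)).
{ intros u w hu hw. apply Cmod_inv_le; [lra|auto]. }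
assert (len : path_length G <= 8 * r) by (apply diamond_length; lra).
assert (len0 := path_length_ge0 G).
assert (cf : forall u, Cmod (u - c) <= r / 4 ->
   path_int (fun w => f w / (w - u))%C G = (two_pi_i * f u)%C).
{ intros u hu. now apply cauchy_formula with R0. }
set (q2 := fun w => (f w * (/ (w - z) * / (w - z')))%C).
assert (c2 : path_cont q2 G).
{ intros w hw. apply cdiff_ccont, cdiff_mult; [apply hf; auto|].
  apply cdiff_mult; now apply ker. }
set (q3 := fun w => (f w * (/ (w - z) * / (w - z') * / (w - c)))%C).
assert (c3 : path_cont q3 G).
{ intros w hw. apply cdiff_ccont, cdiff_mult; [apply hf; auto|].
  apply cdiff_mult; [apply cdiff_mult|]; now apply ker. }
assert (b2 : Cmod (path_int q2 G) <= 16 * r * (M * K0)).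
{ eapply Rle_trans; [apply (path_int_le q2 G (M * K0)); auto|].
  - intros w hw. unfold q2. rewrite !Cmod_mult.
    apply Rmult_le_compat; auto using Cmod_ge_0.
    + apply Rmult_le_pos; apply Cmod_ge_0.
    + apply Rmult_le_compat; auto using Cmod_ge_0.
  - assert (0 <= M * K0) by (apply Rmult_le_pos; lra). nra. }
assert (b3 : Cmod (path_int q3 G) <= 16 * r * (M * K1)).
{ eapply Rle_trans; [apply (path_int_le q3 G (M * K1)); auto|].
  - intros w hw. unfold q3. rewrite !Cmod_mult.
    apply Rmult_le_compat; auto using Cmod_ge_0.
    + repeat apply Rmult_le_pos; apply Cmod_ge_0.
    + apply Rmult_le_compat; auto using Cmod_ge_0.
      * apply Rmult_le_pos; apply Cmod_ge_0.
      * apply Rmult_le_compat; auto using Cmod_ge_0.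
  - assert (0 <= M * K1) by (apply Rmult_le_pos; lra). nra. }
assert (cdiv : forall u, Cmod (u - c) <= r / 4 -> path_cont (fun w => f w / (w - u))%C G).
{ intros u hu w hw. apply cdiff_ccont, (cdiff_mult f (fun w => / (w - u))%C); auto. }
assert (e2 : (two_pi_i * (f z - f z') = (z - z') * path_int q2 G)%C).
{ replace (two_pi_i * (f z - f z'))%C with (two_pi_i * f z - two_pi_i * f z')%C by ring.
  rewrite <- !cf, <- path_int_minus, <- path_int_scal by auto.
  apply path_int_ext. intros w hw. unfold q2. field. split; apply ne; auto. }
assert (dz : Cmod (z - z') >= 0) by (apply Rle_ge, Cmod_ge_0).
split.
- replace (f z - f z')%C with ((z - z') * path_int q2 G / two_pi_i)%C by (rewrite <- e2; field; auto).
  rewrite Cmod_div, Cmod_mult by auto.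
  apply Rle_div_l; [exact h2|].
  replace (16 * r * (K0 + K1) / Cmod two_pi_i * M * Cmod (z - z') * Cmod two_pi_i)
    with (Cmod (z - z') * (16 * r * (M * (K0 + K1)))) by (field; lra).
  apply Rmult_le_compat_l; [lra|]. eapply Rle_trans; [exact b2|].
  apply Rmult_le_compat_l; [lra|]. apply Rmult_le_compat_l; lra.
- intros hzc hzc'.
  assert (e1 : forall u, Cmod (u - c) <= r / 4 -> u <> c ->
    (two_pi_i * ((f u - f c) / (u - c)) = path_int (fun w => f w * (/ (w - u) * / (w - c))) G)%C).
  { intros u hu huc.
    replace (two_pi_i * ((f u - f c) / (u - c)))%C
      with (/ (u - c) * (two_pi_i * f u - two_pi_i * f c))%C by (field; now apply Cminus_neq_0).
    rewrite <- !cf, <- path_int_minus, <- path_int_scal by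
      (auto; intros w hw; exact (ccont_minus _ _ _ (cdiv u hu w hw) (cdiv c hcc w hw))).
    apply path_int_ext. intros w hw. field.
    repeat split; first [now apply Cminus_neq_0|now apply ne]. }
  assert (e3 : (two_pi_i * ((f z - f c) / (z - c) - (f z' - f c) / (z' - c))
     = (z - z') * path_int q3 G)%C).
  { match goal with |- (_ * (?a - ?b) = _)%C =>
      replace (two_pi_i * (a - b))%C with (two_pi_i * a - two_pi_i * b)%C by ring end.
    assert (cc : forall u, Cmod (u - c) <= r / 4 -> path_cont (fun w => f w * (/ (w - u) * / (w - c)))%C G).
    { intros u hu w hw. apply cdiff_ccont, cdiff_mult; auto. apply cdiff_mult; auto. }
    rewrite !e1, <- path_int_minus, <- path_int_scal by auto.
    apply path_int_ext. intros w hw. unfold q3. field. repeat split; apply ne; auto. }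
  match goal with |- Cmod ?x <= _ => replace x with ((z - z') * path_int q3 G / two_pi_i)%C
    by (rewrite <- e3; field; repeat split; auto; now apply Cminus_neq_0) end.
  rewrite Cmod_div, Cmod_mult by auto.
  apply Rle_div_l; [exact h2|].
  replace (16 * r * (K0 + K1) / Cmod two_pi_i * M * Cmod (z - z') * Cmod two_pi_i)
    with (Cmod (z - z') * (16 * r * (M * (K0 + K1)))) by (field; lra).
  apply Rmult_le_compat_l; [lra|]. eapply Rle_trans; [exact b3|].
  apply Rmult_le_compat_l; [lra|]. apply Rmult_le_compat_l; lra.
Qed.

(** A Lipschitz function on a punctured disc extends to the centre. The sequence [c + d / (n + 1)]
    merely produces the candidate for the value. *)
Lemma lipschitz_limit (Q : C -> C) (c : C) (d L : R) : 0 < d -> 0 <= L ->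
  (forall z z', z <> c -> z' <> c -> Cmod (z - c) <= d -> Cmod (z' - c) <= d ->
     Cmod (Q z - Q z') <= L * Cmod (z - z')) ->
  exists l, forall z, z <> c -> Cmod (z - c) <= d -> Cmod (Q z - l) <= L * Cmod (z - c).
Proof.
intros hd hL H.
set (x := fun n => (c + RtoC (d / (INR n + 1)))%C).
assert (pn : forall n, 0 < INR n + 1) by (intros n; generalize (pos_INR n); lra).
assert (xc : forall n, Cmod (x n - c) = d / (INR n + 1)).
{ intros n. unfold x. replace (c + RtoC (d / (INR n + 1)) - c)%C with (RtoC (d / (INR n + 1))) by ring.
  rewrite Cmod_R. apply Rabs_pos_eq. left. now apply Rdiv_lt_0_compat. }
assert (xd : forall n, Cmod (x n - c) <= d).
{ intros n. rewrite xc. apply Rle_div_l; [apply pn|]. generalize (pos_INR n). nra. }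
assert (xne : forall n, x n <> c).
{ intros n e. specialize (xc n). rewrite e, Cmod_minus_self in xc.
  generalize (Rdiv_lt_0_compat d (INR n + 1) hd (pn n)). lra. }
assert (small : forall eps, 0 < eps -> exists N, forall n, (N <= n)%nat -> L * Cmod (x n - c) <= eps).
{ intros eps heps. destruct (INR_unbounded (L * d / eps)) as [N hN]. exists N.
  intros n hn. rewrite xc. apply le_INR in hn.
  replace (L * (d / (INR n + 1))) with (L * d / (INR n + 1)) by (field; generalize (pn n); lra).
  apply Rle_div_l; [apply pn|]. apply Rlt_div_l in hN; [|lra]. nra. }
destruct (C_complete (fun n => Q (x n))) as [l hl].
{ intros eps heps. destruct (small (eps / 2) ltac:(lra)) as [N hN]. exists N. intros n m hn hm.
  eapply Rle_trans; [apply H; auto|].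
  generalize (Cmod_minus_triangle (x n) c (x m)). rewrite (Cmod_minus_sym c (x m)).
  generalize (hN n hn) (hN m hm). nra. }
exists l. intros z hz hzd. apply le_epsilon. intros eps heps.
destruct (small (eps / 2) ltac:(lra)) as [N hN].
destruct (hl (eps / 2) ltac:(lra)) as [N' hN'].
set (n := max N N'). specialize (hN n ltac:(lia)). specialize (hN' n ltac:(lia)). simpl in hN'.
generalize (Cmod_minus_triangle (Q z) (Q (x n)) l) (H z (x n) hz (xne n) hzd (xd n)).
generalize (Cmod_minus_triangle z c (x n)). rewrite (Cmod_minus_sym c (x n)). nra.
Qed.

(** Differentiation under the integral sign without joint continuity of [k]. By [cauchy_quotients]
    the difference quotients of [k z w] at [c] are Lipschitz in [z] with one constant for all [w];
    so are those of the integral, which therefore have a limit. *)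
Lemma path_int_param_cdiff (k : C -> C -> C) (G : contour) (c : C) (R0 M : R) :
  0 < R0 ->
  (forall w z, on_contour G w -> disc c R0 z -> cdiff (fun z => k z w) z) ->
  (forall w z, on_contour G w -> disc c R0 z -> Cmod (k z w) <= M) ->
  (forall z, disc c R0 z -> path_cont (k z) G) ->
  cdiff (fun z => path_int (k z) G) c.
Proof.
intros hR hd hM hc.
destruct (cauchy_quotients (R0 / 2) R0 ltac:(lra)) as [K [hK H]].
set (rr := R0 / 2 / 4).
assert (hcd : disc c R0 c) by (unfold disc; rewrite Cmod_minus_self; lra).
assert (hrr : forall z, Cmod (z - c) <= rr -> disc c R0 z) by (intros z hz; unfold disc, rr in *; lra).
set (M' := Rmax M 0).
assert (hM' : forall w z, on_contour G w -> disc c R0 z -> Cmod (k z w) <= M').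
{ intros w z hw hz. eapply Rle_trans; [apply hM; auto|apply Rmax_l]. }
assert (M0 : 0 <= M') by apply Rmax_r.
set (h := fun z => path_int (k z) G).
assert (E : forall z, Cmod (z - c) <= rr -> z <> c ->
  ((h z - h c) / (z - c))%C = path_int (fun w => (k z w - k c w) / (z - c))%C G /\
  path_cont (fun w => (k z w - k c w) / (z - c))%C G).
{ intros z hz hne.
  assert (pc : path_cont (fun w => k z w - k c w)%C G).
  { intros w hw. apply ccont_minus; [apply (hc z)|apply (hc c)]; auto. }
  split.
  - unfold h. rewrite <- path_int_minus by auto.
    unfold Cdiv. rewrite Cmult_comm, <- path_int_scal by exact pc.
    apply path_int_ext. intros; ring.
  - intros w hw. apply (ccont_ext_loc (fun w => / (z - c) * (k z w - k c w))%C _ w 1);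
      [lra|intros; unfold Cdiv; ring|]. now apply ccont_scal, pc. }
assert (L0 : 0 <= 2 * (path_length G * (K * M'))).
{ assert (l := path_length_ge0 G). assert (0 <= K * M') by (apply Rmult_le_pos; lra). nra. }
destruct (lipschitz_limit (fun z => (h z - h c) / (z - c))%C c rr (2 * (path_length G * (K * M'))))
  as [l hl]; [unfold rr; lra|exact L0| |].
{ intros z z' hz hz' dz dz'.
  destruct (E z dz hz) as [-> p1]. destruct (E z' dz' hz') as [-> p2].
  rewrite <- path_int_minus by assumption.
  eapply Rle_trans; [apply (path_int_le _ G (K * M' * Cmod (z - z')))|right; ring].
  - intros w hw. apply ccont_minus; [now apply p1|now apply p2].
  - intros w hw. apply (H (fun z => k z w) c M'); auto. }
exists l. intros eps heps.
set (L := 2 * (path_length G * (K * M'))) in *.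
exists (Rmin rr (eps / (L + 1))).
split. { apply Rmin_pos; [unfold rr; lra|apply Rdiv_lt_0_compat; lra]. }
intros z hz.
assert (z1 := Rlt_le_trans _ _ _ hz (Rmin_l _ _)).
assert (z2 := Rlt_le_trans _ _ _ hz (Rmin_r _ _)).
apply Rlt_div_r in z2; [|lra].
destruct (excluded_middle_informative (z = c)) as [->|hne].
{ replace (h c - h c - l * (c - c))%C with (RtoC 0) by ring.
  rewrite Cmod_0. apply Rmult_le_pos; [lra|apply Cmod_ge_0]. }
specialize (hl z hne ltac:(lra)).
replace (h z - h c - l * (z - c))%C with (((h z - h c) / (z - c) - l) * (z - c))%C
  by (field; now apply Cminus_neq_0).
rewrite Cmod_mult. apply Rmult_le_compat_r; [apply Cmod_ge_0|].
generalize (Cmod_ge_0 (z - c)). nra.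
Qed.

Lemma ccont_agree (f g : C -> C) (c : C) (d : R) : 0 < d ->
  ccont f c -> ccont g c -> (forall z, z <> c -> Cmod (z - c) < d -> f z = g z) -> f c = g c.
Proof.
intros hd hf hg H. apply Cminus_eq_0, Cmod_eq_0, Rle_antisym; [|apply Cmod_ge_0].
apply le_epsilon. intros eps heps. rewrite Rplus_0_l.
destruct (hf (eps / 2) ltac:(lra)) as [d1 [p1 H1]].
destruct (hg (eps / 2) ltac:(lra)) as [d2 [p2 H2]].
set (e := Rmin d (Rmin d1 d2) / 2).
assert (he : 0 < e) by (unfold e; assert (0 < Rmin d (Rmin d1 d2)) by (repeat apply Rmin_pos; auto); lra).
set (z := (c + RtoC e)%C).
assert (hz : Cmod (z - c) = e).
{ unfold z. replace (c + RtoC e - c)%C with (RtoC e) by ring. rewrite Cmod_R. apply Rabs_pos_eq; lra. }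
assert (e1 : e < d /\ e < d1 /\ e < d2).
{ generalize (Rmin_l d (Rmin d1 d2)) (Rmin_r d (Rmin d1 d2)) (Rmin_l d1 d2) (Rmin_r d1 d2).
  unfold e in *. lra. }
assert (ne : z <> c) by (intros e0; rewrite e0, Cmod_minus_self in hz; lra).
specialize (H z ne ltac:(lra)). specialize (H1 z ltac:(lra)). specialize (H2 z ltac:(lra)).
rewrite H in H1. rewrite Cmod_minus_sym in H1.
generalize (Cmod_minus_triangle (f c) (g z) (g c)). lra.
Qed.

(** Cauchy's formula writes the quotient, off [c], as the integral of [f w / ((w - c) (w - z))],
    which is differentiable in [z] at [c] too; continuity of both sides identifies the values at
    [c]. *)
Lemma removable (f : C -> C) (c l : C) (R0 : R) : 0 < R0 ->
  (forall w, disc c R0 w -> cdiff f w) -> cderiv f c l -> cdiff (diff_quot f l c) c.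
Proof.
intros hR hf hl.
set (r := R0 / 2). set (G := diamond c r).
assert (hr : 0 < r) by (unfold r; lra).
assert (far : forall u w, Cmod (u - c) <= r / 4 -> on_contour G w -> r / 4 <= Cmod (w - u)).
{ intros u w hu hw. apply (diamond_far c u w r); auto; lra. }
assert (hcc : Cmod (c - c) <= r / 4) by (rewrite Cmod_minus_self; lra).
assert (ne : forall u w, Cmod (u - c) <= r / 4 -> on_contour G w -> (w - u <> 0)%C).
{ intros u w hu hw. apply Cmod_gt_0. specialize (far u w hu hw). lra. }
assert (inD : forall w, on_contour G w -> disc c R0 w).
{ intros w hw. apply diamond_dist in hw; [|lra]. unfold disc, r in *. lra. }
destruct (path_bounded f G) as [M [M0 hM]].
{ intros w hw. apply cdiff_ccont, hf. auto. }
assert (cker : forall u, Cmod (u - c) <= r / 4 -> forall w, on_contour G w -> cdiff (fun w => / (w - u))%C w).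
{ intros u hu w hw. apply cdiff_inv_minus. intros ->. apply (ne u u hu hw). ring. }
set (k := fun z w => (f w * (/ (w - c) * / (w - z)))%C).
assert (kc : forall z, Cmod (z - c) <= r / 4 -> path_cont (k z) G).
{ intros z hz w hw. apply cdiff_ccont, cdiff_mult; auto. apply cdiff_mult; auto. }
assert (kd : cdiff (fun z => path_int (k z) G) c).
{ apply (path_int_param_cdiff k G c (r / 4) (M * (/ (r / 4) * / (r / 4)))); auto; [lra| |].
  - intros w z hw hz. apply cdiff_mult; [apply cdiff_const|].
    apply cdiff_mult; [apply cdiff_const|].
    apply (cdiff_inv (fun z => w - z)%C); [|now apply ne].
    apply cdiff_minus; [apply cdiff_const|apply cdiff_id].
  - intros w z hw hz. unfold k. rewrite !Cmod_mult.
    apply Rmult_le_compat; auto using Cmod_ge_0.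
    + apply Rmult_le_pos; apply Cmod_ge_0.
    + apply Rmult_le_compat; auto using Cmod_ge_0; apply Cmod_inv_le; auto; lra. }
assert (n2 := two_pi_i_neq_0).
assert (kd' : cdiff (fun z => / two_pi_i * path_int (k z) G)%C c).
{ apply cdiff_mult; [apply cdiff_const|exact kd]. }
assert (agree : forall z, z <> c -> Cmod (z - c) < r / 4 ->
   (/ two_pi_i * path_int (k z) G)%C = diff_quot f l c z).
{ intros z hz hzd. assert (hzd' := Rlt_le _ _ hzd). rewrite diff_quot_ne by exact hz.
  assert (cf : forall u, Cmod (u - c) <= r / 4 ->
     path_int (fun w => f w / (w - u))%C G = (two_pi_i * f u)%C).
  { intros u hu. apply cauchy_formula with R0; auto. unfold r; lra. }
  assert (cdiv : forall u, Cmod (u - c) <= r / 4 -> path_cont (fun w => f w / (w - u))%C G).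
  { intros u hu w hw. apply cdiff_ccont, (cdiff_mult f (fun w => / (w - u))%C); auto. }
  assert (e : path_int (k z) G = (/ (z - c) * (two_pi_i * f z - two_pi_i * f c))%C).
  { rewrite <- !cf, <- path_int_minus, <- path_int_scal by
      (auto; try lra; intros w hw; exact (ccont_minus _ _ _ (cdiv z hzd' w hw) (cdiv c hcc w hw))).
    apply path_int_ext. intros w hw. unfold k. field.
    repeat split; first [now apply Cminus_neq_0|apply ne; auto; lra]. }
  rewrite e. field. split; [now apply Cminus_neq_0|exact n2]. }
apply (cdiff_ext_loc (fun z => / two_pi_i * path_int (k z) G)%C _ c (r / 4)); [lra| |exact kd'].
intros w hw. destruct (excluded_middle_informative (w = c)) as [->|h]; [|now apply agree].
apply (ccont_agree (fun z => / two_pi_i * path_int (k z) G)%C (diff_quot f l c) c (r / 4)); [lra|now apply cdiff_ccont| |exact agree].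
apply diff_quot_ccont; [exact hl|]. apply hf. unfold disc. rewrite Cmod_minus_self; lra.
Qed.

Lemma cderiv_le (f : C -> C) (c l : C) (d B : R) : 0 < d -> cderiv f c l ->
  (forall z, Cmod (z - c) < d -> Cmod (f z - f c) <= B * Cmod (z - c)) -> Cmod l <= B.
Proof.
intros hd hl H. apply le_epsilon. intros eps heps.
destruct (hl eps heps) as [d1 [p1 H1]].
set (e := Rmin d d1 / 2).
assert (he : 0 < e) by (unfold e; assert (0 < Rmin d d1) by (repeat apply Rmin_pos; auto); lra).
set (z := (c + RtoC e)%C).
assert (zc : (z - c)%C = RtoC e) by (unfold z; ring).
assert (hz : Cmod (z - c) = e) by (rewrite zc, Cmod_R; apply Rabs_pos_eq; lra).
assert (e1 : e < d /\ e < d1).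
{ generalize (Rmin_l d d1) (Rmin_r d d1). unfold e in *. lra. }
specialize (H z ltac:(lra)). specialize (H1 z ltac:(lra)). rewrite hz in *.
apply (Rmult_le_reg_r e); [exact he|].
replace (Cmod l * e) with (Cmod (l * (z - c))) by (rewrite Cmod_mult, hz; reflexivity).
replace (l * (z - c))%C with ((f z - f c) - (f z - f c - l * (z - c)))%C by ring.
eapply Rle_trans; [apply Cmod_minus_le|]. lra.
Qed.

Definition copen (U : C -> Prop) : Prop :=
  forall z, U z -> exists d, 0 < d /\ forall w, Cmod (w - z) < d -> U w.

(** A bound for the continuous function [1 / (w - c)] along [G] is the inverse of a distance. *)
Lemma contour_dist (G : contour) (c : C) : ~ on_contour G c ->
  exists d, 0 < d /\ forall w, on_contour G w -> d <= Cmod (w - c).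
Proof.
intros hc. destruct (path_bounded (fun w => / (w - c))%C G) as [M [M0 hM]].
{ intros w hw. apply cdiff_ccont, cdiff_inv_minus. intros ->. auto. }
exists (/ M). split; [now apply Rinv_0_lt_compat|]. intros w hw. specialize (hM w hw).
assert (ne : (w - c <> 0)%C) by (apply Cminus_neq_0; intros ->; auto).
rewrite Cmod_inv in hM by exact ne. apply Cmod_gt_0 in ne.
rewrite <- (Rinv_inv (Cmod (w - c))). apply Rinv_le_contravar; [now apply Rinv_0_lt_compat|exact hM].
Qed.

Lemma liouville (phi : C -> C) (A B : R) : (forall z, cdiff phi z) -> 0 <= A ->
  (forall z, B < Cmod z -> Cmod (phi z) <= A / (Cmod z - B)) -> forall z, phi z = 0%C.
Proof.
intros hd hA hB z. assert (h2 := two_pi_i_pos).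
apply Cmod_eq_0, Rle_antisym; [|apply Cmod_ge_0].
apply le_epsilon. intros eps heps. rewrite Rplus_0_l.
(* On the diamond of size [r] about [z] one has [|phi| <= A / (T + 1)] and [1 / |w - z| <= 2 / r];
   with length at most [8 r] and the factor 2 of [cint_le] this gives [32 A / (T + 1)]. *)
set (T := 32 * A / (eps * Cmod two_pi_i)).
assert (hT : 0 <= T).
{ unfold T. apply Rmult_le_pos; [lra|]. left. apply Rinv_0_lt_compat. now apply Rmult_lt_0_compat. }
set (r := 2 * (Cmod z + Rabs B + 1 + T)).
assert (hr : 2 <= r) by (unfold r; generalize (Cmod_ge_0 z) (Rabs_pos B); lra).
assert (on : forall w, on_contour (diamond z r) w -> r / 2 <= Cmod (w - z) <= r).
{ intros w hw. apply diamond_dist; auto; lra. }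
assert (E : path_int (fun w => phi w / (w - z))%C (diamond z r) = (two_pi_i * phi z)%C).
{ apply cauchy_formula with (r + 1); [auto|lra|]. rewrite Cmod_minus_self. lra. }
assert (F : Cmod (path_int (fun w => phi w / (w - z))%C (diamond z r)) <=
   2 * (path_length (diamond z r) * (A / (T + 1) * (2 / r)))).
{ apply path_int_le.
  - intros w hw. apply cdiff_ccont, (cdiff_mult phi (fun w => / (w - z))%C); [apply hd|].
    apply cdiff_inv_minus. intros ->. specialize (on z hw). rewrite Cmod_minus_self in on. lra.
  - intros w hw. specialize (on w hw).
    assert (n0 : (w - z <> 0)%C) by (apply Cmod_gt_0; lra).
    unfold Cdiv. rewrite Cmod_mult. apply Rmult_le_compat; auto using Cmod_ge_0.
    + assert (hw2 : T + 1 <= Cmod w - B).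
      { generalize (Cmod_minus_le w z) (Rle_abs B). unfold r in *. lra. }
      eapply Rle_trans; [apply hB; lra|]. apply Rmult_le_compat_l; [exact hA|].
      apply Rinv_le_contravar; lra.
    + replace (2 / r) with (/ (r / 2)) by (field; lra). apply Cmod_inv_le; lra. }
rewrite E, Cmod_mult in F.
assert (len : path_length (diamond z r) <= 8 * r) by (apply diamond_length; lra).
assert (hp : 0 <= A / (T + 1) * (2 / r)).
{ apply Rmult_le_pos; (apply Rmult_le_pos; [lra|left; apply Rinv_0_lt_compat; lra]). }
assert (F2 : Cmod two_pi_i * Cmod (phi z) <= 32 * A / (T + 1)).
{ eapply Rle_trans; [exact F|].
  replace (32 * A / (T + 1)) with (2 * (8 * r * (A / (T + 1) * (2 / r)))) by (field; lra).
  apply Rmult_le_compat_l; [lra|]. now apply Rmult_le_compat_r. }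
apply (Rmult_le_reg_l (Cmod two_pi_i)); [exact h2|].
eapply Rle_trans; [exact F2|]. apply Rle_div_l; [lra|].
assert (e : Cmod two_pi_i * eps * T = 32 * A) by (unfold T; field; lra).
assert (0 <= Cmod two_pi_i * eps) by (apply Rmult_le_pos; lra). lra.
Qed.

(* Dixon's argument: the function [phi] below is entire and vanishes at infinity. *)
Theorem cauchy_homology (f : C -> C) (U : C -> Prop) (G : contour) :
  copen U -> (forall z, U z -> cdiff f z) -> closed_path G ->
  (forall z, on_contour G z -> U z) ->
  (forall z, ~ U z -> path_int (fun w => / (w - z))%C G = 0%C) ->
  forall z, U z -> ~ on_contour G z ->
  path_int (fun w => f w / (w - z))%C G = (f z * path_int (fun w => / (w - z))%C G)%C.
Proof.
intros hU hf hG hGU hn.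
set (D := fun z => epsilon (inhabits (RtoC 0)) (cderiv f z)).
assert (hD : forall z, U z -> cderiv f z (D z)).
{ intros z hz. apply epsilon_spec. now apply hf. }
(* For [z] in [U] and off the contour, the two formulas differ by [f z] times the winding integral.
   They agree wherever this vanishes, which is how the pieces glue. *)
set (phi := fun z => if excluded_middle_informative (U z)
   then path_int (diff_quot f (D z) z) G else path_int (fun w => f w / (w - z))%C G).
assert (cker : forall u, ~ on_contour G u -> path_cont (fun w => / (w - u))%C G).
{ intros u hu w hw. apply cdiff_ccont, cdiff_inv_minus. intros ->. auto. }
assert (cdiv : forall u, ~ on_contour G u -> path_cont (fun w => f w / (w - u))%C G).
{ intros u hu w hw. apply cdiff_ccont, (cdiff_mult f (fun w => / (w - u))%C); auto.
  apply cdiff_inv_minus. intros ->. auto. }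
assert (phi_in : forall z, U z -> phi z = path_int (diff_quot f (D z) z) G).
{ intros z hz. unfold phi. destruct (excluded_middle_informative (U z)); tauto. }
assert (phi_out : forall z, ~ on_contour G z ->
   (U z -> path_int (fun w => / (w - z))%C G = 0%C) ->
   phi z = path_int (fun w => f w / (w - z))%C G).
{ intros z hz h0. unfold phi. destruct (excluded_middle_informative (U z)) as [h|h]; [|reflexivity].
  rewrite (path_int_ext _ (fun w => f w / (w - z) - f z * / (w - z))%C).
  - rewrite path_int_minus, path_int_scal, h0; auto; [ring|].
    intros w hw. now apply ccont_scal, cker.
  - intros w hw. assert (w <> z) by (intros ->; auto).
    rewrite diff_quot_ne by assumption. field. now apply Cminus_neq_0. }
(* Symmetry turns differentiability in the base point into differentiability in the other point,
   which [dq] provides. *)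
assert (sym : forall z w, diff_quot f (D z) z w = diff_quot f (D w) w z).
{ intros z w. destruct (excluded_middle_informative (w = z)) as [->|h]; [reflexivity|].
  rewrite !diff_quot_ne by auto. field. split; apply Cminus_neq_0; auto. }
destruct (path_bounded f G) as [Mf [Mf0 hMf]].
{ intros w hw. apply cdiff_ccont; auto. }
assert (dq : forall w z, U w -> U z -> cdiff (diff_quot f (D w) w) z).
{ intros w z hw hz. destruct (excluded_middle_informative (z = w)) as [->|h].
  - destruct (hU w hw) as [d [hd Hd]]. apply (removable f w (D w) (d / 2)); auto; [lra|].
    intros u hu. apply hf, Hd. unfold disc in hu. lra.
  - now apply diff_quot_cdiff, hf. }
assert (hphi : forall c, cdiff phi c).
{ intros c. destruct (excluded_middle_informative (U c)) as [hc|hc].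
  - destruct (hU c hc) as [d0 [hd0 Hd0]].
    destruct (cdiff_ccont f c (hf c hc) 1 ltac:(lra)) as [d1 [hd1 Hd1]].
    set (R0 := Rmin d0 d1 / 2).
    assert (hR0 : 0 < R0) by (unfold R0; assert (0 < Rmin d0 d1) by (apply Rmin_pos; auto); lra).
    assert (R0le : R0 < d0 /\ R0 < d1)
      by (generalize (Rmin_l d0 d1) (Rmin_r d0 d1); unfold R0 in *; lra).
    assert (RU : forall w, disc c R0 w -> U w) by (intros w hw; apply Hd0; unfold disc in hw; lra).
    set (M0 := Cmod (f c) + 1).
    assert (hM0 : forall w, disc c R0 w -> Cmod (f w) <= M0).
    { intros w hw. unfold disc in hw. specialize (Hd1 w ltac:(lra)).
      generalize (Cmod_rev_triangle (f w) (f c)). unfold M0. lra. }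
    assert (M0pos : 0 < M0) by (unfold M0; generalize (Cmod_ge_0 (f c)); lra).
    set (r := R0 / 2).
    destruct (cauchy_quotients r R0 ltac:(unfold r; lra)) as [K [hK HK]].
    specialize (HK f c M0 (fun w hw => hf w (RU w hw)) hM0).
    assert (KM : 0 < K * M0) by now apply Rmult_lt_0_compat.
    set (M := K * M0 + (Mf + M0) * / (r / 8)).
    apply (cdiff_ext_loc (fun z => path_int (diff_quot f (D z) z) G) _ c (r / 8)).
    + unfold r; lra.
    + intros w hw. symmetry. apply phi_in, RU. unfold disc, r in *. lra.
    + assert (hi : 0 < / (r / 8)) by (apply Rinv_0_lt_compat; unfold r; lra).
      apply (path_int_param_cdiff (fun z => diff_quot f (D z) z) G c (r / 8) M).
      * unfold r; lra.
      * intros w z hw hz.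
        apply (cdiff_ext_loc (diff_quot f (D w) w) _ z 1); [lra|intros; apply sym|].
        apply dq; auto. apply RU. unfold disc, r in *. lra.
      * intros w z hw hz. unfold disc in hz.
        assert (P : 0 < (Mf + M0) * / (r / 8)) by (apply Rmult_lt_0_compat; lra).
        (* A bound uniform in [w]: for [w] near [c] the Cauchy estimate bounds the quotient, also at
           [w = z] where it is a derivative; for [w] farther away the denominator is at least
           [r / 8]. *)
        destruct (Rle_dec (Cmod (w - c)) (r / 4)) as [hwc|hwc].
        -- apply Rle_trans with (K * M0); [|unfold M; lra].
           destruct (excluded_middle_informative (w = z)) as [->|hwz].
           ++ rewrite diff_quot_eq.
              apply (cderiv_le f z (D z) (r / 8)); [unfold r; lra|apply hD; auto|].
              intros x hx. apply HK.
              ** generalize (Cmod_minus_triangle x z c). lra.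
              ** exact hwc.
           ++ rewrite diff_quot_ne by exact hwz.
              assert (h := Cmod_minus_pos w z hwz).
              rewrite Cmod_div by now apply Cminus_neq_0.
              apply Rle_div_l; [exact h|]. apply HK; [exact hwc|unfold r in *; lra].
        -- assert (hwz : r / 8 <= Cmod (w - z)) by (generalize (Cmod_minus_triangle w z c); lra).
           assert (hr : 0 < r / 8) by (unfold r; lra).
           assert (ne : w <> z) by (intros ->; rewrite Cmod_minus_self in hwz; lra).
           rewrite diff_quot_ne by exact ne. unfold Cdiv. rewrite Cmod_mult.
           apply Rle_trans with ((Mf + M0) * / (r / 8)); [|unfold M; lra].
           apply Rmult_le_compat; auto using Cmod_ge_0.
           ++ eapply Rle_trans; [apply Cmod_minus_le|]. apply Rplus_le_compat; auto.
              apply hM0. unfold disc, r in *. lra.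
           ++ now apply Cmod_inv_le.
      * intros z hz w hw. apply diff_quot_ccont; auto. apply hD, RU. unfold disc, r in *. lra.
  - assert (hcG : ~ on_contour G c) by auto.
    destruct (contour_dist G c hcG) as [d [hd Hd]].
    assert (far : forall z w, Cmod (z - c) <= d / 2 -> on_contour G w -> d / 2 <= Cmod (w - z)).
    { intros z w hz hw. specialize (Hd w hw). generalize (Cmod_minus_triangle w z c). lra. }
    assert (off : forall z, Cmod (z - c) <= d / 2 -> ~ on_contour G z).
    { intros z hz hzG. specialize (far z z hz hzG). rewrite Cmod_minus_self in far. lra. }
    (* The winding integral vanishes at [c], outside [U], and is locally constant; so the outer
       formula holds in a whole neighbourhood of [c], even at its points in [U]. *)
    apply (cdiff_ext_loc (fun z => path_int (fun w => f w / (w - z))%C G) _ c (d / 2)).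
    + lra.
    + intros z hz. symmetry. apply phi_out; [apply off; lra|]. intros _.
      rewrite (winding_locally_const G c z d); auto. lra.
    + apply (path_int_param_cdiff (fun z w => f w / (w - z))%C G c (d / 2) (Mf * / (d / 2))).
      * lra.
      * intros w z hw hz. apply (cdiff_mult (fun _ => f w) (fun z => / (w - z))%C); [apply cdiff_const|].
        apply (cdiff_inv (fun z => w - z)%C).
        -- apply cdiff_minus; [apply cdiff_const|apply cdiff_id].
        -- apply Cmod_gt_0. specialize (far z w hz hw). lra.
      * intros w z hw hz. unfold Cdiv. rewrite Cmod_mult.
        apply Rmult_le_compat; auto using Cmod_ge_0. apply Cmod_inv_le; [lra|auto].
      * intros z hz. apply cdiv, off, hz. }
destruct (path_bounded (fun w => w) G) as [B [B0 hB]].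
{ intros w hw. apply cdiff_ccont, cdiff_id. }
assert (H0 : forall z, phi z = 0%C).
{ apply (liouville phi (2 * (path_length G * Mf)) (B + 1)); auto.
  - generalize (path_length_ge0 G). nra.
  - intros z hz.
    assert (far : forall w, on_contour G w -> Cmod z - (B + 1) <= Cmod (w - z)).
    { intros w hw. specialize (hB w hw). rewrite Cmod_minus_sym.
      generalize (Cmod_rev_triangle z w). lra. }
    assert (off : ~ on_contour G z) by (intros h; specialize (hB z h); lra).
    rewrite phi_out; [|exact off|].
    + eapply Rle_trans; [apply (path_int_le _ G (Mf * / (Cmod z - (B + 1))))|].
      * now apply cdiv.
      * intros w hw. unfold Cdiv. rewrite Cmod_mult.
        apply Rmult_le_compat; auto using Cmod_ge_0. apply Cmod_inv_le; [lra|auto].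
      * right. unfold Rdiv. ring.
    (* The contour lies in a disc about 0 that does not contain [z], so the winding integral at [z]
       is 0. *)
    + intros _. apply (cauchy_disc _ 0 0 (B + 1)); auto.
      * intros w hw. apply cdiff_ccont, cdiff_inv_minus. intros ->. unfold disc in hw.
        replace (z - 0)%C with z in hw by ring. lra.
      * intros w hw _. apply cdiff_inv_minus. intros ->. unfold disc in hw.
        replace (z - 0)%C with z in hw by ring. lra.
      * unfold disc. rewrite Cmod_minus_self. lra.
      * intros w hw. replace (w - 0)%C with w by ring. specialize (hB w hw). lra. }
intros z hz hzG. specialize (H0 z). rewrite phi_in in H0 by exact hz.
rewrite (path_int_ext _ (fun w => f w / (w - z) - f z * / (w - z))%C) in H0.
- rewrite path_int_minus, path_int_scal in H0; auto.
  + now apply Cminus_eq_0.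
  + intros w hw. now apply ccont_scal, cker.
- intros w hw. assert (w <> z) by (intros ->; auto).
  rewrite diff_quot_ne by assumption. field. now apply Cminus_neq_0.
Qed.

(** * Operators on l2 *)

(** Sums over arbitrary duplicate-free lists detach square-summability from the enumeration of [Z]
    in [fold_Z], which reindexings do not respect. *)
Definition lsum (g : Z -> R) (L : list Z) : R := fold_right (fun k s => g k + s) 0 L.

Lemma lsum_cons (g : Z -> R) (k : Z) (L : list Z) : lsum g (k :: L) = g k + lsum g L.
Proof. reflexivity. Qed.

Lemma lsum_app (g : Z -> R) (L L' : list Z) : lsum g (L ++ L') = lsum g L + lsum g L'.
Proof.
induction L as [|k L IH]; simpl; [unfold lsum; simpl; ring|].
unfold lsum in *. simpl. rewrite IH. ring.
Qed.

Lemma lsum_ge0 (g : Z -> R) (L : list Z) : (forall k, 0 <= g k) -> 0 <= lsum g L.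
Proof.
intros h. induction L as [|k L IH]; unfold lsum in *; simpl; [lra|]. generalize (h k). lra.
Qed.

Lemma lsum_le (g h : Z -> R) (L : list Z) :
  (forall k, In k L -> g k <= h k) -> lsum g L <= lsum h L.
Proof.
induction L as [|k L IH]; intros H; unfold lsum in *; simpl; [lra|].
generalize (H k (or_introl eq_refl)) (IH (fun j hj => H j (or_intror hj))). lra.
Qed.

Lemma lsum_ext (g h : Z -> R) (L : list Z) :
  (forall k, In k L -> g k = h k) -> lsum g L = lsum h L.
Proof.
intros H. apply Rle_antisym; apply lsum_le; intros k hk; rewrite H by exact hk; lra.
Qed.

Lemma lsum_scal (c : R) (g : Z -> R) (L : list Z) : lsum (fun k => c * g k) L = c * lsum g L.
Proof. induction L as [|k L IH]; unfold lsum in *; simpl; [ring|]. rewrite IH. ring. Qed.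

Lemma lsum_incl (g : Z -> R) (L L' : list Z) : (forall k, 0 <= g k) ->
  NoDup L -> incl L L' -> lsum g L <= lsum g L'.
Proof.
intros hg. revert L'. induction L as [|k L IH]; intros L' hL hi; [now apply lsum_ge0|].
inversion hL as [|k' L'' hk hL']; subst.
destruct (in_split k L' (hi k (or_introl eq_refl))) as (l1 & l2 & ->).
assert (H : lsum g L <= lsum g (l1 ++ l2)).
{ apply IH; [exact hL'|]. intros x hx.
  assert (hx' := hi x (or_intror hx)). apply in_app_or in hx'. apply in_or_app.
  destruct hx' as [h|[h|h]]; [now left| |now right]. subst x. contradiction. }
rewrite lsum_app in *. unfold lsum in *. simpl. lra.
Qed.

(** The indices collected by the terms 0 to [n] of [fold_Z]. *)
Fixpoint zrange (n : nat) : list Z :=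
  match n with
  | O => 0%Z :: (-1)%Z :: nil
  | S m => Z.of_nat (S m) :: (- Z.of_nat (S (S m)))%Z :: zrange m
  end.

Lemma in_zrange (n : nat) (k : Z) :
  In k (zrange n) <-> (- Z.of_nat (S n) <= k <= Z.of_nat n)%Z.
Proof.
induction n as [|n IH]; [simpl; lia|].
change (zrange (S n)) with (Z.of_nat (S n) :: (- Z.of_nat (S (S n)))%Z :: zrange n).
simpl In. rewrite IH. lia.
Qed.

Lemma NoDup_zrange (n : nat) : NoDup (zrange n).
Proof.
induction n as [|n IH].
- constructor; [simpl; lia|]. constructor; [simpl; tauto|constructor].
- change (zrange (S n)) with (Z.of_nat (S n) :: (- Z.of_nat (S (S n)))%Z :: zrange n).
  constructor.
  + intros [h|h]; [lia|]. apply in_zrange in h. lia.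
  + constructor; [|exact IH]. intros h. apply in_zrange in h. lia.
Qed.

Lemma sum_n_fold_Z (g : Z -> R) (n : nat) : sum_n (fold_Z g) n = lsum g (zrange n) :> R.
Proof.
induction n as [|n IH].
- rewrite sum_O. unfold fold_Z, lsum. simpl.
  match goal with |- ?a = ?b => change (@eq R a b) end. ring.
- rewrite sum_Sn, IH. transitivity (lsum g (zrange n) + fold_Z g (S n)); [reflexivity|].
  transitivity (g (Z.of_nat (S n)) + (g (- Z.of_nat (S (S n)))%Z + lsum g (zrange n)));
    [unfold fold_Z; ring|reflexivity].
Qed.

Lemma fold_Z_ge0 (g : Z -> R) (n : nat) : (forall k, 0 <= g k) -> 0 <= fold_Z g n.
Proof. intros h. unfold fold_Z. generalize (h (Z.of_nat n)) (h (- Z.of_nat (S n))%Z). lra. Qed.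

Lemma zrange_covers (L : list Z) : exists n, incl L (zrange n).
Proof.
induction L as [|k L [n IH]]; [exists 0%nat; intros x []|].
exists (max n (Z.abs_nat k)). intros x [<-|hx]; apply in_zrange; [lia|].
specialize (IH x hx). apply in_zrange in IH. lia.
Qed.

Lemma lsum_le_zsum (g : Z -> R) (L : list Z) : (forall k, 0 <= g k) ->
  ex_series (fold_Z g) -> NoDup L -> lsum g L <= zsum g.
Proof.
intros hg hs hL. destruct (zrange_covers L) as [n hn].
eapply Rle_trans; [apply (lsum_incl g L (zrange n)); auto|].
rewrite <- sum_n_fold_Z.
apply (is_lim_seq_incr_compare (sum_n (fold_Z g)) (zsum g)).
- exact (Series_correct _ hs).
- intros k. rewrite sum_Sn. change (@plus R_AbelianMonoid) with Rplus.
  generalize (fold_Z_ge0 g (S k) hg). lra.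
Qed.

Lemma zsum_bounded (g : Z -> R) (B : R) : (forall k, 0 <= g k) ->
  (forall L, NoDup L -> lsum g L <= B) -> ex_series (fold_Z g) /\ zsum g <= B.
Proof.
intros hg hB.
assert (hs : ex_series (fold_Z g)).
{ destruct (ex_finite_lim_seq_incr (sum_n (fold_Z g)) B) as [l hl].
  - intros n. rewrite sum_Sn. change (@plus R_AbelianMonoid) with Rplus. generalize (fold_Z_ge0 g (S n) hg). lra.
  - intros n. rewrite sum_n_fold_Z. apply hB, NoDup_zrange.
  - exists l. exact hl. }
split; [exact hs|].
apply (is_lim_seq_le (sum_n (fold_Z g)) (fun _ => B) (zsum g) B).
- intros n. rewrite sum_n_fold_Z. apply hB, NoDup_zrange.
- exact (Series_correct _ hs).
- apply is_lim_seq_const.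
Qed.

Lemma coord_plus (u v : l2) (k : Z) : coord (plus u v) k = (coord u k + coord v k)%C.
Proof. reflexivity. Qed.

Lemma coord_scal (c : C) (u : l2) (k : Z) : coord (scal c u) k = (c * coord u k)%C.
Proof. reflexivity. Qed.

Lemma coord_opp (u : l2) (k : Z) : coord (opp u) k = (- coord u k)%C.
Proof.
transitivity (RtoC (-1) * coord u k)%C; [reflexivity|].
apply injective_projections; simpl; ring.
Qed.

Lemma coord_minus (u v : l2) (k : Z) : coord (minus u v) k = (coord u k - coord v k)%C.
Proof.
transitivity (coord u k + coord (opp v) k)%C; [reflexivity|].
rewrite coord_opp. reflexivity.
Qed.

Lemma coord_zero (k : Z) : coord zero k = 0%C.
Proof. reflexivity. Qed.

Lemma coord_basis (l k : Z) : coord (l2_basis l) k = if Z.eqb k l then RtoC 1 else RtoC 0.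
Proof. reflexivity. Qed.

Lemma l2_norm_sq_lsum (u : l2) (L : list Z) : NoDup L ->
  lsum (fun k => Cmod (coord u k) ^ 2) L <= l2_norm u ^ 2.
Proof.
intros hL. rewrite l2_norm_sq.
apply lsum_le_zsum; [intros; apply pow2_ge_0|apply coord_sq|exact hL].
Qed.

Lemma coord_le (u : l2) (k : Z) : Cmod (coord u k) <= l2_norm u.
Proof.
apply le_of_sq; [apply l2_norm_ge0|].
generalize (l2_norm_sq_lsum u (k :: nil)). unfold lsum; simpl fold_right.
intros h. rewrite Rplus_0_r in h. apply h. constructor; [intros []|constructor].
Qed.

Lemma l2_norm_le (u : l2) (B : R) : 0 <= B ->
  (forall L, NoDup L -> lsum (fun k => Cmod (coord u k) ^ 2) L <= B ^ 2) -> l2_norm u <= B.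
Proof.
intros hB h. apply le_of_sq; [exact hB|]. rewrite l2_norm_sq.
apply zsum_bounded; [intros; apply pow2_ge_0|exact h].
Qed.

Lemma l2_norm_coord_le (u v : l2) (c : R) : 0 <= c ->
  (forall k, Cmod (coord u k) <= c * Cmod (coord v k)) -> l2_norm u <= c * l2_norm v.
Proof.
intros hc h. apply l2_norm_le; [apply Rmult_le_pos; [exact hc|apply l2_norm_ge0]|].
intros L hL. eapply Rle_trans.
- apply (lsum_le _ (fun k => c ^ 2 * Cmod (coord v k) ^ 2)). intros k _.
  rewrite <- Rpow_mult_distr. apply pow_incr. split; [apply Cmod_ge_0|apply h].
- rewrite lsum_scal, Rpow_mult_distr. apply Rmult_le_compat_l; [apply pow2_ge_0|].
  now apply l2_norm_sq_lsum.
Qed.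

Lemma l2_basis_norm (l : Z) : l2_norm (l2_basis l) <= 1.
Proof.
apply l2_norm_le; [lra|]. intros L hL. induction hL as [|k L hk hL IH].
- unfold lsum; simpl; lra.
- rewrite lsum_cons, coord_basis.
  destruct (Z.eqb_spec k l) as [->|hkl]; [|rewrite Cmod_0; lra].
  rewrite Cmod_1. replace (lsum _ L) with 0; [lra|]. symmetry.
  clear IH hL. induction L as [|j L IHL]; [reflexivity|]. rewrite lsum_cons.
  rewrite IHL by (intros h; apply hk; now right). rewrite coord_basis.
  destruct (Z.eqb_spec j l) as [->|hj]; [exfalso; apply hk; now left|rewrite Cmod_0; ring].
Qed.

(** * Weighted composition operators on l2 *)

Section WeightedComposition.

Context (w : Z -> C) (phi : Z -> Z) (B : R) (hB : 0 <= B) (hw : forall k, Cmod (w k) <= B)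
  (hphi : forall j k, w j <> 0%C -> w k <> 0%C -> phi j = phi k -> j = k).

(** The images under [phi] of the indices with nonzero weight form a duplicate-free list, because
    [phi] is injective there. *)
Lemma wcomp_lsum (u : l2) (L : list Z) : NoDup L ->
  lsum (fun k => Cmod (w k * coord u (phi k)) ^ 2) L <= (B * l2_norm u) ^ 2.
Proof.
intros hL.
assert (H : exists L', NoDup L' /\ (forall x, In x L' -> exists k, In k L /\ w k <> 0%C /\ x = phi k) /\
  lsum (fun k => Cmod (w k * coord u (phi k)) ^ 2) L <= B ^ 2 * lsum (fun k => Cmod (coord u k) ^ 2) L').
{ induction hL as [|k L hk hL (L' & h1 & h2 & h3)].
  - exists nil. repeat split; [constructor|intros x []|unfold lsum; simpl; lra].
  - destruct (excluded_middle_informative (w k = 0%C)) as [e|e].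
    + exists L'. repeat split; [exact h1| |].
      * intros x hx. destruct (h2 x hx) as (j & j1 & j2). exists j. split; [now right|exact j2].
      * rewrite lsum_cons, e, Cmult_0_l, Cmod_0. lra.
    + exists (phi k :: L'). repeat split.
      * constructor; [|exact h1]. intros hin. destruct (h2 _ hin) as (j & j1 & j2 & j3).
        apply hk. now rewrite (hphi k j e j2 j3).
      * intros x [<-|hx]; [exists k; repeat split; auto; now left|].
        destruct (h2 x hx) as (j & j1 & j2). exists j. split; [now right|exact j2].
      * rewrite !lsum_cons, Cmod_mult, Rpow_mult_distr.
        assert (Cmod (w k) ^ 2 <= B ^ 2) by (apply pow_incr; split; [apply Cmod_ge_0|apply hw]).
        generalize (pow2_ge_0 (Cmod (coord u (phi k)))). nra. }
destruct H as (L' & h1 & _ & h3). eapply Rle_trans; [exact h3|].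
rewrite Rpow_mult_distr. apply Rmult_le_compat_l; [apply pow2_ge_0|]. now apply l2_norm_sq_lsum.
Qed.

Definition wcomp_vec (u : l2) : l2 :=
  L2 (fun k => w k * coord u (phi k))%C
    (proj1 (zsum_bounded _ _ (fun _ => pow2_ge_0 _) (wcomp_lsum u))).

Lemma wcomp_vec_norm (u : l2) : l2_norm (wcomp_vec u) <= B * l2_norm u.
Proof.
apply l2_norm_le; [apply Rmult_le_pos; [exact hB|apply l2_norm_ge0]|].
exact (wcomp_lsum u).
Qed.

Lemma wcomp_linear : @is_linear C_AbsRing l2_NormedModule l2_NormedModule wcomp_vec.
Proof.
constructor.
- intros u v. apply l2_ext. intros k. simpl. ring.
- intros c u. apply l2_ext. intros k. simpl. ring.
- exists (B + 1). split; [lra|]. intros u.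
  apply Rle_trans with (B * l2_norm u); [exact (wcomp_vec_norm u)|].
  generalize (l2_norm_ge0 u). intros h. apply Rmult_le_compat_r; [exact h|lra].
Qed.

(** Block swaps, the shift, its adjoint and diagonal operators are all of this form, which settles
    their boundedness and norms once. *)
Definition wcomp : BH := BoundedOp l2_NormedModule wcomp_vec wcomp_linear.

Lemma wcomp_coord (u : l2) (k : Z) : coord (wcomp u) k = (w k * coord u (phi k))%C.
Proof. reflexivity. Qed.

Lemma wcomp_norm : op_norm l2_NormedModule wcomp <= B.
Proof. apply op_norm_le. split; [exact hB|]. intros u. exact (wcomp_vec_norm u). Qed.

End WeightedComposition.

Definition ltrunc (L : list Z) (u : l2) : l2 :=
  fold_right (fun k s => plus (scal (coord u k) (l2_basis k)) s) zero L.

Lemma ltrunc_coord (L : list Z) (u : l2) (k : Z) : NoDup L ->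
  (In k L -> coord (ltrunc L u) k = coord u k) /\ (~ In k L -> coord (ltrunc L u) k = 0%C).
Proof.
induction 1 as [|j L hj hL [IH1 IH2]]; [split; [intros []|reflexivity]|].
change (ltrunc (j :: L) u) with (plus (scal (coord u j) (l2_basis j)) (ltrunc L u)).
rewrite coord_plus, coord_scal, coord_basis.
destruct (Z.eqb_spec k j) as [->|hkj]; split.
- intros _. rewrite IH2 by exact hj. ring.
- intros h. exfalso. apply h. now left.
- intros [h|h]; [congruence|]. rewrite IH1 by exact h. ring.
- intros h. rewrite IH2 by (intros h'; apply h; now right). ring.
Qed.

Lemma filter_split_lsum (g : Z -> R) (L M : list Z) : (forall k, 0 <= g k) -> NoDup L -> NoDup M ->
  lsum (fun k => if in_dec Z.eq_dec k M then 0 else g k) L + lsum g M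
  <= lsum g (filter (fun k => if in_dec Z.eq_dec k M then false else true) L ++ M).
Proof.
intros hg hL hM. rewrite lsum_app. apply Rplus_le_compat_r.
induction L as [|k L IH]; [unfold lsum; simpl; lra|].
inversion hL; subst. simpl filter. unfold lsum in *. simpl fold_right.
destruct (in_dec Z.eq_dec k M); simpl fold_right; specialize (IH ltac:(assumption)); lra.
Qed.

(** Pythagoras: the coordinates inside and outside [zrange n] share the square norm of [u]. *)
Lemma ltrunc_zrange_norm (u : l2) (n : nat) :
  l2_norm (minus u (ltrunc (zrange n) u)) ^ 2 <=
  l2_norm u ^ 2 - sum_n (fold_Z (fun k => Cmod (coord u k) ^ 2)) n.
Proof.
set (g := fun k => Cmod (coord u k) ^ 2).
assert (hg : forall k, 0 <= g k) by (intros; apply pow2_ge_0).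
rewrite sum_n_fold_Z, l2_norm_sq.
apply zsum_bounded; [intros; apply pow2_ge_0|]. intros L hL.
rewrite (lsum_ext _ (fun k => if in_dec Z.eq_dec k (zrange n) then 0 else g k)).
- assert (h1 := filter_split_lsum g L (zrange n) hg hL (NoDup_zrange n)).
  assert (h2 : lsum g (filter (fun k => if in_dec Z.eq_dec k (zrange n) then false else true) L ++ zrange n)
     <= l2_norm u ^ 2).
  { apply l2_norm_sq_lsum. apply NoDup_app.
    - now apply NoDup_filter.
    - apply NoDup_zrange.
    - intros k hk. apply filter_In in hk. destruct hk as [_ hk].
      destruct (in_dec Z.eq_dec k (zrange n)); [discriminate|assumption]. }
  lra.
- intros k _. destruct (ltrunc_coord (zrange n) u k (NoDup_zrange n)) as [h1 h2].
  rewrite coord_minus.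
  destruct (in_dec Z.eq_dec k (zrange n)) as [h|h].
  + rewrite h1 by exact h. rewrite Cmod_minus_self. ring.
  + rewrite h2 by exact h. unfold g. f_equal. f_equal. ring.
Qed.

Lemma ltrunc_approx (u : l2) (eps : R) : 0 < eps ->
  exists L, l2_norm (minus u (ltrunc L u)) <= eps.
Proof.
intros heps.
assert (hs : is_lim_seq (sum_n (fold_Z (fun k => Cmod (coord u k) ^ 2)))
  (zsum (fun k => Cmod (coord u k) ^ 2))) by exact (Series_correct _ (coord_sq u)).
apply is_lim_seq_spec in hs.
destruct (hs (mkposreal (eps ^ 2) (pow_lt _ _ heps))) as [N hN].
exists (zrange N). apply le_of_sq; [lra|].
eapply Rle_trans; [apply ltrunc_zrange_norm|].
specialize (hN N (le_n N)). rewrite l2_norm_sq. apply Rabs_lt_between in hN.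
change (pos (mkposreal (eps ^ 2) (pow_lt _ _ heps))) with (eps ^ 2) in hN. lra.
Qed.

Lemma functional_basis (Phi : l2 -> C) (M : R) :
  (forall u v, Phi (plus u v) = Phi u + Phi v)%C -> (forall c u, Phi (scal c u) = c * Phi u)%C ->
  (forall u, Cmod (Phi u) <= M * l2_norm u) -> (forall l, Phi (l2_basis l) = 0%C) ->
  forall u, Phi u = 0%C.
Proof.
intros hp hs hM hb u. apply Cmod_eq_0, Rle_antisym; [|apply Cmod_ge_0].
apply le_epsilon. intros eps heps. rewrite Rplus_0_l.
assert (hM' : 0 < Rabs M + 1) by (generalize (Rabs_pos M); lra).
destruct (ltrunc_approx u (eps / (Rabs M + 1))) as [L hL]; [now apply Rdiv_lt_0_compat|].
assert (hz : Phi zero = 0%C).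
{ transitivity (Phi (scal (RtoC 0) zero)); [f_equal|rewrite hs; ring].
  symmetry. exact (@scal_zero_r C_Ring l2_ModuleSpace (RtoC 0)). }
assert (h0 : Phi (ltrunc L u) = 0%C).
{ clear hL. induction L as [|k L IH]; [exact hz|].
  change (ltrunc (k :: L) u) with (plus (scal (coord u k) (l2_basis k)) (ltrunc L u)).
  rewrite hp, hs, hb, IH. ring. }
assert (e : u = plus (minus u (ltrunc L u)) (ltrunc L u)).
{ apply l2_ext. intros k. rewrite coord_plus, coord_minus. ring. }
rewrite e, hp, h0, Cplus_0_r. eapply Rle_trans; [apply hM|].
apply Rle_div_r in hL; [|exact hM'].
eapply Rle_trans; [|exact hL]. rewrite Rmult_comm. apply Rmult_le_compat_l; [apply l2_norm_ge0|].
generalize (Rle_abs M). lra.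
Qed.

Lemma op_plus_apply (T : BH) (u v : l2) : T (plus u v) = plus (T u) (T v).
Proof. apply (linear_plus T (op_linear _ T)). Qed.

Lemma op_scal_apply (T : BH) (c : C) (u : l2) : T (scal c u) = scal c (T u).
Proof. apply (linear_scal T (op_linear _ T)). Qed.

Lemma op_zero_apply (T : BH) : T zero = zero.
Proof. exact (linear_zero T (op_linear _ T)). Qed.

Lemma op_norm_apply (T : BH) (u : l2) : l2_norm (T u) <= op_norm _ T * l2_norm u.
Proof. exact (op_norm_spec l2_NormedModule T u). Qed.

Lemma coord_op_le (T : BH) (u : l2) (k : Z) :
  Cmod (coord (T u) k) <= op_norm _ T * l2_norm u.
Proof. eapply Rle_trans; [apply coord_le|apply op_norm_apply]. Qed.

Lemma coord_op_basis_le (T : BH) (l k : Z) : Cmod (coord (T (l2_basis l)) k) <= op_norm _ T.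
Proof.
eapply Rle_trans; [apply coord_op_le|].
rewrite <- (Rmult_1_r (op_norm _ T)) at 2.
apply Rmult_le_compat_l; [apply op_norm_ge0|apply l2_basis_norm].
Qed.

(** Working with one coordinate at a time allows [Phi] to be a formula valid at [k] alone; no second
    operator has to be built for the comparison. *)
Lemma op_coord_ext (T : BH) (k : Z) (Phi : l2 -> C) (M : R) :
  (forall u v, Phi (plus u v) = Phi u + Phi v)%C -> (forall c u, Phi (scal c u) = c * Phi u)%C ->
  (forall u, Cmod (Phi u) <= M * l2_norm u) ->
  (forall l, coord (T (l2_basis l)) k = Phi (l2_basis l)) ->
  forall u, coord (T u) k = Phi u.
Proof.
intros hp hs hM hb u. apply Cminus_eq_0.
apply (functional_basis (fun u => coord (T u) k - Phi u)%C (op_norm _ T + M)).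
- intros x y. rewrite op_plus_apply, coord_plus, hp. ring.
- intros c x. rewrite op_scal_apply, coord_scal, hs. ring.
- intros x. eapply Rle_trans; [apply Cmod_minus_le|]. rewrite Rmult_plus_distr_r.
  apply Rplus_le_compat; [apply coord_op_le|apply hM].
- intros l. rewrite hb. ring.
Qed.

Lemma op_basis_ext (S T : BH) :
  (forall l k, coord (S (l2_basis l)) k = coord (T (l2_basis l)) k) -> S = T.
Proof.
intros h. apply op_ext. intros u. apply l2_ext. intros k.
apply (op_coord_ext S k (fun u => coord (T u) k) (op_norm _ T)); auto.
- intros x y. now rewrite op_plus_apply, coord_plus.
- intros c x. now rewrite op_scal_apply, coord_scal.
- intros x. apply coord_op_le.
Qed.

(** * Completeness and adjoints *)

Notation opnorm := (op_norm l2_NormedModule).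

Lemma l2_norm_minus_sym (u v : l2) : l2_norm (minus u v) = l2_norm (minus v u).
Proof.
unfold l2_norm. f_equal. apply Series_ext. intros n. unfold fold_Z.
rewrite !coord_minus. rewrite (Cmod_minus_sym (coord u _)), (Cmod_minus_sym (coord u (- _)%Z)).
reflexivity.
Qed.

Lemma l2_norm_minus_triangle (u v w : l2) :
  l2_norm (minus u w) <= l2_norm (minus u v) + l2_norm (minus v w).
Proof.
replace (minus u w) with (plus (minus u v) (minus v w)).
- apply l2_norm_triangle.
- apply l2_ext. intros k. rewrite coord_plus, !coord_minus. ring.
Qed.

Lemma l2_norm_le_minus (u v : l2) : l2_norm u <= l2_norm (minus u v) + l2_norm v.
Proof.
replace u with (plus (minus u v) v) at 1; [apply l2_norm_triangle|].
apply l2_ext. intros k. rewrite coord_plus, coord_minus. ring.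
Qed.

Definition l2_lim (x : nat -> l2) (y : l2) : Prop :=
  forall eps, 0 < eps -> exists N, forall n, (N <= n)%nat -> l2_norm (minus (x n) y) <= eps.

Lemma is_lim_seq_Cmod_minus (a c : C) (z : nat -> C) :
  (forall eps, 0 < eps -> exists N, forall n, (N <= n)%nat -> Cmod (z n - c) <= eps) ->
  is_lim_seq (fun n => Cmod (a - z n)) (Cmod (a - c)).
Proof.
intros h. apply is_lim_seq_spec. intros eps.
destruct (h (eps / 2)) as [N hN]; [generalize (cond_pos eps); lra|].
exists N. intros n hn. specialize (hN n hn).
generalize (Cmod_minus_triangle a c (z n)) (Cmod_minus_triangle a (z n) c).
rewrite (Cmod_minus_sym c (z n)). intros h1 h2.
apply Rabs_lt_between. generalize (cond_pos eps). lra.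
Qed.

Lemma l2_complete (x : nat -> l2) :
  (forall eps, 0 < eps -> exists N, forall n m, (N <= n)%nat -> (N <= m)%nat ->
     l2_norm (minus (x n) (x m)) <= eps) ->
  exists y, l2_lim x y.
Proof.
intros H.
assert (hc : forall k, exists c, forall eps, 0 < eps -> exists N, forall n, (N <= n)%nat ->
   Cmod (coord (x n) k - c) <= eps).
{ intros k. apply (C_complete (fun n => coord (x n) k)). intros eps heps.
  destruct (H eps heps) as [N hN]. exists N. intros n m hn hm.
  rewrite <- coord_minus. eapply Rle_trans; [apply coord_le|auto]. }
set (c := fun k => proj1_sig (constructive_indefinite_description _ (hc k))).
assert (hck : forall k eps, 0 < eps -> exists N, forall n, (N <= n)%nat ->
   Cmod (coord (x n) k - c k) <= eps).
{ intros k. exact (proj2_sig (constructive_indefinite_description _ (hc k))). }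
(* On a finite list of coordinates the Cauchy bound passes to the coordinatewise limit; the result
   is uniform in the list. *)
assert (B : forall eps N, 0 < eps -> (forall n m, (N <= n)%nat -> (N <= m)%nat ->
     l2_norm (minus (x n) (x m)) <= eps) -> forall n, (N <= n)%nat -> forall L, NoDup L ->
     lsum (fun k => Cmod (coord (x n) k - c k) ^ 2) L <= eps ^ 2).
{ intros eps N heps hN n hn L hL.
  apply (is_lim_seq_le_loc (fun m => lsum (fun k => Cmod (coord (x n) k - coord (x m) k) ^ 2) L)
    (fun _ => eps ^ 2) (lsum (fun k => Cmod (coord (x n) k - c k) ^ 2) L) (eps ^ 2)).
  - exists N. intros m hm. eapply Rle_trans; [|apply pow_incr; split; [apply l2_norm_ge0|apply (hN n m hn hm)]].
    rewrite (lsum_ext _ (fun k => Cmod (coord (minus (x n) (x m)) k) ^ 2))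
      by (intros k _; now rewrite coord_minus).
    now apply l2_norm_sq_lsum.
  - clear hL. induction L as [|k L IH]; [apply is_lim_seq_const|].
    apply (is_lim_seq_ext (fun m => Cmod (coord (x n) k - coord (x m) k) ^ 2
       + lsum (fun k => Cmod (coord (x n) k - coord (x m) k) ^ 2) L)); [reflexivity|].
    rewrite lsum_cons. apply is_lim_seq_plus'; [|exact IH].
    assert (h := is_lim_seq_Cmod_minus (coord (x n) k) (c k) (fun m => coord (x m) k) (hck k)).
    apply (is_lim_seq_ext (fun m => Cmod (coord (x n) k - coord (x m) k)
       * Cmod (coord (x n) k - coord (x m) k))); [intros m; simpl; ring|].
    replace (Cmod (coord (x n) k - c k) ^ 2)
      with (Cmod (coord (x n) k - c k) * Cmod (coord (x n) k - c k)) by (simpl; ring).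
    now apply is_lim_seq_mult'.
  - apply is_lim_seq_const. }
destruct (H 1 ltac:(lra)) as [N1 hN1].
(* The bound just obtained shows that [x N1 - c] is square summable. The limit is therefore built as
   [x N1 - d]. *)
set (d := L2 (fun k => coord (x N1) k - c k)%C
   (proj1 (zsum_bounded _ _ (fun _ => pow2_ge_0 _) (B 1 N1 Rlt_0_1 hN1 N1 (le_n N1))))).
assert (hy : forall k, coord (minus (x N1) d) k = c k).
{ intros k. rewrite coord_minus. unfold d. cbn [coord]. ring. }
exists (minus (x N1) d). intros eps heps. destruct (H eps heps) as [N hN].
exists N. intros n hn. apply l2_norm_le; [lra|]. intros L hL.
rewrite (lsum_ext _ (fun k => Cmod (coord (x n) k - c k) ^ 2))
  by (intros k _; now rewrite coord_minus, hy).
now apply (B eps N).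
Qed.

Lemma l2_lim_unique (x : nat -> l2) (y z : l2) : l2_lim x y -> l2_lim x z -> y = z.
Proof.
intros hy hz. apply l2_ext. intros k. apply Cminus_eq_0, Cmod_eq_0, Rle_antisym; [|apply Cmod_ge_0].
apply le_epsilon. intros eps heps. rewrite Rplus_0_l.
destruct (hy (eps / 2) ltac:(lra)) as [N1 h1]. destruct (hz (eps / 2) ltac:(lra)) as [N2 h2].
specialize (h1 (max N1 N2) ltac:(lia)). specialize (h2 (max N1 N2) ltac:(lia)).
rewrite <- coord_minus. eapply Rle_trans; [apply coord_le|].
eapply Rle_trans; [apply (l2_norm_minus_triangle _ (x (max N1 N2)))|].
rewrite (l2_norm_minus_sym y). lra.
Qed.

Lemma l2_lim_plus (x x' : nat -> l2) (y y' : l2) :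
  l2_lim x y -> l2_lim x' y' -> l2_lim (fun n => plus (x n) (x' n)) (plus y y').
Proof.
intros hy hz eps heps.
destruct (hy (eps / 2) ltac:(lra)) as [N1 h1]. destruct (hz (eps / 2) ltac:(lra)) as [N2 h2].
exists (max N1 N2). intros n hn. specialize (h1 n ltac:(lia)). specialize (h2 n ltac:(lia)).
replace (minus (plus (x n) (x' n)) (plus y y')) with (plus (minus (x n) y) (minus (x' n) y')).
- generalize (l2_norm_triangle (minus (x n) y) (minus (x' n) y')).
  change (l2_plus (minus (x n) y) (minus (x' n) y')) with (plus (minus (x n) y) (minus (x' n) y')). lra.
- apply l2_ext. intros k. rewrite !coord_plus, !coord_minus, !coord_plus. ring.
Qed.

Lemma l2_lim_scal (c : C) (x : nat -> l2) (y : l2) :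
  l2_lim x y -> l2_lim (fun n => scal c (x n)) (scal c y).
Proof.
intros hy eps heps. assert (hc := Cmod_ge_0 c).
destruct (hy (eps / (1 + Cmod c)) ltac:(apply Rdiv_lt_0_compat; lra)) as [N h1].
exists N. intros n hn. specialize (h1 n hn).
assert (e : minus (scal c (x n) : l2) (scal c y) = l2_scal c (minus (x n) y)).
{ apply l2_ext. intros k. rewrite coord_minus, !coord_scal.
  transitivity (c * coord (minus (x n) y) k)%C; [|reflexivity]. rewrite coord_minus. ring. }
eapply Rle_trans; [right; exact (f_equal l2_norm e)|].
eapply Rle_trans; [apply l2_norm_scal|].
apply Rle_div_r in h1; [|lra]. generalize (l2_norm_ge0 (minus (x n) y)). nra.
Qed.

Lemma l2_lim_norm_le (x : nat -> l2) (y z : l2) (B : R) (N : nat) :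
  l2_lim x y -> (forall n, (N <= n)%nat -> l2_norm (minus z (x n)) <= B) -> l2_norm (minus z y) <= B.
Proof.
intros hy h. apply le_epsilon. intros eps heps.
destruct (hy eps heps) as [N' h']. specialize (h (max N N') ltac:(lia)).
specialize (h' (max N N') ltac:(lia)).
generalize (l2_norm_minus_triangle z (x (max N N')) y). lra.
Qed.

Lemma op_minus_apply (S T : BH) (u : l2) : (minus S T : BH) u = minus (S u) (T u).
Proof. reflexivity. Qed.

Lemma op_minus_arg (T : BH) (u v : l2) : T (minus u v) = minus (T u : l2) (T v).
Proof.
unfold minus. rewrite op_plus_apply. f_equal. exact (linear_opp T _ (op_linear _ T)).
Qed.

Lemma op_complete (S : nat -> BH) :
  (forall eps, 0 < eps -> exists N, forall n m, (N <= n)%nat -> (N <= m)%nat ->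
     opnorm (minus (S n) (S m)) <= eps) ->
  exists T : BH, forall eps, 0 < eps -> exists N, forall n, (N <= n)%nat ->
     opnorm (minus (S n) T) <= eps.
Proof.
intros H.
assert (HS : forall eps N, (forall n m, (N <= n)%nat -> (N <= m)%nat ->
     opnorm (minus (S n) (S m)) <= eps) -> forall u n m, (N <= n)%nat -> (N <= m)%nat ->
     l2_norm (minus (S n u) (S m u)) <= eps * l2_norm u).
{ intros eps N h u n m hn hm. rewrite <- op_minus_apply.
  eapply Rle_trans; [apply op_norm_apply|]. apply Rmult_le_compat_r; [apply l2_norm_ge0|auto]. }
assert (hl : forall u, exists y, l2_lim (fun n => S n u) y).
{ intros u. apply l2_complete. intros eps heps. assert (h0 := l2_norm_ge0 u).
  destruct (H (eps / (1 + l2_norm u))) as [N hN]; [apply Rdiv_lt_0_compat; lra|].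
  exists N. intros n m hn hm. eapply Rle_trans; [apply (HS _ N hN); auto|].
  replace (eps / (1 + l2_norm u) * l2_norm u) with (eps * l2_norm u / (1 + l2_norm u)) by (field; lra).
  apply Rle_div_l; [lra|]. nra. }
set (t := fun u => proj1_sig (constructive_indefinite_description _ (hl u))).
assert (ht : forall u, l2_lim (fun n => S n u) (t u)).
{ intros u. exact (proj2_sig (constructive_indefinite_description _ (hl u))). }
assert (HT : forall eps N, (forall n m, (N <= n)%nat -> (N <= m)%nat ->
     opnorm (minus (S n) (S m)) <= eps) -> forall u n, (N <= n)%nat ->
     l2_norm (minus (S n u) (t u)) <= eps * l2_norm u).
{ intros eps N h u n hn. apply (l2_lim_norm_le (fun n => S n u) _ _ _ N (ht u)).
  intros m hm. now apply (HS _ N). }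
assert (hlin : @is_linear C_AbsRing l2_NormedModule l2_NormedModule t).
{ constructor.
  - intros u v. apply (l2_lim_unique (fun n => S n (plus u v))); [apply ht|].
    generalize (l2_lim_plus _ _ _ _ (ht u) (ht v)).
    intros h eps heps. destruct (h eps heps) as [N hN]. exists N. intros n hn.
    rewrite op_plus_apply. now apply hN.
  - intros c u. apply (l2_lim_unique (fun n => S n (scal c u))); [apply ht|].
    generalize (l2_lim_scal c _ _ (ht u)).
    intros h eps heps. destruct (h eps heps) as [N hN]. exists N. intros n hn.
    rewrite op_scal_apply. now apply hN.
  - destruct (H 1 ltac:(lra)) as [N hN]. exists (opnorm (S N) + 1 + 1).
    assert (h0 := op_norm_ge0 l2_NormedModule (S N)). split; [lra|]. intros u.
    change (l2_norm (t u) <= (opnorm (S N) + 1 + 1) * l2_norm u).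
    assert (h1 := HT 1 N hN u N (le_n N)). rewrite l2_norm_minus_sym in h1.
    generalize (l2_norm_le_minus (t u) (S N u)) (op_norm_apply (S N) u) (l2_norm_ge0 u). lra. }
exists (BoundedOp l2_NormedModule t hlin). intros eps heps. destruct (H eps heps) as [N hN].
exists N. intros n hn. apply op_norm_le. split; [lra|]. intros u.
exact (HT eps N hN u n hn).
Qed.

Lemma is_series_op (T : nat -> BH) (S : BH) :
  is_series T S <-> forall eps, 0 < eps -> exists N, forall n, (N <= n)%nat ->
    opnorm (minus (sum_n T n) S) < eps.
Proof.
split.
- intros h eps heps.
  destruct (h (fun y : BH => opnorm (minus y S) < eps)) as [N hN].
  + exists (mkposreal eps heps). intros y hy. exact hy.
  + exists N. exact hN.
- intros h P [eps hP]. destruct (h eps (cond_pos eps)) as [N hN].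
  exists N. intros n hn. apply hP. exact (hN n hn).
Qed.

Lemma opnorm_zero : opnorm (zero : BH) = 0.
Proof.
apply Rle_antisym; [|apply op_norm_ge0]. apply op_norm_le. split; [lra|]. intros u.
rewrite Rmult_0_l. right. exact (@norm_zero C_AbsRing l2_NormedModule).
Qed.

Lemma opnorm_minus_self (T : BH) : opnorm (minus T T) = 0.
Proof. rewrite minus_eq_zero. exact opnorm_zero. Qed.

Lemma opnorm_minus_triangle (S T U : BH) :
  opnorm (minus S U) <= opnorm (minus S T) + opnorm (minus T U).
Proof.
rewrite (minus_trans T S U). apply (op_norm_triangle l2_NormedModule).
Qed.

Lemma opnorm_opp (T : BH) : opnorm (opp T) = opnorm T.
Proof.
apply (N_opp (op_ModuleSpace l2_NormedModule)).
intros c x. apply (op_norm_scal l2_NormedModule).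
Qed.

Lemma opnorm_minus_sym (S T : BH) : opnorm (minus S T) = opnorm (minus T S).
Proof. rewrite <- opp_minus. apply opnorm_opp. Qed.

Lemma op_series_exists (T : nat -> BH) (c : nat -> R) :
  (forall n, opnorm (T n) <= c n) -> ex_series c -> exists S : BH, is_series T S.
Proof.
intros hT hc.
assert (h : forall k n, opnorm (minus (sum_n T (n + k)) (sum_n T n)) <= sum_n c (n + k) - sum_n c n).
{ induction k as [|k IH]; intros n.
  - rewrite Nat.add_0_r, opnorm_minus_self. lra.
  - replace (n + S k)%nat with (S (n + k))%nat by lia. rewrite !sum_Sn.
    change (plus (sum_n c (n + k)) (c (S (n + k)))) with (sum_n c (n + k) + c (S (n + k))).
    replace (minus (plus (sum_n T (n + k)) (T (S (n + k)))) (sum_n T n))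
      with (plus (minus (sum_n T (n + k)) (sum_n T n)) (T (S (n + k)))).
    + eapply Rle_trans; [apply (op_norm_triangle l2_NormedModule)|].
      specialize (IH n). specialize (hT (S (n + k))).
      change (sum_n c (n + k) : R) with (sum_n c (n + k)) in *. lra.
    + unfold minus. rewrite <- !plus_assoc. f_equal. apply plus_comm. }
assert (hcau : forall eps, 0 < eps -> exists N, forall n, (N <= n)%nat ->
   Rabs (sum_n c n - Series c) < eps).
{ intros eps heps.
  assert (hl : is_lim_seq (sum_n c) (Series c)) by exact (Series_correct _ hc).
  apply is_lim_seq_spec in hl. destruct (hl (mkposreal eps heps)) as [N hN].
  exists N. exact hN. }
destruct (op_complete (sum_n T)) as [S hS].
{ intros eps heps. destruct (hcau (eps / 4) ltac:(lra)) as [N hN]. exists N.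
  assert (h2 : forall n, (N <= n)%nat -> opnorm (minus (sum_n T n) (sum_n T N)) <= eps / 2).
  { intros n hn. replace n with (N + (n - N))%nat by lia.
    eapply Rle_trans; [apply h|]. replace (N + (n - N))%nat with n by lia.
    generalize (hN n hn) (hN N (le_n N)). intros a b.
    apply Rabs_lt_between in a. apply Rabs_lt_between in b. lra. }
  intros n m hn hm. eapply Rle_trans; [apply (opnorm_minus_triangle _ (sum_n T N))|].
  rewrite (opnorm_minus_sym (sum_n T N)). generalize (h2 n hn) (h2 m hm). lra. }
exists S. apply is_series_op. intros eps heps. destruct (hS (eps / 2) ltac:(lra)) as [N hN].
exists N. intros n hn. specialize (hN n hn). lra.
Qed.

(** Cauchy-Schwarz, from [x y <= t/2 x^2 + 1/(2t) y^2] summed over the coordinates, for real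
    families dominated by products so that real and imaginary parts are covered alike. *)
Lemma inner_ex (u v : l2) (g : Z -> R) :
  (forall k, Rabs (g k) <= Cmod (coord u k) * Cmod (coord v k)) ->
  ex_series (fold_Z g) /\ Rabs (zsum g) <= l2_norm u * l2_norm v.
Proof.
intros hg.
assert (H : forall t, 0 < t -> ex_series (fold_Z g) /\
   Rabs (zsum g) <= t / 2 * l2_norm u ^ 2 + / t / 2 * l2_norm v ^ 2).
{ intros t ht.
  set (b := fun k => t / 2 * Cmod (coord u k) ^ 2 + / t / 2 * Cmod (coord v k) ^ 2).
  assert (hi : 0 < / t) by now apply Rinv_0_lt_compat.
  assert (hb : forall k, Rabs (g k) <= b k).
  { intros k. eapply Rle_trans; [apply hg|]. unfold b.
    set (x := Cmod (coord u k)). set (y := Cmod (coord v k)).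
    assert (0 <= / t * (t * x - y) ^ 2) by (apply Rmult_le_pos; [lra|apply pow2_ge_0]).
    replace (/ t * (t * x - y) ^ 2) with (t * x ^ 2 - 2 * (x * y) + / t * y ^ 2) in H by (field; lra).
    lra. }
  assert (sb : ex_series (fold_Z b)) by (apply ex_fold_Z_lin; apply coord_sq).
  assert (habs : forall n, Rabs (fold_Z g n) <= fold_Z b n).
  { intros n. unfold fold_Z. eapply Rle_trans; [apply Rabs_triang|].
    generalize (hb (Z.of_nat n)) (hb (- Z.of_nat (S n))%Z). lra. }
  assert (sa : ex_series (fun n => Rabs (fold_Z g n))).
  { apply (ex_series_nonneg_le _ (fold_Z b)); [|exact sb]. intros n. split; [apply Rabs_pos|apply habs]. }
  split; [now apply ex_series_Rabs|].
  unfold zsum at 1. eapply Rle_trans; [apply Series_Rabs, sa|].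
  eapply Rle_trans; [apply (Series_le _ (fold_Z b)); [|exact sb]|].
  - intros n. split; [apply Rabs_pos|apply habs].
  - right. change (Series (fold_Z b)) with (zsum b). unfold b.
    rewrite zsum_lin by apply coord_sq. now rewrite !l2_norm_sq. }
split; [apply (H 1); lra|].
assert (hu := l2_norm_ge0 u). assert (hv := l2_norm_ge0 v).
apply le_epsilon. intros eps heps.
set (a := l2_norm u) in *. set (b := l2_norm v) in *.
set (d := Rmin 1 (eps / (a + b + 1))).
assert (hd : 0 < d) by (apply Rmin_pos; [lra|apply Rdiv_lt_0_compat; lra]).
assert (hd1 : d <= 1) by apply Rmin_l.
assert (hd2 : d * (a + b + 1) <= eps).
{ apply Rle_div_r; [lra|]. apply Rmin_r. }
(* The optimal weight is [b / a]; the shift by [d] keeps it defined and positive when a norm is 0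
   and costs at most [eps]. *)
destruct (H ((b + d) / (a + d))) as [_ h]; [apply Rdiv_lt_0_compat; lra|].
eapply Rle_trans; [exact h|].
assert (q1 : (b + d) / (a + d) / 2 * a ^ 2 <= (b + d) * a / 2).
{ replace ((b + d) / (a + d) / 2 * a ^ 2) with ((b + d) * a / 2 * (a / (a + d))) by (field; lra).
  rewrite <- (Rmult_1_r ((b + d) * a / 2)) at 2. apply Rmult_le_compat_l; [nra|].
  apply Rle_div_l; lra. }
assert (q2 : / ((b + d) / (a + d)) / 2 * b ^ 2 <= (a + d) * b / 2).
{ replace (/ ((b + d) / (a + d)) / 2 * b ^ 2) with ((a + d) * b / 2 * (b / (b + d))) by (field; lra).
  rewrite <- (Rmult_1_r ((a + d) * b / 2)) at 2. apply Rmult_le_compat_l; [nra|].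
  apply Rle_div_l; lra. }
nra.
Qed.

Lemma inner_re_le (u v : l2) (k : Z) :
  Rabs (Re (coord u k * Cconj (coord v k))) <= Cmod (coord u k) * Cmod (coord v k).
Proof. rewrite <- (Cmod_conj (coord v k)), <- Cmod_mult. apply re_le_Cmod. Qed.

Lemma inner_im_le (u v : l2) (k : Z) :
  Rabs (Im (coord u k * Cconj (coord v k))) <= Cmod (coord u k) * Cmod (coord v k).
Proof. rewrite <- (Cmod_conj (coord v k)), <- Cmod_mult. apply im_le_Cmod. Qed.

(* The sharp constant is 1, but only boundedness matters here. *)
Lemma inner_le (u v : l2) : Cmod (l2_inner u v) <= 2 * (l2_norm u * l2_norm v).
Proof.
eapply Rle_trans; [apply Cmod_le_Re_Im|].
destruct (inner_ex u v _ (inner_re_le u v)) as [_ h1].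
destruct (inner_ex u v _ (inner_im_le u v)) as [_ h2].
unfold l2_inner, Re, Im in *; cbn [fst snd] in *. lra.
Qed.

Lemma inner_plus_l (u u' v : l2) : l2_inner (plus u u') v = (l2_inner u v + l2_inner u' v)%C.
Proof.
destruct (inner_ex u v _ (inner_re_le u v)) as [r1 _].
destruct (inner_ex u v _ (inner_im_le u v)) as [i1 _].
destruct (inner_ex u' v _ (inner_re_le u' v)) as [r2 _].
destruct (inner_ex u' v _ (inner_im_le u' v)) as [i2 _].
unfold l2_inner. apply injective_projections; cbn [fst snd Cplus].
- transitivity (1 * zsum (fun l => Re (coord u l * Cconj (coord v l)))
     + 1 * zsum (fun l => Re (coord u' l * Cconj (coord v l)))); [|unfold Cplus; cbn [fst snd]; ring].
  rewrite <- zsum_lin by auto.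
  apply Series_ext. intros n. unfold fold_Z. rewrite !coord_plus. unfold Re; simpl; ring.
- transitivity (1 * zsum (fun l => Im (coord u l * Cconj (coord v l)))
     + 1 * zsum (fun l => Im (coord u' l * Cconj (coord v l)))); [|unfold Cplus; cbn [fst snd]; ring].
  rewrite <- zsum_lin by auto.
  apply Series_ext. intros n. unfold fold_Z. rewrite !coord_plus. unfold Im; simpl; ring.
Qed.

Lemma inner_scal_l (c : C) (u v : l2) : l2_inner (scal c u) v = (c * l2_inner u v)%C.
Proof.
destruct (inner_ex u v _ (inner_re_le u v)) as [r1 _].
destruct (inner_ex u v _ (inner_im_le u v)) as [i1 _].
unfold l2_inner. apply injective_projections; cbn [fst snd Cmult].
- transitivity (fst c * zsum (fun l => Re (coord u l * Cconj (coord v l)))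
     + (- snd c) * zsum (fun l => Im (coord u l * Cconj (coord v l)))); [|ring].
  rewrite <- zsum_lin by auto.
  apply Series_ext. intros n. unfold fold_Z. rewrite !coord_scal. unfold Re, Im; simpl; ring.
- transitivity (snd c * zsum (fun l => Re (coord u l * Cconj (coord v l)))
     + fst c * zsum (fun l => Im (coord u l * Cconj (coord v l)))); [|ring].
  rewrite <- zsum_lin by auto.
  apply Series_ext. intros n. unfold fold_Z. rewrite !coord_scal. unfold Re, Im; simpl; ring.
Qed.

Lemma inner_conj (u v : l2) : l2_inner u v = Cconj (l2_inner v u).
Proof.
destruct (inner_ex v u _ (inner_im_le v u)) as [i1 _].
unfold l2_inner, Cconj. apply injective_projections; cbn [fst snd].
- apply Series_ext. intros n. unfold fold_Z, Re, Cconj; simpl; ring.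
- transitivity (0 * zsum (fun l => Im (coord v l * Cconj (coord u l)))
     + (- (1)) * zsum (fun l => Im (coord v l * Cconj (coord u l)))).
  + rewrite <- zsum_lin by auto. apply Series_ext. intros n. unfold fold_Z, Im, Cconj; simpl; ring.
  + unfold Cconj. ring.
Qed.

Lemma inner_self (u : l2) : Cmod (l2_inner u u) = l2_norm u ^ 2.
Proof.
rewrite l2_norm_sq.
replace (l2_inner u u) with (RtoC (zsum (fun l => Cmod (coord u l) ^ 2))).
- rewrite Cmod_R, Rabs_pos_eq; [reflexivity|]. apply zsum_ge0; [intros; apply pow2_ge_0|apply coord_sq].
- unfold l2_inner. apply injective_projections; cbn [fst snd RtoC].
  + apply Series_ext. intros n. unfold fold_Z. rewrite !Cmod2_alt. unfold Re, Im, Cconj; simpl; ring.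
  + symmetry. transitivity (0 * zsum (fun l => Cmod (coord u l) ^ 2) + 0 * zsum (fun l => Cmod (coord u l) ^ 2)); [|ring].
    rewrite <- zsum_lin by apply coord_sq.
    apply Series_ext. intros n. unfold fold_Z, Im, Cconj; simpl; ring.
Qed.

Lemma lsum_single (g : Z -> R) (k : Z) (L : list Z) : NoDup L -> In k L ->
  (forall l, l <> k -> g l = 0) -> lsum g L = g k.
Proof.
intros hnd hin h. induction L as [|j L IH]; [destruct hin|].
rewrite lsum_cons. inversion hnd as [|j' L' hj hL]; subst. destruct hin as [->|hin].
- replace (lsum g L) with 0; [ring|]. symmetry. clear IH hnd hL.
  induction L as [|i L IHL]; [reflexivity|]. rewrite lsum_cons, h, IHL.
  + ring.
  + intros h'. apply hj. now right.
  + intros ->. apply hj. now left.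
- assert (hjk : j <> k) by (intros ->; contradiction).
  rewrite (h j hjk), IH by assumption. ring.
Qed.

Lemma zsum_single (g : Z -> R) (k : Z) : (forall l, l <> k -> g l = 0) -> zsum g = g k.
Proof.
intros h.
assert (H : forall N, (Z.abs_nat k <= N)%nat -> sum_n (fold_Z g) N = g k :> R).
{ intros N hN. rewrite sum_n_fold_Z. apply lsum_single; [apply NoDup_zrange| |exact h].
  apply in_zrange; lia. }
unfold zsum. apply is_series_unique.
intros P hP. exists (Z.abs_nat k). intros n hn. rewrite H by exact hn. now apply locally_singleton.
Qed.

Lemma inner_basis_l (k : Z) (v : l2) : l2_inner (l2_basis k) v = Cconj (coord v k).
Proof.
unfold l2_inner. apply injective_projections; cbn [fst snd].
- rewrite (zsum_single _ k).
  + rewrite coord_basis, Z.eqb_refl. unfold Re, Cconj; simpl; ring.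
  + intros l hl. rewrite coord_basis. apply Z.eqb_neq in hl. rewrite hl. unfold Re; simpl; ring.
- rewrite (zsum_single _ k).
  + rewrite coord_basis, Z.eqb_refl. unfold Im, Cconj; simpl; ring.
  + intros l hl. rewrite coord_basis. apply Z.eqb_neq in hl. rewrite hl. unfold Im; simpl; ring.
Qed.

(** From [|S u|^2 = <T S u, u>]; the factor 2 is inherited from [inner_le]. *)
Lemma is_adjoint_norm (T S : BH) : is_adjoint T S -> opnorm S <= 2 * opnorm T.
Proof.
intros h. assert (hT := op_norm_ge0 l2_NormedModule T). apply op_norm_le. split; [lra|]. intros u.
change (l2_norm (S u) <= 2 * opnorm T * l2_norm u).
assert (e : l2_norm (S u) ^ 2 <= 2 * (opnorm T * l2_norm (S u) * l2_norm u)).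
{ rewrite <- inner_self, <- h. eapply Rle_trans; [apply inner_le|].
  apply Rmult_le_compat_l; [lra|]. apply Rmult_le_compat_r; [apply l2_norm_ge0|apply op_norm_apply]. }
destruct (Rle_lt_or_eq_dec _ _ (l2_norm_ge0 (S u))) as [hp|h0].
- apply (Rmult_le_reg_r (l2_norm (S u))); [exact hp|]. lra.
- rewrite <- h0. apply Rmult_le_pos; [lra|apply l2_norm_ge0].
Qed.

Lemma is_adjoint_coord (V W : BH) (u : l2) (k : Z) :
  is_adjoint V W -> coord (W u) k = Cconj (l2_inner (V (l2_basis k)) u).
Proof. intros h. rewrite h, inner_basis_l, Cconj_conj. reflexivity. Qed.

(** * Continuity of the elements of HS(s) along the units *)

Lemma bounded_choice (Q : nat -> nat -> Prop) (m : nat) :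
  (forall d N N', (N <= N')%nat -> Q d N -> Q d N') ->
  (forall d, (d < m)%nat -> exists N, Q d N) -> exists N, forall d, (d < m)%nat -> Q d N.
Proof.
intros hm. induction m as [|m IH]; intros h; [exists 0%nat; intros; lia|].
destruct IH as [N1 h1]; [intros; apply h; lia|]. destruct (h m ltac:(lia)) as [N2 h2].
exists (max N1 N2). intros d hd. destruct (Nat.eq_dec d m) as [->|hne].
- apply (hm _ N2); [lia|exact h2].
- apply (hm _ N1); [lia|]. apply h1. lia.
Qed.

(** * Powers of [s], digits and compactness of the [s]-adic integers *)

Section Adic.

Context (s : nat).

Definition pw (n : nat) : Z := (Z.of_nat s ^ Z.of_nat n)%Z.

Lemma pw_0 : pw 0 = 1%Z.
Proof. reflexivity. Qed.

Lemma pw_S (n : nat) : pw (S n) = (Z.of_nat s * pw n)%Z.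
Proof. unfold pw. now rewrite Nat2Z.inj_succ, Z.pow_succ_r by lia. Qed.

Lemma pw_plus (m n : nat) : pw (m + n) = (pw m * pw n)%Z.
Proof. unfold pw. rewrite Nat2Z.inj_add, Z.pow_add_r; lia. Qed.

Lemma pw_1 : pw 1 = Z.of_nat s.
Proof. unfold pw. simpl Z.of_nat. apply Z.pow_1_r. Qed.

Lemma pw_divide (m n : nat) : (m <= n)%nat -> (pw m | pw n)%Z.
Proof. intros h. exists (pw (n - m)). rewrite <- pw_plus. f_equal. lia. Qed.

Definition zunit (p : Z) : Prop := ~ (Z.of_nat s | p)%Z.

Lemma zunit_neq_0 (p : Z) : zunit p -> p <> 0%Z.
Proof. intros h ->. apply h. apply Z.divide_0_r. Qed.

Definition agree (n : nat) (x y : Zs s) : Prop := forall j, (j < n)%nat -> x j = y j.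

Lemma agree_le (m n : nat) (x y : Zs s) : (m <= n)%nat -> agree n x y -> agree m x y.
Proof. intros h1 h2 j hj. apply h2. lia. Qed.

Lemma agree_sym (n : nat) (x y : Zs s) : agree n x y -> agree n y x.
Proof. intros h j hj. symmetry. now apply h. Qed.

Lemma agree_trans (n : nat) (x y z : Zs s) : agree n x y -> agree n y z -> agree n x z.
Proof. intros h1 h2 j hj. now rewrite h1, h2. Qed.

(** Compactness of [Zs s] in inductive form, [P n x] being a property of the cylinder of the first
    [n] digits of [x]. A cylinder without the property contains a longer one without it; the digits
    so chosen define a point that contradicts the third hypothesis. *)
Lemma Zs_bar_induction (P : nat -> Zs s -> Prop) :
  (forall n x y, agree n x y -> P n x -> P n y) ->
  (forall n x, (forall y, agree n x y -> P (S n) y) -> P n x) ->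
  (forall x, exists n, P n x) -> forall x, P 0%nat x.
Proof.
intros H1 H2 H3 x0. apply NNPP. intros h0.
set (next := fun n x => epsilon (inhabits x0) (fun y => agree n x y /\ ~ P (S n) y)).
set (X := fix X n := match n with O => x0 | S n => next n (X n) end).
assert (hstep : forall n, ~ P n (X n) -> agree n (X n) (X (S n)) /\ ~ P (S n) (X (S n))).
{ intros n hn. change (X (S n)) with (next n (X n)). unfold next. apply epsilon_spec.
  apply NNPP. intros h. apply hn, H2. intros y hy. apply NNPP. intros hy'. apply h. now exists y. }
assert (hX : forall n, ~ P n (X n)).
{ induction n as [|n IH]; [exact h0|]. now apply hstep. }
assert (hchain : forall k n, agree n (X n) (X (n + k)%nat)).
{ induction k as [|k IH]; intros n; [rewrite Nat.add_0_r; intros j _; reflexivity|].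
  replace (n + S k)%nat with (S (n + k)) by lia.
  apply (agree_trans _ _ (X (n + k)%nat)); [apply IH|].
  apply (agree_le _ (n + k)); [lia|]. apply hstep, hX. }
set (x := MkZs s (fun j => X (S j) j) (fun j => digit_le s (X (S j)) j)).
destruct (H3 x) as [n hn]. apply (hX n). apply (H1 n x); [|exact hn].
intros j hj. change (x j) with (X (S j) j).
replace n with (S j + (n - S j))%nat by lia. apply hchain. lia.
Qed.

Definition set_digit (x : Zs s) (n d : nat) : Zs s :=
  MkZs s (fun j => if Nat.eqb j n then Nat.min d (s - 1) else x j)
    (fun j => match Nat.eqb j n as b return ((if b then Nat.min d (s - 1) else x j) <= s - 1)%nat
              with true => Nat.le_min_r _ _ | false => digit_le s x j end).

Lemma set_digit_agree (x y : Zs s) (n : nat) : agree n x y -> agree (S n) (set_digit x n (y n)) y.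
Proof.
intros h j hj. simpl. destruct (Nat.eqb_spec j n) as [->|hne].
- apply Nat.min_l, digit_le.
- apply h. lia.
Qed.

Lemma set_digit_agree_l (x : Zs s) (n d : nat) : agree n x (set_digit x n d).
Proof. intros j hj. simpl. destruct (Nat.eqb_spec j n) as [->|hne]; [lia|reflexivity]. Qed.

Lemma trunc_S (x : Zs s) (n : nat) :
  Zs_trunc s x (S n) = (Zs_trunc s x n + Z.of_nat (x n) * pw n)%Z.
Proof. reflexivity. Qed.

Lemma trunc_mod (x : Zs s) (n m : nat) : (n <= m)%nat -> (pw n | Zs_trunc s x m - Zs_trunc s x n)%Z.
Proof.
induction 1 as [|m hm IH]; [exists 0%Z; lia|]. rewrite trunc_S.
replace (Zs_trunc s x m + Z.of_nat (x m) * pw m - Zs_trunc s x n)%Z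
  with (Zs_trunc s x m - Zs_trunc s x n + Z.of_nat (x m) * pw m)%Z by ring.
apply Z.divide_add_r; [exact IH|]. apply Z.divide_mul_r, pw_divide, hm.
Qed.

Context (hs : (2 <= s)%nat).

Lemma pw_pos (n : nat) : (0 < pw n)%Z.
Proof. apply Z.pow_pos_nonneg; lia. Qed.

Lemma zdecomp (k : Z) : k <> 0%Z -> exists m p, zunit p /\ k = (pw m * p)%Z.
Proof.
intros hk. remember (Z.abs_nat k) as n eqn:hn. revert k hk hn.
induction n as [n IH] using lt_wf_ind. intros k hk hn.
destruct (classic (Z.of_nat s | k)%Z) as [[q hq]|h].
- destruct (IH (Z.abs_nat q)) with (k := q) as (m & p & hp & e); [nia|nia|reflexivity|].
  exists (S m), p. split; [exact hp|]. rewrite pw_S. nia.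
- exists 0%nat, k. split; [exact h|]. rewrite pw_0. ring.
Qed.

Lemma zdecomp_uniq (i j : nat) (p q : Z) : zunit p -> zunit q ->
  (pw i * p = pw j * q)%Z -> i = j /\ p = q.
Proof.
intros hp hq e.
assert (H : forall i j p q, zunit p -> (i <= j)%nat -> (pw i * p = pw j * q)%Z -> i = j /\ p = q).
{ clear i j p q hp hq e. intros i j p q hp hij e.
  replace j with (i + (j - i))%nat in e by lia.
  rewrite pw_plus, <- Z.mul_assoc in e.
  apply Z.mul_reg_l in e; [|generalize (pw_pos i); lia].
  destruct (j - i)%nat as [|d] eqn:hd.
  - rewrite pw_0 in e. split; [lia|]. lia.
  - exfalso. apply hp. rewrite e, pw_S. exists (pw d * q)%Z. ring. }
destruct (Nat.le_ge_cases i j) as [h|h].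
- now apply H.
- destruct (H j i q p hq h (eq_sym e)). auto.
Qed.

Definition zblock (p k : Z) : Prop := exists i, k = (pw i * p)%Z.

Section Swap.

Context (p q : Z) (hp : zunit p) (hq : zunit q).

(** On the block of [p] the quotient [k / p] is an exact power of [s]. Outside the two blocks the
    value is junk, and [swap_weight] vanishes there. *)
Definition swap_index (k : Z) : Z :=
  if excluded_middle_informative (zblock p k) then (k / p * q)%Z else (k / q * p)%Z.

Definition swap_weight (k : Z) : C :=
  if excluded_middle_informative (zblock p k \/ zblock q k) then RtoC 1 else RtoC 0.

Lemma swap_index_l (i : nat) : swap_index (pw i * p) = (pw i * q)%Z.
Proof.
unfold swap_index. destruct (excluded_middle_informative _) as [h|h].
- rewrite Z.div_mul; [reflexivity|now apply zunit_neq_0].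
- exfalso. apply h. now exists i.
Qed.

Lemma swap_index_r (i : nat) : swap_index (pw i * q) = (pw i * p)%Z.
Proof.
unfold swap_index. destruct (excluded_middle_informative _) as [[j h]|h].
- destruct (zdecomp_uniq _ _ _ _ hq hp h) as [-> <-].
  rewrite Z.div_mul; [reflexivity|now apply zunit_neq_0].
- rewrite Z.div_mul; [reflexivity|now apply zunit_neq_0].
Qed.

Lemma swap_weight_in (k : Z) : zblock p k \/ zblock q k -> swap_weight k = RtoC 1.
Proof. intros h. unfold swap_weight. destruct (excluded_middle_informative _); tauto. Qed.

Lemma swap_weight_out (k : Z) : ~ (zblock p k \/ zblock q k) -> swap_weight k = RtoC 0.
Proof. intros h. unfold swap_weight. destruct (excluded_middle_informative _); tauto. Qed.

Lemma swap_weight_le (k : Z) : Cmod (swap_weight k) <= 1.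
Proof.
destruct (classic (zblock p k \/ zblock q k)) as [h|h].
- rewrite swap_weight_in, Cmod_1 by exact h. lra.
- rewrite swap_weight_out, Cmod_0 by exact h. lra.
Qed.

Lemma swap_invol (k : Z) : zblock p k \/ zblock q k ->
  (zblock p (swap_index k) \/ zblock q (swap_index k)) /\ swap_index (swap_index k) = k.
Proof.
intros [[i ->]|[i ->]].
- rewrite swap_index_l, swap_index_r. split; [right; now exists i|reflexivity].
- rewrite swap_index_r, swap_index_l. split; [left; now exists i|reflexivity].
Qed.

Lemma swap_support (k : Z) : swap_weight k <> 0%C -> zblock p k \/ zblock q k.
Proof.
intros h. destruct (classic (zblock p k \/ zblock q k)) as [H|H]; [exact H|].
now rewrite swap_weight_out in h.
Qed.

Lemma swap_inj (j k : Z) : swap_weight j <> 0%C -> swap_weight k <> 0%C ->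
  swap_index j = swap_index k -> j = k.
Proof.
intros hj hk e. apply swap_support in hj. apply swap_support in hk.
rewrite <- (proj2 (swap_invol j hj)), <- (proj2 (swap_invol k hk)). now rewrite e.
Qed.

(* Exchanges [E_{s^i p}] and [E_{s^i q}], and kills the other basis vectors;
   for [p = q] this is the projection onto the block of [p]. *)
Definition swap_op : BH := wcomp swap_weight swap_index 1 Rle_0_1 swap_weight_le swap_inj.

Lemma swap_coord (u : l2) (k : Z) :
  coord (swap_op u) k = (swap_weight k * coord u (swap_index k))%C.
Proof. reflexivity. Qed.

Lemma swap_norm : opnorm swap_op <= 1.
Proof. apply wcomp_norm. Qed.

Lemma swap_basis (k : Z) :
  swap_op (l2_basis k) = scal (swap_weight k) (l2_basis (swap_index k)).
Proof.
apply l2_ext. intros j. change (coord (swap_op (l2_basis k)) j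
  = coord (scal (swap_weight k) (l2_basis (swap_index k))) j).
rewrite swap_coord, coord_scal, !coord_basis.
destruct (classic (zblock p j \/ zblock q j)) as [hj|hj].
- rewrite (swap_weight_in j hj).
  destruct (Z.eqb_spec (swap_index j) k) as [e|e].
  + subst k. destruct (swap_invol j hj) as [h1 h2].
    rewrite h2, (swap_weight_in _ h1), Z.eqb_refl. reflexivity.
  + destruct (Z.eqb_spec j (swap_index k)) as [e'|e']; [|ring].
    destruct (classic (zblock p k \/ zblock q k)) as [hk|hk].
    * exfalso. apply e. rewrite e'. now apply swap_invol.
    * rewrite (swap_weight_out k hk). ring.
- rewrite (swap_weight_out j hj).
  destruct (Z.eqb_spec j (swap_index k)) as [e'|e']; [|ring].
  destruct (classic (zblock p k \/ zblock q k)) as [hk|hk].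
  + exfalso. apply hj. rewrite e'. now apply swap_invol.
  + rewrite (swap_weight_out k hk). ring.
Qed.

Lemma swap_adjoint : is_adjoint swap_op swap_op.
Proof.
intros u v. apply Cminus_eq_0.
apply (functional_basis (fun u => l2_inner (swap_op u) v - l2_inner u (swap_op v))%C
  (2 * l2_norm v + 2 * l2_norm (swap_op v))).
- intros x y. rewrite op_plus_apply, !inner_plus_l. ring.
- intros c x. rewrite op_scal_apply, !inner_scal_l. ring.
- intros x. eapply Rle_trans; [apply Cmod_minus_le|].
  generalize (inner_le (swap_op x) v) (inner_le x (swap_op v)) (op_norm_apply swap_op x)
    swap_norm (l2_norm_ge0 x) (l2_norm_ge0 v) (op_norm_ge0 l2_NormedModule swap_op).
  intros h1 h2 h3 h4 h5 h6 h7.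
  assert (h8 : l2_norm (swap_op x) <= l2_norm x) by nra.
  assert (h9 : l2_norm (swap_op x) * l2_norm v <= l2_norm x * l2_norm v)
    by now apply Rmult_le_compat_r.
  lra.
- intros l. rewrite swap_basis, inner_scal_l, !inner_basis_l, swap_coord, Cmult_conj.
  replace (Cconj (swap_weight l)) with (swap_weight l); [ring|].
  destruct (classic (zblock p l \/ zblock q l)) as [h|h];
    rewrite ?(swap_weight_in l h), ?(swap_weight_out l h);
    unfold Cconj, RtoC; simpl; f_equal; ring.
Qed.

Lemma swap_basis_l (i : nat) : swap_op (l2_basis (pw i * p)) = l2_basis (pw i * q).
Proof.
rewrite swap_basis, swap_index_l, swap_weight_in by (left; now exists i).
apply l2_ext. intros k. transitivity (1 * coord (l2_basis (pw i * q)) k)%C; [reflexivity|ring].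
Qed.

End Swap.

(** * The C*-algebra of operators that almost commute with the swaps *)

Definition comm (T S : BH) : BH := minus (op_mult _ T S) (op_mult _ S T).

Lemma opnorm_mult (S T : BH) : opnorm (op_mult _ S T) <= opnorm S * opnorm T.
Proof.
assert (h1 := op_norm_ge0 l2_NormedModule S). assert (h2 := op_norm_ge0 l2_NormedModule T).
apply op_norm_le. split; [now apply Rmult_le_pos|]. intros u.
change (l2_norm (S (T u)) <= opnorm S * opnorm T * l2_norm u).
eapply Rle_trans; [apply op_norm_apply|]. rewrite Rmult_assoc.
apply Rmult_le_compat_l; [exact h1|apply op_norm_apply].
Qed.

Lemma comm_coord (T S : BH) (u : l2) (k : Z) :
  coord (comm T S u) k = (coord (T (S u)) k - coord (S (T u)) k)%C.
Proof. exact (coord_minus (T (S u)) (S (T u)) k). Qed.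

Lemma op_coord_eq (S T : BH) : (forall u k, coord (S u) k = coord (T u) k) -> S = T.
Proof. intros h. apply op_ext. intros u. apply l2_ext. intros k. apply h. Qed.

Lemma opplus_coord (S T : BH) (u : l2) (k : Z) :
  coord ((plus S T : BH) u) k = (coord (S u) k + coord (T u) k)%C.
Proof. reflexivity. Qed.

Lemma opscal_coord (c : C) (T : BH) (u : l2) (k : Z) :
  coord ((scal c T : BH) u) k = (c * coord (T u) k)%C.
Proof. reflexivity. Qed.

Lemma opmult_apply (S T : BH) (u : l2) : op_mult _ S T u = S (T u).
Proof. reflexivity. Qed.

Lemma comm_norm (T S : BH) : opnorm S <= 1 -> opnorm (comm T S) <= 2 * opnorm T.
Proof.
intros h. unfold comm. eapply Rle_trans; [apply (opnorm_minus_triangle _ zero)|].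
assert (e1 : opnorm (minus (op_mult _ T S) zero) <= opnorm T).
{ rewrite minus_zero_r. eapply Rle_trans; [apply opnorm_mult|].
  generalize (op_norm_ge0 l2_NormedModule T). nra. }
assert (e2 : opnorm (minus zero (op_mult _ S T)) <= opnorm T).
{ rewrite opnorm_minus_sym, minus_zero_r. eapply Rle_trans; [apply opnorm_mult|].
  generalize (op_norm_ge0 l2_NormedModule T). nra. }
eapply Rle_trans; [exact (Rplus_le_compat _ _ _ _ e1 e2)|lra].
Qed.

(* Elements of HS(s) are norm-continuous families of operators on the blocks
   [E_{s^i p}], [i >= 0], indexed by the [s]-adic unit [p]; this is the shape in which
   that property survives products, adjoints and limits. *)
Definition almost_comm (T : BH) : Prop :=
  forall eps, 0 < eps -> exists N, forall p q (hp : zunit p) (hq : zunit q),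
    (pw N | p - q)%Z -> opnorm (comm T (swap_op p q hp hq)) <= eps.

Lemma almost_comm_plus (S T : BH) : almost_comm S -> almost_comm T -> almost_comm (plus S T).
Proof.
intros h1 h2 eps heps.
destruct (h1 (eps / 2) ltac:(lra)) as [N1 H1]. destruct (h2 (eps / 2) ltac:(lra)) as [N2 H2].
exists (max N1 N2). intros p q hp hq hd.
specialize (H1 p q hp hq). specialize (H2 p q hp hq).
set (t := swap_op p q hp hq) in *.
assert (e : comm (plus S T) t = op_plus _ (comm S t) (comm T t)).
{ apply op_coord_eq. intros u k. change (op_plus _ (comm S t) (comm T t)) with (plus (comm S t) (comm T t) : BH).
  rewrite opplus_coord, !comm_coord. change (op_plus _ S T) with (plus S T : BH).
  rewrite opplus_coord.
  change ((plus S T : BH) u) with (plus (S u) (T u) : l2). rewrite op_plus_apply, coord_plus. ring. }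
rewrite e. eapply Rle_trans; [apply op_norm_triangle|].
assert (d1 : (pw N1 | p - q)%Z) by (eapply Z.divide_trans; [apply pw_divide|exact hd]; lia).
assert (d2 : (pw N2 | p - q)%Z) by (eapply Z.divide_trans; [apply pw_divide|exact hd]; lia).
specialize (H1 d1). specialize (H2 d2). lra.
Qed.

Lemma almost_comm_scal (c : C) (T : BH) : almost_comm T -> almost_comm (scal c T).
Proof.
intros h eps heps. assert (hc := Cmod_ge_0 c).
destruct (h (eps / (1 + Cmod c)) ltac:(apply Rdiv_lt_0_compat; lra)) as [N H].
exists N. intros p q hp hq hd. specialize (H p q hp hq hd).
set (t := swap_op p q hp hq) in *.
assert (e : comm (scal c T) t = op_scal _ c (comm T t)).
{ apply op_coord_eq. intros u k. change (op_scal _ c (comm T t)) with (scal c (comm T t) : BH).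
  rewrite opscal_coord, !comm_coord, opscal_coord.
  change ((scal c T : BH) u) with (scal c (T u) : l2). rewrite op_scal_apply, coord_scal. ring. }
rewrite e. eapply Rle_trans; [apply op_norm_scal|].
apply Rle_div_r in H; [|lra]. generalize (op_norm_ge0 l2_NormedModule (comm T t)). nra.
Qed.

Lemma almost_comm_mult (S T : BH) : almost_comm S -> almost_comm T -> almost_comm (op_mult _ S T).
Proof.
intros h1 h2 eps heps.
assert (hS := op_norm_ge0 l2_NormedModule S). assert (hT := op_norm_ge0 l2_NormedModule T).
destruct (h1 (eps / (2 * (1 + opnorm T))) ltac:(apply Rdiv_lt_0_compat; lra)) as [N1 H1].
destruct (h2 (eps / (2 * (1 + opnorm S))) ltac:(apply Rdiv_lt_0_compat; lra)) as [N2 H2].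
exists (max N1 N2). intros p q hp hq hd.
specialize (H1 p q hp hq). specialize (H2 p q hp hq).
set (t := swap_op p q hp hq) in *.
(* The commutator with [t] is a derivation. *)
assert (e : comm (op_mult _ S T) t = op_plus _ (op_mult _ S (comm T t)) (op_mult _ (comm S t) T)).
{ apply op_coord_eq. intros u k.
  change (op_plus _ (op_mult _ S (comm T t)) (op_mult _ (comm S t) T))
    with (plus (op_mult _ S (comm T t)) (op_mult _ (comm S t) T) : BH).
  rewrite opplus_coord, comm_coord, !opmult_apply, comm_coord.
  assert (e1 : S (comm T t u) = minus (S (T (t u)) : l2) (S (t (T u)))).
  { exact (op_minus_arg S (T (t u)) (t (T u))). }
  rewrite e1, coord_minus. ring. }
assert (d1 : (pw N1 | p - q)%Z) by (eapply Z.divide_trans; [apply pw_divide|exact hd]; lia).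
assert (d2 : (pw N2 | p - q)%Z) by (eapply Z.divide_trans; [apply pw_divide|exact hd]; lia).
specialize (H1 d1). specialize (H2 d2).
rewrite e. eapply Rle_trans; [apply op_norm_triangle|].
assert (a1 := opnorm_mult S (comm T t)). assert (a2 := opnorm_mult (comm S t) T).
apply Rle_div_r in H1; [|lra]. apply Rle_div_r in H2; [|lra].
generalize (op_norm_ge0 l2_NormedModule (comm T t)) (op_norm_ge0 l2_NormedModule (comm S t)). nra.
Qed.

Lemma inner_minus_l (u u' v : l2) : l2_inner (minus u u') v = (l2_inner u v - l2_inner u' v)%C.
Proof.
apply Cminus_eq_0.
replace (l2_inner u v) with (l2_inner (plus (minus u u') u') v).
- rewrite inner_plus_l. ring.
- f_equal. apply l2_ext. intros k.
  transitivity (coord (plus (minus u u') u') k); [reflexivity|]. rewrite coord_plus, coord_minus. ring.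
Qed.

Lemma inner_minus_r (u v v' : l2) : l2_inner u (minus v v') = (l2_inner u v - l2_inner u v')%C.
Proof.
rewrite (inner_conj u), inner_minus_l, (inner_conj u v), (inner_conj u v').
unfold Cconj; apply injective_projections; simpl; ring.
Qed.

Lemma almost_comm_adjoint (S T : BH) : almost_comm T -> is_adjoint T S -> almost_comm S.
Proof.
intros h ha eps heps. destruct (h (eps / 2) ltac:(lra)) as [N H].
exists N. intros p q hp hq hd. specialize (H p q hp hq hd).
assert (hself := swap_adjoint p q hp hq). set (t := swap_op p q hp hq) in *.
(* Since [t] is self-adjoint, the adjoint of the commutator of [T] is, up to sign, the commutator of
   [S]. *)
assert (hadj : is_adjoint (comm T t) (minus (op_mult _ t S) (op_mult _ S t))).
{ intros u v.
  change (comm T t u) with (minus (T (t u) : l2) (t (T u))).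
  change ((minus (op_mult _ t S) (op_mult _ S t) : BH) v) with (minus (t (S v) : l2) (S (t v))).
  rewrite inner_minus_l, inner_minus_r.
  now rewrite (ha (t u) v), (hself u (S v)), (hself (T u) v), (ha u (t v)). }
apply is_adjoint_norm in hadj. unfold comm. rewrite opnorm_minus_sym. lra.
Qed.

Lemma almost_comm_closed : closed almost_comm.
Proof.
intros T hT eps heps.
(* [closed] speaks of points whose complement is not a neighbourhood, which yields the approximant
   by contradiction. The error is [eps / 2] from [S] and twice [eps / 4] from [T - S]. *)
assert (hS : exists S, almost_comm S /\ opnorm (minus S T) < eps / 4).
{ apply NNPP. intros hn. apply hT. exists (mkposreal (eps / 4) ltac:(lra)). intros S hS hSc.
  apply hn. exists S. split; [exact hSc|exact hS]. }
destruct hS as (S & hS & hST). destruct (hS (eps / 2) ltac:(lra)) as [N H].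
exists N. intros p q hp hq hd. specialize (H p q hp hq hd).
assert (hn := swap_norm p q hp hq). set (t := swap_op p q hp hq) in *.
assert (e : comm T t = op_plus _ (comm S t) (comm (minus T S) t)).
{ apply op_coord_eq. intros u k.
  change (op_plus _ (comm S t) (comm (minus T S) t)) with (plus (comm S t) (comm (minus T S) t) : BH).
  rewrite opplus_coord, !comm_coord.
  change ((minus T S : BH) (t u)) with (minus (T (t u) : l2) (S (t u))).
  assert (e1 : t ((minus T S : BH) u) = minus (t (T u) : l2) (t (S u))).
  { exact (op_minus_arg t (T u) (S u)). }
  rewrite e1, !coord_minus. ring. }
rewrite e. eapply Rle_trans; [apply op_norm_triangle|].
assert (a := comm_norm (minus T S) t hn). rewrite opnorm_minus_sym in hST. lra.
Qed.

Lemma inv_pow_small (e : R) : 0 < e -> exists n, / INR s ^ n < e.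
Proof.
intros he. assert (h2 : 2 <= INR s) by (apply le_INR in hs; simpl in hs; lra).
destruct (pow_lt_1_zero (/ INR s)) with (y := e) as [N hN]; [|exact he|].
- rewrite Rabs_pos_eq by (left; apply Rinv_0_lt_compat; lra).
  rewrite <- Rinv_1. apply Rinv_lt_contravar; lra.
- exists N. specialize (hN N (le_n N)). rewrite pow_inv in hN.
  eapply Rle_lt_trans; [apply Rle_abs|exact hN].
Qed.

Lemma agree_ball (x y : Zs s) (n : nat) (e : R) : / INR s ^ n < e -> agree n x y -> Zs_ball s x e y.
Proof.
intros hn h. assert (h2 : 2 <= INR s) by (apply le_INR in hs; simpl in hs; lra).
assert (hp : forall m, 0 < INR s ^ m) by (intros; apply pow_lt; lra).
split; [eapply Rlt_trans; [apply Rinv_0_lt_compat, (hp n)|exact hn]|]. intros j hj.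
destruct (Nat.lt_ge_cases j n) as [h'|h']; [exfalso; apply hj, h, h'|].
eapply Rle_lt_trans; [|exact hn]. apply Rinv_le_contravar; [apply hp|].
apply Rle_pow; [lra|exact h'].
Qed.

(** Balls of [C] are squares, for its uniform structure is that of a product. *)
Lemma C_ball_Cmod (a b : C) (e : R) : @ball C_UniformSpace a e b -> Cmod (b - a) < 2 * e.
Proof.
intros [h1 h2]. eapply Rle_lt_trans; [apply Cmod_le_Re_Im|].
change (Rabs (fst b - fst a) < e) in h1. change (Rabs (snd b - snd a) < e) in h2.
unfold Re, Im. simpl. unfold Rminus in *. lra.
Qed.

(** Heine-Cantor by bar induction: a modulus valid on each of the finitely many one-digit extensions
    of a cylinder yields one on the cylinder. *)
Lemma Zs_unif_cont (f : Zs s -> C) :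
  (forall x, @continuous (Zs_UniformSpace s) C_UniformSpace f x) ->
  forall eps, 0 < eps -> exists N, forall x y, agree N x y -> Cmod (f x - f y) <= eps.
Proof.
intros hf eps heps.
set (P := fun n x => exists N, forall y z, agree n x y -> agree N y z -> Cmod (f y - f z) <= eps).
assert (H : P 0%nat (Zs_zero s)).
{ apply Zs_bar_induction; unfold P.
  - intros n x y hxy [N hN]. exists N. intros y' z hy hz. apply hN; [|exact hz].
    now apply (agree_trans _ _ y).
  - intros n x h.
    destruct (bounded_choice (fun d N => forall y z, agree (S n) (set_digit x n d) y -> agree N y z ->
        Cmod (f y - f z) <= eps) s) as [N hN].
    + intros d N N' hNN hN y z hy hz. apply hN; [exact hy|]. now apply (agree_le _ N').
    + intros d _. apply h, set_digit_agree_l.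
    + exists N. intros y z hy hz. apply (hN (y n)); [|now apply set_digit_agree|exact hz].
      generalize (digit_le s y n). lia.
  - intros x.
    destruct (hf x (fun c => @ball C_UniformSpace (f x) (eps / 4) c)) as [d hd].
    { exists (mkposreal (eps / 4) ltac:(lra)). auto. }
    destruct (inv_pow_small d (cond_pos d)) as [n hn]. exists n, n.
    assert (hx : forall y, agree n x y -> Cmod (f y - f x) <= eps / 2).
    { intros y hy. assert (hb := C_ball_Cmod _ _ _ (hd y (agree_ball x y n d hn hy))).
      simpl in hb. lra. }
    intros y z hy hz. generalize (hx y hy) (hx z (agree_trans _ _ _ _ hy hz)).
    generalize (Cmod_minus_triangle (f y) (f x) (f z)). rewrite (Cmod_minus_sym (f x) (f z)). lra. }
destruct H as [N hN]. exists N. intros x y h. apply hN; [intros j hj; lia|exact h].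
Qed.

Lemma trunc_bound (x : Zs s) (n : nat) : (0 <= Zs_trunc s x n < pw n)%Z.
Proof.
induction n as [|n IH]; [rewrite pw_0; simpl; lia|]. rewrite trunc_S, pw_S.
generalize (digit_le s x n) (pw_pos n). nia.
Qed.

Lemma trunc_agree (x y : Zs s) (n : nat) : Zs_trunc s x n = Zs_trunc s y n <-> agree n x y.
Proof.
induction n as [|n IH]; [split; [intros _ j hj; lia|reflexivity]|].
rewrite !trunc_S. split.
- intros e. generalize (trunc_bound x n) (trunc_bound y n). intros b1 b2.
  assert (e1 : Zs_trunc s x n = Zs_trunc s y n /\ Z.of_nat (x n) = Z.of_nat (y n)).
  { assert (Z.of_nat (x n) = Z.of_nat (y n)) by nia. nia. }
  intros j hj. destruct (Nat.eq_dec j n) as [->|hne]; [lia|]. apply IH; [tauto|lia].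
- intros h. rewrite (h n) by lia. f_equal. apply IH. now apply (agree_le _ (S n)); [lia|].
Qed.

Lemma repr_agree (x y : Zs s) (k l : Z) (n : nat) :
  Zs_repr s x k -> Zs_repr s y l -> (pw n | k - l)%Z -> agree n x y.
Proof.
intros hx hy h. apply trunc_agree.
destruct (hx n) as [a ha]. destruct (hy n) as [b hb]. destruct h as [c hc]. fold (pw n) in *.
generalize (trunc_bound x n) (trunc_bound y n) (pw_pos n). intros b1 b2 b3.
assert (e : (Zs_trunc s x n - Zs_trunc s y n = (c - a + b) * pw n)%Z) by lia.
assert ((c - a + b = 0)%Z) by nia. nia.
Qed.

Lemma trunc_zunit (x : Zs s) (n : nat) : Zs_units s x -> (1 <= n)%nat -> zunit (Zs_trunc s x n).
Proof.
intros hx hn h. assert (h1 := trunc_mod x 1 n hn). rewrite pw_1 in h1.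
assert (h2 : (Z.of_nat s | Zs_trunc s x 1)%Z).
{ replace (Zs_trunc s x 1) with (Zs_trunc s x n - (Zs_trunc s x n - Zs_trunc s x 1))%Z by ring.
  now apply Z.divide_sub_r. }
rewrite trunc_S, pw_0 in h2. cbn [Zs_trunc] in h2.
unfold Zs_units in hx. generalize (digit_le s x 0). intros hd.
apply Z.divide_pos_le in h2; lia.
Qed.

Lemma repr_zunit (x : Zs s) (l : Z) : Zs_repr s x l -> (zunit l <-> Zs_units s x).
Proof.
intros hx. assert (h := hx 1%nat). fold (pw 1) in h. rewrite pw_1, trunc_S, pw_0 in h. cbn [Zs_trunc] in h.
unfold zunit, Zs_units. split.
- intros hl e. apply hl. rewrite e in h. now rewrite Z.sub_0_r in h.
- intros hx0 hl. assert (h2 : (Z.of_nat s | Z.of_nat (x 0%nat))%Z).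
  { replace (Z.of_nat (x 0%nat)) with (l - (l - (0 + Z.of_nat (x 0%nat) * 1)))%Z by ring.
    now apply Z.divide_sub_r. }
  generalize (digit_le s x 0). intros hd. apply Z.divide_pos_le in h2; lia.
Qed.

Lemma is_mult_coord (f : Zs s -> C) (M : BH) : is_mult s f M ->
  forall u k x, Zs_repr s x k -> coord (M u) k = (f x * coord u k)%C.
Proof.
intros h u k x hx.
apply (op_coord_ext M k (fun u => f x * coord u k)%C (Cmod (f x))).
- intros a b. rewrite coord_plus. ring.
- intros c a. rewrite coord_scal. ring.
- intros a. rewrite Cmod_mult. apply Rmult_le_compat_l; [apply Cmod_ge_0|apply coord_le].
- intros l. destruct (Zs_repr_ex s l hs) as [y hy]. rewrite (h l y hy), coord_scal, coord_basis.
  destruct (Z.eqb_spec k l) as [->|hkl]; [|ring]. now rewrite (Zs_repr_uniq s x y l hs hx hy).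
Qed.

(** On the swapped blocks the commutator multiplies by a difference of values of [f] at the images
    of [s^i p] and [s^i q]. These are congruent modulo [s^N] for every [i], so uniform continuity of
    [f] bounds all levels at once. *)
Lemma almost_comm_is_mult (f : Zs s -> C) (M : BH) :
  (forall x, @continuous (Zs_UniformSpace s) C_UniformSpace f x) -> is_mult s f M -> almost_comm M.
Proof.
intros hf hM eps heps. destruct (Zs_unif_cont f hf eps heps) as [N hN].
exists N. intros p q hp hq hd.
apply op_norm_le. split; [lra|]. intros u.
change (l2_norm (comm M (swap_op p q hp hq) u) <= eps * l2_norm u).
apply Rle_trans with (eps * l2_norm (swap_op p q hp hq u)).
- apply l2_norm_coord_le; [lra|]. intros k.
  destruct (Zs_repr_ex s k hs) as [x hx]. destruct (Zs_repr_ex s (swap_index p q k) hs) as [y hy].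
  rewrite comm_coord, (is_mult_coord f M hM _ k x hx), !swap_coord,
    (is_mult_coord f M hM _ _ y hy).
  replace (f x * (swap_weight p q k * coord u (swap_index p q k)) -
    swap_weight p q k * (f y * coord u (swap_index p q k)))%C
    with ((f x - f y) * (swap_weight p q k * coord u (swap_index p q k)))%C by ring.
  destruct (classic (zblock p k \/ zblock q k)) as [h|h].
  + rewrite Cmod_mult. apply Rmult_le_compat_r; [apply Cmod_ge_0|]. apply hN.
    apply (repr_agree x y k (swap_index p q k)); auto.
    destruct h as [[i ->]|[i ->]].
    * rewrite (swap_index_l p q hp). rewrite <- Z.mul_sub_distr_l. now apply Z.divide_mul_r.
    * rewrite (swap_index_r p q hp hq). rewrite <- Z.mul_sub_distr_l. apply Z.divide_mul_r.
      replace (q - p)%Z with (- (p - q))%Z by ring. now apply Z.divide_opp_r.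
  + rewrite (swap_weight_out p q k h), Cmult_0_l, Cmult_0_r, Cmod_0. lra.
- apply Rmult_le_compat_l; [lra|]. eapply Rle_trans; [apply op_norm_apply|].
  generalize (swap_norm p q hp hq) (l2_norm_ge0 u). nra.
Qed.

Lemma swap_index_scale (p q : Z) (hp : zunit p) (hq : zunit q) (k : Z) :
  zblock p k \/ zblock q k -> swap_index p q (Z.of_nat s * k) = (Z.of_nat s * swap_index p q k)%Z.
Proof.
intros [[i ->]|[i ->]].
- rewrite Z.mul_assoc, <- pw_S, !swap_index_l by assumption. rewrite pw_S. ring.
- rewrite Z.mul_assoc, <- pw_S, !swap_index_r by assumption. rewrite pw_S. ring.
Qed.

Lemma zblock_scale (p k : Z) : zunit p -> (zblock p (Z.of_nat s * k) <-> zblock p k).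
Proof.
intros hp. split.
- intros [[|i] h].
  + exfalso. apply hp. exists k. rewrite pw_0 in h. lia.
  + exists i. rewrite pw_S in h. nia.
- intros [i ->]. exists (S i). rewrite pw_S. ring.
Qed.

(** The shift raises the level inside each block, so it commutes exactly with every swap. *)
Lemma almost_comm_shift (V : BH) : is_shift s V -> almost_comm V.
Proof.
intros hV eps heps. exists 0%nat. intros p q hp hq _.
assert (e : comm V (swap_op p q hp hq) = zero).
{ apply op_basis_ext. intros l k. rewrite comm_coord, !swap_basis, op_scal_apply, !hV, swap_basis.
  rewrite !coord_scal.
  destruct (classic (zblock p l \/ zblock q l)) as [h|h].
  - rewrite (swap_index_scale p q hp hq l h).
    rewrite !swap_weight_in by (exact h || (destruct h as [h|h]; [left|right]; now apply zblock_scale)).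
    transitivity (RtoC 0); [ring|reflexivity].
  - rewrite (swap_weight_out p q l h), (swap_weight_out p q (Z.of_nat s * l))
      by (intros [h'|h']; apply h;
        [left; now apply (zblock_scale p l hp)|right; now apply (zblock_scale q l hq)]).
    transitivity (RtoC 0); [ring|reflexivity]. }
rewrite e, opnorm_zero. lra.
Qed.

Lemma almost_comm_Cstar : Cstar_subalgebra almost_comm.
Proof.
constructor.
- intros eps heps. exists 0%nat. intros p q hp hq _.
  eapply Rle_trans; [apply comm_norm, swap_norm|]. rewrite opnorm_zero. lra.
- apply almost_comm_plus.
- apply almost_comm_scal.
- apply almost_comm_mult.
- apply almost_comm_adjoint.
- apply almost_comm_closed.
Qed.

Lemma HS_almost_comm (T : BH) : HS s T -> almost_comm T.
Proof.
intros h. apply h; [apply almost_comm_Cstar|apply almost_comm_shift|apply almost_comm_is_mult].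
Qed.

Definition entry (T : BH) (i j : nat) (p : Z) : C := coord (T (l2_basis (pw j * p))) (pw i * p).

(** The coordinate at [s^i q] of the commutator applied to [E_{s^j p}] is the entry at [q] minus the
    entry at [p]; hence the uniformity in [i] and [j]. *)
Lemma almost_comm_entry (T : BH) : almost_comm T ->
  forall eps, 0 < eps -> exists N, forall p q, zunit p -> zunit q -> (pw N | p - q)%Z ->
  forall i j, Cmod (entry T i j p - entry T i j q) <= eps.
Proof.
intros h eps heps. destruct (h eps heps) as [N hN]. exists N. intros p q hp hq hd i j.
specialize (hN p q hp hq hd).
assert (hc := comm_coord T (swap_op p q hp hq) (l2_basis (pw j * p)) (pw i * q)).
rewrite swap_basis_l, swap_coord, (swap_index_r p q hp hq), swap_weight_in in hc
  by (right; now exists i).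
rewrite Cmult_1_l in hc. unfold entry. rewrite Cmod_minus_sym.
eapply Rle_trans; [right; exact (f_equal Cmod (eq_sym hc))|].
eapply Rle_trans; [apply coord_op_basis_le|exact hN].
Qed.

(** For [p = q] the swap is the projection onto the block, and [p - p] is divisible by every power
    of [s]; so the commutator with the projection is 0. *)
Lemma almost_comm_block (T : BH) (p k : Z) (j : nat) : almost_comm T -> zunit p -> ~ zblock p k ->
  coord (T (l2_basis (pw j * p))) k = 0%C.
Proof.
intros h hp hk. apply Cmod_eq_0, Rle_antisym; [|apply Cmod_ge_0].
apply le_epsilon. intros eps heps. rewrite Rplus_0_l.
destruct (h eps heps) as [N hN]. specialize (hN p p hp hp ltac:(exists 0%Z; lia)).
assert (hc := comm_coord T (swap_op p p hp hp) (l2_basis (pw j * p)) k).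
rewrite swap_basis_l, swap_coord, swap_weight_out in hc by tauto.
rewrite Cmult_0_l in hc.
replace (coord (T (l2_basis (pw j * p))) k - 0)%C with (coord (T (l2_basis (pw j * p))) k) in hc by ring.
eapply Rle_trans; [right; exact (f_equal Cmod (eq_sym hc))|].
eapply Rle_trans; [apply coord_op_basis_le|exact hN].
Qed.

End Adic.

(** * Decay of the elements of the ideal *)

Section Shift.

Context (s : nat) (hs : (2 <= s)%nat).

Notation pw := (pw s).
Notation zunit := (zunit s).

Definition div_weight (k : Z) : C :=
  if excluded_middle_informative (Z.of_nat s | k)%Z then RtoC 1 else RtoC 0.

Lemma div_weight_le (k : Z) : Cmod (div_weight k) <= 1.
Proof.
unfold div_weight. destruct (excluded_middle_informative _); [rewrite Cmod_1|rewrite Cmod_0]; lra.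
Qed.

Lemma div_weight_inj (j k : Z) : div_weight j <> 0%C -> div_weight k <> 0%C ->
  (j / Z.of_nat s = k / Z.of_nat s)%Z -> j = k.
Proof.
unfold div_weight. intros hj hk e.
destruct (excluded_middle_informative (Z.of_nat s | j)%Z) as [[a ->]|h]; [|now destruct hj].
destruct (excluded_middle_informative (Z.of_nat s | k)%Z) as [[b ->]|h]; [|now destruct hk].
rewrite !Z.div_mul in e by lia. now subst.
Qed.

Lemma shift_wcomp (V : BH) : is_shift s V ->
  V = wcomp div_weight (fun k => k / Z.of_nat s)%Z 1 Rle_0_1 div_weight_le div_weight_inj.
Proof.
intros hV. apply op_basis_ext. intros l k. rewrite hV, wcomp_coord, !coord_basis.
unfold div_weight. destruct (excluded_middle_informative (Z.of_nat s | k)%Z) as [[a ->]|h].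
- rewrite Z.div_mul by lia.
  destruct (Z.eqb_spec a l) as [e'|e'];
    destruct (Z.eqb_spec (a * Z.of_nat s) (Z.of_nat s * l)) as [e|e];
    try ring; exfalso; nia.
- destruct (Z.eqb_spec k (Z.of_nat s * l)) as [->|e]; [|ring].
  exfalso. apply h. exists l. ring.
Qed.

Lemma shift_norm (V : BH) : is_shift s V -> opnorm V <= 1.
Proof. intros hV. rewrite (shift_wcomp V hV). apply wcomp_norm. Qed.

Lemma adjoint_shift_coord (V W : BH) (u : l2) (k : Z) : is_shift s V -> is_adjoint V W ->
  coord (W u) k = coord u (Z.of_nat s * k).
Proof.
intros hV hW. rewrite (is_adjoint_coord V W u k hW), hV, inner_basis_l, Cconj_conj. reflexivity.
Qed.

Lemma const_weight_inj (j k : Z) : RtoC 1 <> 0%C -> RtoC 1 <> 0%C ->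
  (Z.of_nat s * j = Z.of_nat s * k)%Z -> j = k.
Proof. intros _ _ h. nia. Qed.

Lemma adjoint_shift_norm (V W : BH) : is_shift s V -> is_adjoint V W -> opnorm W <= 1.
Proof.
intros hV hW.
replace W with (wcomp (fun _ => RtoC 1) (fun k => Z.of_nat s * k)%Z 1 Rle_0_1
  (fun _ => Req_le _ _ Cmod_1) const_weight_inj).
- apply wcomp_norm.
- apply op_coord_eq. intros u k. rewrite wcomp_coord, (adjoint_shift_coord V W u k hV hW). ring.
Qed.

Lemma op_pow_norm (T : BH) (n : nat) : opnorm T <= 1 -> opnorm (op_pow _ T n) <= 1.
Proof.
intros h. induction n as [|n IH].
- apply op_norm_le. split; [lra|]. intros u. right. simpl. ring.
- simpl op_pow. eapply Rle_trans; [apply opnorm_mult|].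
  generalize (op_norm_ge0 l2_NormedModule T) (op_norm_ge0 l2_NormedModule (op_pow _ T n)). nra.
Qed.

Lemma shift_pow_basis (V : BH) (n : nat) (l : Z) : is_shift s V ->
  op_pow _ V n (l2_basis l) = l2_basis (pw n * l).
Proof.
intros hV. induction n as [|n IH].
- rewrite pw_0, Z.mul_1_l. reflexivity.
- change (V (op_pow _ V n (l2_basis l)) = l2_basis (pw (S n) * l)).
  rewrite IH, hV, pw_S. f_equal. ring.
Qed.

Lemma adjoint_pow_coord (V W : BH) (n : nat) (u : l2) (k : Z) : is_shift s V -> is_adjoint V W ->
  coord (op_pow _ W n u) k = coord u (pw n * k).
Proof.
intros hV hW. revert k. induction n as [|n IH]; intros k.
- rewrite pw_0, Z.mul_1_l. reflexivity.
- change (coord (W (op_pow _ W n u)) k = coord u (pw (S n) * k)).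
  rewrite (adjoint_shift_coord V W _ _ hV hW), IH, pw_S. f_equal. ring.
Qed.

Lemma shift_pow_coord (V : BH) (n : nat) (u : l2) (k : Z) : is_shift s V ->
  coord (op_pow _ V n u) (pw n * k) = coord u k.
Proof.
intros hV. apply (op_coord_ext (op_pow _ V n) (pw n * k) (fun u => coord u k) 1); auto.
- intros v. rewrite Rmult_1_l. apply coord_le.
- intros l. rewrite (shift_pow_basis V n l hV), !coord_basis.
  generalize (pw_pos s hs n). intros hp.
  destruct (Z.eqb_spec k l) as [->|hne]; [now rewrite Z.eqb_refl|].
  destruct (Z.eqb_spec (pw n * k) (pw n * l)) as [e|e]; [exfalso; nia|reflexivity].
Qed.

Lemma shift_pow_coord_out (V : BH) (n : nat) (u : l2) (k : Z) : is_shift s V ->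
  ~ (pw n | k)%Z -> coord (op_pow _ V n u) k = 0%C.
Proof.
intros hV hk. apply (op_coord_ext (op_pow _ V n) k (fun _ => 0%C) 0).
- intros; ring.
- intros; ring.
- intros v. rewrite Cmod_0. lra.
- intros l. rewrite (shift_pow_basis V n l hV), coord_basis.
  destruct (Z.eqb_spec k (pw n * l)) as [->|e]; [|reflexivity].
  exfalso. apply hk. exists l. ring.
Qed.

Lemma pw_not_divide (m n : nat) (p : Z) : zunit p -> (m < n)%nat -> ~ (pw n | pw m * p)%Z.
Proof.
intros hp hmn [c hc].
replace n with (S (n - m - 1) + m)%nat in hc by lia.
rewrite pw_plus, pw_S in hc. apply hp. exists (c * pw (n - m - 1))%Z.
generalize (pw_pos s hs m). nia.
Qed.

Lemma is_mult0_coord (F : nat * Zs s -> C) (M : BH) (m : nat) (p : Z) (x : Zs s) (u : l2) :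
  is_mult0 s F M -> Zs_repr s x p -> Zs_units s x ->
  coord (M u) (pw m * p) = (F (m, x) * coord u (pw m * p))%C.
Proof.
intros [h0 h] hx hu.
apply (op_coord_ext M (pw m * p) (fun u => F (m, x) * coord u (pw m * p))%C (Cmod (F (m, x)))).
- intros a b. rewrite coord_plus. ring.
- intros c a. rewrite coord_scal. ring.
- intros a. rewrite Cmod_mult. apply Rmult_le_compat_l; [apply Cmod_ge_0|apply coord_le].
- assert (hp : zunit p) by now apply (repr_zunit s hs x p hx).
  intros l. destruct (Z.eq_dec l 0) as [->|hl].
  + rewrite h0, coord_zero, coord_basis.
    destruct (Z.eqb_spec (pw m * p) 0) as [e|e]; [|ring].
    generalize (pw_pos s hs m) (zunit_neq_0 s p hp). nia.
  + destruct (zdecomp s hs l hl) as (i & q & hq & ->).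
    destruct (Zs_repr_ex s q hs) as [y hy].
    assert (hyu : Zs_units s y) by now apply (repr_zunit s hs y q hy).
    rewrite (h i q y hy hyu : M (l2_basis (pw i * q)) = _), coord_scal.
    fold (pw i). rewrite coord_basis.
    destruct (Z.eqb_spec (pw m * p) (pw i * q)) as [e|e]; [|ring].
    destruct (zdecomp_uniq s hs _ _ _ _ hp hq e) as [-> ->].
    now rewrite (Zs_repr_uniq s x y q hs hx hy).
Qed.

Lemma is_mult0_basis (F : nat * Zs s -> C) (M : BH) (m : nat) (p : Z) (x : Zs s) :
  is_mult0 s F M -> Zs_repr s x p -> Zs_units s x ->
  M (l2_basis (pw m * p)) = scal (F (m, x)) (l2_basis (pw m * p)).
Proof. intros [_ h] hx hu. exact (h m p x hx hu). Qed.

(** Covers both quantities whose decay is at stake: one coordinate of [T v] for rows, the norm of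
    [T v] for columns. *)
Definition op_seminorm (N : BH -> R) (K : R) : Prop :=
  (forall S T, N (plus S T) <= N S + N T) /\ (forall T, N T <= K * opnorm T).

Lemma seminorm_coord (v : l2) (k : Z) : op_seminorm (fun T => Cmod (coord (T v) k)) (l2_norm v).
Proof.
split.
- intros S T. rewrite opplus_coord. apply Cmod_triangle.
- intros T. rewrite Rmult_comm. apply coord_op_le.
Qed.

Lemma seminorm_vec (v : l2) : op_seminorm (fun T => l2_norm (T v)) (l2_norm v).
Proof.
split.
- intros S T. exact (l2_norm_triangle (S v) (T v)).
- intros T. rewrite Rmult_comm. apply op_norm_apply.
Qed.

Lemma seminorm_sum (N : BH -> R) (K : R) (T : nat -> BH) (c : nat -> R) (n : nat) :
  op_seminorm N K -> (forall n, N (T n) <= c n) -> N (sum_n T n) <= sum_n c n.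
Proof.
intros [h1 _] hc. induction n as [|n IH].
- rewrite !sum_O. apply hc.
- rewrite !sum_Sn. eapply Rle_trans; [apply h1|].
  change (plus (sum_n c n) (c (S n))) with (sum_n c n + c (S n)). specialize (hc (S n)).
  apply Rplus_le_compat; assumption.
Qed.

Lemma seminorm_series (N : BH -> R) (K B : R) (T : nat -> BH) (c : nat -> R) (S : BH) :
  op_seminorm N K -> 0 <= K -> is_series T S ->
  (forall n, N (T n) <= c n) -> (forall n, sum_n c n <= B) -> N S <= B.
Proof.
intros hN hK hS hc hB. apply le_epsilon. intros eps heps.
destruct (proj1 (is_series_op T S) hS (eps / (K + 1)) ltac:(apply Rdiv_lt_0_compat; lra)) as [n hn].
specialize (hn n (le_n n)).
assert (e : S = plus (minus S (sum_n T n)) (sum_n T n)).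
{ unfold minus. rewrite <- plus_assoc, plus_opp_l, plus_zero_r. reflexivity. }
assert (h3 := seminorm_sum N K T c n hN hc). destruct hN as [h1 h2].
rewrite e. eapply Rle_trans; [apply h1|].
specialize (h2 (minus S (sum_n T n))). rewrite opnorm_minus_sym in h2.
apply Rlt_div_r in hn; [|lra]. specialize (hB n).
assert (h0 := op_norm_ge0 l2_NormedModule (minus (sum_n T n) S)).
assert (h4 : N (minus S (sum_n T n)) <= eps) by nra.
assert (h5 : N (sum_n T n) <= B) by (eapply Rle_trans; [exact h3|exact hB]).
rewrite Rplus_comm. now apply Rplus_le_compat.
Qed.

(** The subtracted term makes the induction telescope. *)
Lemma sum_inv_sq (n : nat) : sum_n (fun k => / (1 + INR k) ^ 2) n <= 2 - / (1 + INR n).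
Proof.
induction n as [|n IH].
- rewrite sum_O. simpl. lra.
- rewrite sum_Sn.
  change (plus (sum_n (fun k => / (1 + INR k) ^ 2) n) (/ (1 + INR (S n)) ^ 2))
    with (sum_n (fun k => / (1 + INR k) ^ 2) n + / (1 + INR (S n)) ^ 2).
  eapply Rle_trans; [apply Rplus_le_compat_r, IH|].
  rewrite S_INR. generalize (pos_INR n). intros h. set (x := INR n) in *.
  assert (e : / (1 + x) - / (1 + (x + 1)) - / (1 + (x + 1)) ^ 2 = / ((1 + x) * (1 + (x + 1)) ^ 2)).
  { field. lra. }
  assert (0 < / ((1 + x) * (1 + (x + 1)) ^ 2)).
  { apply Rinv_0_lt_compat, Rmult_lt_0_compat; [lra|apply pow_lt; lra]. }
  lra.
Qed.

Lemma sum_scal_inv_sq (C0 : R) (n : nat) : 0 <= C0 ->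
  sum_n (fun k => C0 * / (1 + INR k) ^ 2) n <= 2 * C0.
Proof.
intros h. rewrite (sum_n_mult_l (K := R_Ring)).
change (mult C0 (sum_n (fun k => / (1 + INR k) ^ 2) n)) with (C0 * sum_n (fun k => / (1 + INR k) ^ 2) n).
assert (0 < / (1 + INR n)) by (apply Rinv_0_lt_compat; generalize (pos_INR n); lra).
generalize (sum_inv_sq n). nra.
Qed.

Lemma ex_series_inv_sq (C0 : R) : 0 <= C0 -> ex_series (fun k => C0 * / (1 + INR k) ^ 2).
Proof.
intros h.
destruct (ex_finite_lim_seq_incr (sum_n (fun k => C0 * / (1 + INR k) ^ 2)) (2 * C0)) as [l hl].
- intros n. rewrite sum_Sn.
  change (@plus R_AbelianMonoid) with Rplus.
  assert (0 <= C0 * / (1 + INR (S n)) ^ 2).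
  { apply Rmult_le_pos; [exact h|]. left. apply Rinv_0_lt_compat, pow_lt. generalize (pos_INR (S n)). lra. }
  apply (Rle_trans _ (sum_n (fun k => C0 * / (1 + INR k) ^ 2) n + 0)); [rewrite Rplus_0_r; apply Rle_refl|].
  now apply Rplus_le_compat_l.
- intros n. now apply sum_scal_inv_sq.
- exists l. exact hl.
Qed.

Lemma rapid_decay_bound (F : Z -> nat * Zs s -> C) (j k : nat) :
  rapid_decay (fun m n => sup_units s (F n) m) ->
  exists C0, 0 <= C0 /\ forall m n x, Zs_units s x ->
    Cmod (F n (m, x)) <= C0 * / ((1 + INR m) ^ j * (1 + Rabs (IZR n)) ^ k).
Proof.
intros h. destruct (h j k) as [M hM]. exists (Rabs M). split; [apply Rabs_pos|]. intros m n x hx.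
specialize (hM m n). unfold sup_units in hM.
assert (hp : 0 < / ((1 + INR m) ^ j * (1 + Rabs (IZR n)) ^ k)).
{ apply Rinv_0_lt_compat, Rmult_lt_0_compat; apply pow_lt.
  - generalize (pos_INR m). lra.
  - generalize (Rabs_pos (IZR n)). lra. }
assert (hle : Cmod (F n (m, x)) <= M / ((1 + INR m) ^ j * (1 + Rabs (IZR n)) ^ k)).
{ assert (h1 := proj1 (Lub_Rbar_correct (fun y => exists x, Zs_units s x /\ y = Cmod (F n (m, x))))
     (Cmod (F n (m, x))) (ex_intro _ x (conj hx eq_refl))).
  exact (Rbar_le_trans _ _ _ h1 hM). }
eapply Rle_trans; [exact hle|]. apply Rmult_le_compat_r; [lra|apply Rle_abs].
Qed.

(** Of the [j + 2] powers of [1 + n], [j] transport the decay from level [i] to level [m], and 2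
    remain for summation over [n]. *)
Lemma decay_shift (m n i j : nat) : (m <= i + n)%nat ->
  / ((1 + INR i) ^ j * (1 + INR n) ^ (j + 2)) <= / (1 + INR m) ^ j * / (1 + INR n) ^ 2.
Proof.
intros h. generalize (pos_INR m) (pos_INR n) (pos_INR i). intros hm hn hi.
rewrite <- Rinv_mult. apply Rinv_le_contravar.
- apply Rmult_lt_0_compat; apply pow_lt; lra.
- rewrite Nat.add_comm, pow_add, (Rmult_comm ((1 + INR n) ^ 2)), <- Rmult_assoc.
  apply Rmult_le_compat_r; [apply pow2_ge_0|].
  rewrite <- Rpow_mult_distr. apply pow_incr. split; [lra|].
  apply le_INR in h. rewrite plus_INR in h. nra.
Qed.

(* The term of index [n] relates the levels [i] and [m <= i + n], and
   [(1 + i) (1 + n) >= 1 + m] turns the decay of [F n] at level [i] into decay at level [m]. *)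
Lemma I_infty_decay (a : BH) : I_infty s a -> a (l2_basis 0) = zero /\
  forall j, exists C0, 0 <= C0 /\ forall m p, zunit p ->
    (forall v, Cmod (coord (a v) (pw m * p)) <= C0 * / (1 + INR m) ^ j * l2_norm v) /\
    l2_norm (a (l2_basis (pw m * p))) <= C0 * / (1 + INR m) ^ j.
Proof.
intros (_ & V & W & F & M & b & c & hV & hW & _ & hM & hrd & hb & hc & ->).
assert (Vn : forall n u, l2_norm (op_pow _ V n u) <= l2_norm u).
{ intros n u. eapply Rle_trans; [apply op_norm_apply|].
  generalize (op_pow_norm V n (shift_norm V hV)) (l2_norm_ge0 u). nra. }
assert (Wn : forall n u, l2_norm (op_pow _ W n u) <= l2_norm u).
{ intros n u. eapply Rle_trans; [apply op_norm_apply|].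
  generalize (op_pow_norm W n (adjoint_shift_norm V W hV hW)) (l2_norm_ge0 u). nra. }
assert (W0 : forall n, op_pow _ W n (l2_basis 0) = l2_basis 0).
{ intros n. apply l2_ext. intros k.
  change (coord (op_pow _ W n (l2_basis 0)) k = coord (l2_basis 0) k).
  rewrite (adjoint_pow_coord V W n _ k hV hW), !coord_basis.
  generalize (pw_pos s hs n). intros hp.
  destruct (Z.eqb_spec (pw n * k) 0); destruct (Z.eqb_spec k 0); try reflexivity; exfalso; nia. }
assert (pinv : forall m j, 0 < / (1 + INR m) ^ j).
{ intros m j. apply Rinv_0_lt_compat, pow_lt. generalize (pos_INR m). lra. }
split.
{ assert (z0 : forall S : BH, l2_norm (S (l2_basis 0)) <= 0 -> S (l2_basis 0) = zero).
  { intros S h. apply l2_norm_eq0. apply Rle_antisym; [exact h|apply l2_norm_ge0]. }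
  apply z0. eapply Rle_trans; [apply (proj1 (seminorm_vec (l2_basis 0)))|].
  assert (s0 : forall n : nat, sum_n (fun _ => 0) n <= 0).
  { intros n. rewrite sum_n_const. lra. }
  assert (h1 : l2_norm (b (l2_basis 0)) <= 0).
  { apply (seminorm_series (fun T => l2_norm (T (l2_basis 0))) _ 0 _ (fun _ => 0) b
      (seminorm_vec _) (l2_norm_ge0 _) hb); [|exact s0].
    intros n. change (l2_norm (op_pow _ V n (M (Z.of_nat n) (l2_basis 0))) <= 0).
    rewrite (proj1 (hM (Z.of_nat n)) : M (Z.of_nat n) (l2_basis 0) = zero), op_zero_apply.
    right. exact (@norm_zero C_AbsRing l2_NormedModule). }
  assert (h2 : l2_norm (c (l2_basis 0)) <= 0).
  { apply (seminorm_series (fun T => l2_norm (T (l2_basis 0))) _ 0 _ (fun _ => 0) c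
      (seminorm_vec _) (l2_norm_ge0 _) hc); [|exact s0].
    intros n. change (l2_norm (M (- Z.of_nat (S n))%Z (op_pow _ W (S n) (l2_basis 0))) <= 0).
    rewrite W0, (proj1 (hM (- Z.of_nat (S n))%Z) : M _ (l2_basis 0) = zero).
    right. exact (@norm_zero C_AbsRing l2_NormedModule). }
  eapply Rle_trans; [exact (Rplus_le_compat _ _ _ _ h1 h2)|lra]. }
intros j. destruct (rapid_decay_bound F j (j + 2) hrd) as [C0 [hC0 hF]].
(* Two series, each at most [2 * C0] because the inverse squares sum to at most 2. *)
exists (4 * C0). split; [lra|]. intros m p hp.
destruct (Zs_repr_ex s p hs) as [x hx].
assert (hxu : Zs_units s x) by now apply (repr_zunit s hs x p hx).
assert (FP : forall n i, (m <= i + n)%nat ->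
   Cmod (F (Z.of_nat n) (i, x)) <= C0 * / (1 + INR m) ^ j * / (1 + INR n) ^ 2).
{ intros n i hi. eapply Rle_trans; [apply hF, hxu|].
  rewrite <- INR_IZR_INZ, (Rabs_pos_eq (INR n)) by apply pos_INR.
  rewrite Rmult_assoc. apply Rmult_le_compat_l; [exact hC0|now apply decay_shift]. }
assert (FN : forall n i, (m <= i + S n)%nat ->
   Cmod (F (- Z.of_nat (S n))%Z (i, x)) <= C0 * / (1 + INR m) ^ j * / (1 + INR n) ^ 2).
{ intros n i hi. eapply Rle_trans; [apply hF, hxu|].
  rewrite opp_IZR, Rabs_Ropp, <- INR_IZR_INZ, (Rabs_pos_eq (INR (S n))) by apply pos_INR.
  rewrite Rmult_assoc. apply Rmult_le_compat_l; [exact hC0|].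
  eapply Rle_trans; [apply (decay_shift m (S n) i j hi)|].
  apply Rmult_le_compat_l; [left; apply pinv|].
  apply Rinv_le_contravar; [apply pow_lt; generalize (pos_INR n); lra|].
  apply pow_incr. rewrite S_INR. generalize (pos_INR n). lra. }
assert (hpm := pinv m j).
assert (hCm : 0 <= C0 * / (1 + INR m) ^ j) by (apply Rmult_le_pos; lra).
assert (sc : forall t n, 0 <= t -> sum_n (fun n => (C0 * / (1 + INR m) ^ j * t) * / (1 + INR n) ^ 2) n
   <= 2 * (C0 * / (1 + INR m) ^ j * t)).
{ intros t n ht. apply sum_scal_inv_sq. now apply Rmult_le_pos. }
split.
- intros v. assert (hv := l2_norm_ge0 v).
  eapply Rle_trans; [apply (proj1 (seminorm_coord v (pw m * p)))|].
  assert (h1 : Cmod (coord (b v) (pw m * p)) <= 2 * (C0 * / (1 + INR m) ^ j * l2_norm v)).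
  { apply (seminorm_series (fun T => Cmod (coord (T v) (pw m * p))) _ _ _ _ b
      (seminorm_coord _ _) hv hb) with (2 := fun n => sc (l2_norm v) n hv).
    intros n.
    change (Cmod (coord (op_pow _ V n (M (Z.of_nat n) v)) (pw m * p)) <=
      C0 * / (1 + INR m) ^ j * l2_norm v * / (1 + INR n) ^ 2).
    (* Row [m] of the [n]-th term reads [F n] at level [m - n]; for [n > m] the row is 0, since
       every index in the range of the [n]-th power of [V] is divisible by [s^n]. *)
    destruct (Nat.le_gt_cases n m) as [hnm|hnm].
    - replace (pw m * p)%Z with (pw n * (pw (m - n) * p))%Z
        by (rewrite Z.mul_assoc, <- pw_plus; f_equal; f_equal; lia).
      rewrite (shift_pow_coord V n _ _ hV), (is_mult0_coord _ _ _ _ x _ (hM _) hx hxu), Cmod_mult.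
      generalize (FP n (m - n)%nat ltac:(lia)) (coord_le v (pw (m - n) * p)).
      intros f1 f2.
      replace (C0 * / (1 + INR m) ^ j * l2_norm v * / (1 + INR n) ^ 2)
        with (C0 * / (1 + INR m) ^ j * / (1 + INR n) ^ 2 * l2_norm v) by ring.
      apply Rmult_le_compat; auto using Cmod_ge_0.
    - rewrite (shift_pow_coord_out V n _ _ hV), Cmod_0 by now apply pw_not_divide.
      repeat apply Rmult_le_pos; auto; try lra; left; apply pinv. }
  assert (h2 : Cmod (coord (c v) (pw m * p)) <= 2 * (C0 * / (1 + INR m) ^ j * l2_norm v)).
  { apply (seminorm_series (fun T => Cmod (coord (T v) (pw m * p))) _ _ _ _ c
      (seminorm_coord _ _) hv hc) with (2 := fun n => sc (l2_norm v) n hv).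
    intros n.
    change (Cmod (coord (M (- Z.of_nat (S n))%Z (op_pow _ W (S n) v)) (pw m * p)) <=
      C0 * / (1 + INR m) ^ j * l2_norm v * / (1 + INR n) ^ 2).
    rewrite (is_mult0_coord _ _ _ _ x _ (hM _) hx hxu), Cmod_mult.
    generalize (FN n m ltac:(lia)) (coord_le (op_pow _ W (S n) v) (pw m * p)) (Wn (S n) v).
    intros f1 f2 f3.
    replace (C0 * / (1 + INR m) ^ j * l2_norm v * / (1 + INR n) ^ 2)
      with (C0 * / (1 + INR m) ^ j * / (1 + INR n) ^ 2 * l2_norm v) by ring.
    apply Rmult_le_compat; auto using Cmod_ge_0. lra. }
  eapply Rle_trans; [exact (Rplus_le_compat _ _ _ _ h1 h2)|lra].
- assert (hE : forall l, 0 <= l2_norm (l2_basis l) <= 1).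
  { intros l. split; [apply l2_norm_ge0|apply l2_basis_norm]. }
  eapply Rle_trans; [apply (proj1 (seminorm_vec (l2_basis (pw m * p))))|].
  assert (h1 : l2_norm (b (l2_basis (pw m * p))) <= 2 * (C0 * / (1 + INR m) ^ j * 1)).
  { apply (seminorm_series (fun T => l2_norm (T (l2_basis (pw m * p)))) _ _ _ _ b
      (seminorm_vec _) (l2_norm_ge0 _) hb) with (2 := fun n => sc 1 n Rle_0_1).
    intros n.
    change (l2_norm (op_pow _ V n (M (Z.of_nat n) (l2_basis (pw m * p)))) <=
      C0 * / (1 + INR m) ^ j * 1 * / (1 + INR n) ^ 2).
    eapply Rle_trans; [apply Vn|].
    rewrite (is_mult0_basis _ _ m p x (hM _) hx hxu).
    eapply Rle_trans; [apply (l2_norm_scal (F (Z.of_nat n) (m, x)) (l2_basis (pw m * p)))|].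
    generalize (FP n m ltac:(lia)) (hE (pw m * p)%Z) (Cmod_ge_0 (F (Z.of_nat n) (m, x))).
    intros f1 f2 f3. nra. }
  assert (h2 : l2_norm (c (l2_basis (pw m * p))) <= 2 * (C0 * / (1 + INR m) ^ j * 1)).
  { apply (seminorm_series (fun T => l2_norm (T (l2_basis (pw m * p)))) _ _ _ _ c
      (seminorm_vec _) (l2_norm_ge0 _) hc) with (2 := fun n => sc 1 n Rle_0_1).
    intros n.
    change (l2_norm (M (- Z.of_nat (S n))%Z (op_pow _ W (S n) (l2_basis (pw m * p)))) <=
      C0 * / (1 + INR m) ^ j * 1 * / (1 + INR n) ^ 2).
    (* The adjoint of the shift lowers the level of a basis vector by one and kills level 0. *)
    destruct (Nat.le_gt_cases (S n) m) as [hnm|hnm].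
    - assert (e : op_pow _ W (S n) (l2_basis (pw m * p)) = l2_basis (pw (m - S n) * p)).
      { apply l2_ext. intros k.
        change (coord (op_pow _ W (S n) (l2_basis (pw m * p))) k = coord (l2_basis (pw (m - S n) * p)) k).
        rewrite (adjoint_pow_coord V W _ _ k hV hW), !coord_basis.
        replace (pw m * p)%Z with (pw (S n) * (pw (m - S n) * p))%Z
          by (rewrite Z.mul_assoc, <- pw_plus; f_equal; f_equal; lia).
        generalize (pw_pos s hs (S n)). intros hpp.
        destruct (Z.eqb_spec (pw (S n) * k) (pw (S n) * (pw (m - S n) * p))) as [e|e];
          destruct (Z.eqb_spec k (pw (m - S n) * p)) as [e'|e']; try reflexivity; exfalso; nia. }
      rewrite e, (is_mult0_basis _ _ (m - S n) p x (hM _) hx hxu).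
      eapply Rle_trans; [apply (l2_norm_scal (F (- Z.of_nat (S n))%Z ((m - S n)%nat, x)) (l2_basis (pw (m - S n) * p)))|].
      generalize (FN n (m - S n)%nat ltac:(lia)) (hE (pw (m - S n) * p)%Z)
        (Cmod_ge_0 (F (- Z.of_nat (S n))%Z ((m - S n)%nat, x))).
      intros f1 f2 f3. nra.
    - assert (e : op_pow _ W (S n) (l2_basis (pw m * p)) = zero).
      { apply l2_ext. intros k.
        change (coord (op_pow _ W (S n) (l2_basis (pw m * p))) k = 0%C).
        rewrite (adjoint_pow_coord V W _ _ k hV hW), coord_basis.
        destruct (Z.eqb_spec (pw (S n) * k) (pw m * p)) as [e|e]; [|reflexivity].
        exfalso. apply (pw_not_divide m (S n) p hp hnm). exists k. rewrite <- e. ring. }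
      rewrite e, op_zero_apply.
      eapply Rle_trans; [right; exact (@norm_zero C_AbsRing l2_NormedModule)|].
      repeat apply Rmult_le_pos; auto; try lra; left; apply pinv. }
  eapply Rle_trans; [exact (Rplus_le_compat _ _ _ _ h1 h2)|lra].
Qed.

End Shift.

(** * Resolvents and the holomorphic calculus *)

Lemma is_RInt_functional (V : NormedModule R_AbsRing) (L : V -> R) (g : R -> V) (I : V) :
  @is_linear R_AbsRing V R_NormedModule L -> is_RInt g 0 1 I -> is_RInt (fun t => L (g t)) 0 1 (L I).
Proof.
intros hL h.
assert (hs : forall ptd, Riemann_sum (fun t => L (g t)) ptd = L (Riemann_sum g ptd)).
{ intros ptd. apply (SF_cons_ind (fun ptd => Riemann_sum (fun t => L (g t)) ptd = L (Riemann_sum g ptd))).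
  - intros x. symmetry. exact (linear_zero L hL).
  - intros h0 s IH. rewrite !Riemann_sum_cons, IH, (linear_plus L hL), (linear_scal L hL). reflexivity. }
unfold is_RInt in *.
apply (filterlim_ext (fun ptd => L (scal (sign (1 - 0)) (Riemann_sum g ptd)))).
- intros ptd. rewrite hs, (linear_scal L hL). reflexivity.
- apply (filterlim_comp _ _ _ _ L _ _ _ h). exact (linear_cont L I hL).
Qed.

Section Functional.

Context (E : NormedModule C_AbsRing) (ell : E -> C) (hl : @is_linear C_AbsRing E C_NormedModule ell).

Lemma functional_re : @is_linear R_AbsRing (realify E) R_NormedModule (fun x => Re (ell x)).
Proof.
destruct hl as [h1 h2 [K [hK h3]]]. constructor.
- intros x y. rewrite (h1 x y : ell (plus x y) = _). reflexivity.
- intros k x. change (Re (ell (scal (RtoC k) x)) = k * Re (ell x)).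
  rewrite h2. change (Re (RtoC k * ell x)%C = k * Re (ell x)). unfold Re; simpl; ring.
- exists K. split; [exact hK|]. intros x. eapply Rle_trans; [apply re_le_Cmod|apply h3].
Qed.

Lemma functional_im : @is_linear R_AbsRing (realify E) R_NormedModule (fun x => Im (ell x)).
Proof.
destruct hl as [h1 h2 [K [hK h3]]]. constructor.
- intros x y. rewrite (h1 x y : ell (plus x y) = _). reflexivity.
- intros k x. change (Im (ell (scal (RtoC k) x)) = k * Im (ell x)).
  rewrite h2. change (Im (RtoC k * ell x)%C = k * Im (ell x)). unfold Im; simpl; ring.
- exists K. split; [exact hK|]. intros x. eapply Rle_trans; [apply im_le_Cmod|apply h3].
Qed.

Definition path_integrable (phi : C -> C) (G : contour) : Prop :=
  forall p q, In (p, q) G -> cintegrable (fun t => (q - p) * phi (segment p q t))%C.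

(** Reduces operator-valued contour integrals to scalar ones, via the functionals
    [T -> coord (T u) k]. Integrability is returned as well, because the scalar integrand is not
    known to be continuous. *)
Lemma contour_int_functional (phi : C -> E) (G : contour) (J : E) :
  is_contour_int phi G J ->
  ell J = path_int (fun z => ell (phi z)) G /\ path_integrable (fun z => ell (phi z)) G.
Proof.
revert J. induction G as [|[p q] G IH]; intros J hJ.
- simpl in hJ. subst J. split; [exact (linear_zero ell hl)|intros p q []].
- destruct hJ as (J1 & J2 & h1 & h2 & ->). destruct (IH J2 h2) as [e2 i2].
  assert (hre := is_RInt_functional _ _ _ _ functional_re h1).
  assert (him := is_RInt_functional _ _ _ _ functional_im h1).
  assert (hsc : forall t, ell (scal (q - p)%C (phi (segment p q t)))
     = ((q - p) * ell (phi (segment p q t)))%C) by (intros t; apply (linear_scal ell hl)).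
  assert (hre' : is_RInt (fun t => Re ((q - p) * ell (phi (segment p q t)))%C) 0 1 (Re (ell J1))).
  { refine (is_RInt_ext _ _ _ _ _ _ hre). intros t _. exact (f_equal Re (hsc t)). }
  assert (him' : is_RInt (fun t => Im ((q - p) * ell (phi (segment p q t)))%C) 0 1 (Im (ell J1))).
  { refine (is_RInt_ext _ _ _ _ _ _ him). intros t _. exact (f_equal Im (hsc t)). }
  split.
  + rewrite (linear_plus ell hl), e2.
    change (plus (ell J1) (path_int (fun z => ell (phi z)) G))
      with (ell J1 + path_int (fun z => ell (phi z)) G)%C.
    simpl path_int. f_equal. unfold seg_int, cint.
    rewrite (surjective_pairing (ell J1)).
    exact (f_equal2 pair (eq_sym (is_RInt_unique _ _ _ _ hre')) (eq_sym (is_RInt_unique _ _ _ _ him'))).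
  + intros p' q' [e|hin]; [|now apply i2]. injection e as <- <-.
    split; eexists; eassumption.
Qed.

End Functional.

Lemma path_cont_integrable (phi : C -> C) (G : contour) : path_cont phi G -> path_integrable phi G.
Proof.
intros h p q hin. apply seg_cintegrable. intros t ht. apply h. exists p, q, t. auto.
Qed.

Lemma path_integrable_tl (phi : C -> C) (pq : C * C) (G : contour) :
  path_integrable phi (pq :: G) -> path_integrable phi G.
Proof. intros h p q hin. apply h. now right. Qed.

Lemma path_int_minus_le (phi psi : C -> C) (G : contour) (M : R) :
  path_integrable phi G -> path_integrable psi G ->
  (forall z, on_contour G z -> Cmod (phi z - psi z) <= M) ->
  Cmod (path_int phi G - path_int psi G) <= 2 * (path_length G * M).
Proof.
induction G as [|[p q] G IH]; intros h1 h2 hM; simpl.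
- rewrite Cmod_minus_self. lra.
- replace (seg_int phi p q + path_int phi G - (seg_int psi p q + path_int psi G))%C
    with ((seg_int phi p q - seg_int psi p q) + (path_int phi G - path_int psi G))%C by ring.
  eapply Rle_trans; [apply Cmod_triangle|].
  assert (a2 : Cmod (path_int phi G - path_int psi G) <= 2 * (path_length G * M)).
  { apply IH; eauto using path_integrable_tl. intros z hz. now apply hM, on_contour_tl. }
  assert (i1 := h1 p q (or_introl eq_refl)). assert (i2 := h2 p q (or_introl eq_refl)).
  assert (a1 : Cmod (seg_int phi p q - seg_int psi p q) <= 2 * (Cmod (q - p) * M)).
  { unfold seg_int.
    assert (i3 := cintegrable_scal (- (1))%C _ i2). cbv beta in i3.
    replace (cint (fun t => (q - p) * phi (segment p q t))%C - cint (fun t => (q - p) * psi (segment p q t))%C)%C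
      with (cint (fun t => (q - p) * phi (segment p q t) + - (1) * ((q - p) * psi (segment p q t)))%C)
      by (rewrite (cint_plus _ _ i1 i3), (cint_scal _ _ i2); ring).
    apply cint_le; [|now apply cintegrable_plus]. intros t ht.
    replace ((q - p) * phi (segment p q t) + - (1) * ((q - p) * psi (segment p q t)))%C
      with ((q - p) * (phi (segment p q t) - psi (segment p q t)))%C by ring.
    rewrite Cmod_mult. apply Rmult_le_compat_l; [apply Cmod_ge_0|]. now apply hM, on_contour_hd. }
  lra.
Qed.

Lemma is_RInt_closed (E : NormedModule C_AbsRing) (A : E -> Prop) (g : R -> E) (J : E) :
  A zero -> (forall x y, A x -> A y -> A (plus x y)) -> (forall (c : C) x, A x -> A (scal c x)) ->
  closed A -> (forall t, 0 <= t <= 1 -> A (g t)) -> @is_RInt (realify E) g 0 1 J -> A J.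
Proof.
intros h0 hp hs hc hg hJ.
(* Extended by [zero], the integrand takes values in [A] everywhere, so every Riemann sum lies in
   [A] and the tags need not be followed. *)
set (g' := fun t => if excluded_middle_informative (0 <= t <= 1) then g t else zero).
assert (hg' : forall t, A (g' t)).
{ intros t. unfold g'. destruct (excluded_middle_informative _); auto. }
assert (hJ' : @is_RInt (realify E) g' 0 1 J).
{ apply (@is_RInt_ext (realify E) g); [|exact hJ]. intros t ht.
  rewrite Rmin_left, Rmax_right in ht by lra.
  unfold g'. destruct (excluded_middle_informative _) as [|n]; [reflexivity|]. exfalso. apply n. lra. }
apply hc. intros hloc. specialize (hJ' _ hloc).
assert (hRS : forall ptd, A (@Riemann_sum (realify E) g' ptd)).
{ intros ptd. apply (SF_cons_ind (fun ptd => A (@Riemann_sum (realify E) g' ptd))).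
  - intros x. exact h0.
  - intros h s IH. rewrite Riemann_sum_cons. apply hp; [|exact IH]. apply hs, hg'. }
destruct (@filter_ex _ (Riemann_fine 0 1) _ _ hJ') as [ptd hptd].
apply hptd, (hs (RtoC (sign (1 - 0)))), hRS.
Qed.

Lemma contour_int_closed (E : NormedModule C_AbsRing) (A : E -> Prop) (phi : C -> E) (G : contour) (J : E) :
  A zero -> (forall x y, A x -> A y -> A (plus x y)) -> (forall (c : C) x, A x -> A (scal c x)) ->
  closed A -> (forall z, on_contour G z -> A (phi z)) -> is_contour_int phi G J -> A J.
Proof.
intros h0 hp hs hc. revert J. induction G as [|[p q] G IH]; intros J hG hJ.
- simpl in hJ. now subst J.
- destruct hJ as (J1 & J2 & h1 & h2 & ->). apply hp.
  + apply (is_RInt_closed E A (fun t => scal (q - p)%C (phi (segment p q t)))); auto.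
    intros t ht. apply hs, hG. now apply on_contour_hd.
  + apply IH; [|exact h2]. intros z hz. now apply hG, on_contour_tl.
Qed.

Lemma HS_contour_int (s : nat) (phi : C -> BH) (G : contour) (J : BH) :
  (forall z, on_contour G z -> HS s (phi z)) -> is_contour_int phi G J -> HS s J.
Proof.
intros h hJ A hA hV hM.
apply (contour_int_closed (op_NormedModule l2_NormedModule) A phi G J); auto.
- apply hA.
- apply (Cstar_plus A hA).
- apply (Cstar_scal A hA).
- apply (Cstar_closed A hA).
- intros z hz. now apply (h z hz).
Qed.

Lemma HS_scal (s : nat) (c : C) (T : BH) : HS s T -> HS s (scal c T).
Proof. intros h A hA hV hM. apply (Cstar_scal A hA). now apply h. Qed.

(** A supremum argument for functions that need not be continuous: near a point, the norm of the
    resolvent is only known to be bounded. *)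
Lemma locally_bounded_bounded (g : R -> R) :
  (forall t, 0 <= t <= 1 -> exists d B, 0 < d /\ forall x, 0 <= x <= 1 -> Rabs (x - t) < d -> g x <= B) ->
  exists B, forall t, 0 <= t <= 1 -> g t <= B.
Proof.
intros h.
set (E := fun x => 0 <= x <= 1 /\ exists B, forall t, 0 <= t <= x -> g t <= B).
assert (h0 : E 0).
{ split; [lra|]. exists (g 0). intros t ht. replace t with 0 by lra. lra. }
destruct (completeness E) as [c [hub hleast]].
- exists 1. intros x [hx _]. lra.
- exists 0. exact h0.
- assert (hc : 0 <= c <= 1).
  { split; [now apply hub|]. apply hleast. intros x [hx _]. lra. }
  destruct (h c hc) as (d & B & hd & hB).
  assert (hx : exists x, E x /\ c - d < x).
  { apply NNPP. intros hn. assert (c <= c - d); [|lra]. apply hleast. intros x hx.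
    apply Rnot_lt_le. intros hlt. apply hn. now exists x. }
  destruct hx as (x & [hx1 [B' hB']] & hx2).
  assert (hEB : forall t, 0 <= t <= 1 -> t < c + d -> g t <= Rmax B B').
  { intros t ht htd. destruct (Rle_dec t x) as [htx|htx].
    - eapply Rle_trans; [apply hB'; lra|apply Rmax_r].
    - eapply Rle_trans; [apply hB; [exact ht|]|apply Rmax_l]. apply Rabs_lt_between. lra. }
  destruct (Rlt_dec 1 (c + d)) as [h1|h1].
  + exists (Rmax B B'). intros t ht. apply hEB; [exact ht|lra].
  + exfalso. assert (hE : E (c + d / 2)).
    { split; [lra|]. exists (Rmax B B'). intros t ht. apply hEB; lra. }
    generalize (hub _ hE). lra.
Qed.

Lemma resolvent_apply (s : nat) (a : BH) (z : C) (r : BH) : is_resolvent s a z r ->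
  (forall u k, (z * coord (r u) k - coord (a (r u)) k = coord u k)%C) /\
  (forall u k, (z * coord (r u) k - coord (r (a u)) k = coord u k)%C).
Proof.
intros (_ & h1 & h2). split; intros u k.
- assert (e := f_equal (fun T : BH => coord (T u) k) h1). simpl in e.
  exact (eq_trans (eq_sym (coord_minus (scal z (r u)) (a (r u)) k)) e).
- assert (e := f_equal (fun T : BH => coord (T u) k) h2).
  change (coord (r (minus (scal z u : l2) (a u))) k = coord u k) in e.
  rewrite <- e, op_minus_arg, coord_minus, op_scal_apply, coord_scal. reflexivity.
Qed.

Lemma resolvent_near (s : nat) (a : BH) (z z0 : C) (r r0 : BH) :
  is_resolvent s a z r -> is_resolvent s a z0 r0 ->
  Cmod (z - z0) * opnorm r0 <= / 2 -> opnorm r <= 2 * opnorm r0.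
Proof.
intros h h0 hz.
(* The resolvent identity. Its last term has norm at most half that of [r], by nearness of [z], and
   is absorbed on the left. *)
assert (E : r = op_plus _ r0 (op_scal _ (z0 - z)%C (op_mult _ r0 r))).
{ apply op_coord_eq. intros u k.
  change (coord (r u) k = coord (r0 u) k + (z0 - z) * coord (r0 (r u)) k)%C.
  assert (e1 := proj2 (resolvent_apply s a z0 r0 h0) (r u) k).
  assert (e2 : a (r u) = minus (scal z (r u) : l2) u).
  { apply l2_ext. intros j. change (coord (a (r u)) j = coord (minus (scal z (r u) : l2) u) j).
    rewrite coord_minus, coord_scal. rewrite <- (proj1 (resolvent_apply s a z r h) u j). ring. }
  rewrite e2, op_minus_arg, coord_minus, op_scal_apply, coord_scal in e1.
  rewrite <- e1. ring. }
assert (hn : opnorm r <= opnorm r0 + Cmod (z0 - z) * (opnorm r0 * opnorm r)).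
{ rewrite E at 1. eapply Rle_trans; [apply op_norm_triangle|]. apply Rplus_le_compat_l.
  eapply Rle_trans; [apply op_norm_scal|]. apply Rmult_le_compat_l; [apply Cmod_ge_0|apply opnorm_mult]. }
rewrite Cmod_minus_sym in hn. generalize (op_norm_ge0 l2_NormedModule r). nra.
Qed.

Lemma resolvent_bounded (s : nat) (a : BH) (r : C -> BH) (G : contour) :
  (forall z, on_contour G z -> is_resolvent s a z (r z)) ->
  exists B, 0 <= B /\ forall z, on_contour G z -> opnorm (r z) <= B.
Proof.
induction G as [|[p q] G IH]; intros h.
- exists 0. split; [lra|]. intros z (p & q & t & [] & _).
- destruct IH as [B1 [h1 H1]]; [intros z hz; now apply h, on_contour_tl|].
  destruct (locally_bounded_bounded (fun t => opnorm (r (segment p q t)))) as [B2 H2].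
  { intros t ht. assert (hn := op_norm_ge0 l2_NormedModule (r (segment p q t))).
    destruct (segment_near p q t (/ (2 * (opnorm (r (segment p q t)) + 1)))) as [d [hd Hd]].
    { apply Rinv_0_lt_compat. lra. }
    exists d, (2 * opnorm (r (segment p q t))). split; [exact hd|]. intros x hx hxt.
    apply (resolvent_near s a (segment p q x) (segment p q t)); [now apply h, on_contour_hd|now apply h, on_contour_hd|].
    specialize (Hd x hxt). set (n := opnorm (r (segment p q t))) in *.
    apply Rle_trans with (/ (2 * (n + 1)) * n); [apply Rmult_le_compat_r; lra|].
    replace (/ (2 * (n + 1)) * n) with (/ 2 * (n / (n + 1))) by (field; lra).
    rewrite <- (Rmult_1_r (/ 2)) at 2. apply Rmult_le_compat_l; [lra|]. apply Rle_div_l; lra. }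
  exists (Rmax B1 B2). split; [eapply Rle_trans; [exact h1|apply Rmax_l]|].
  intros z (p' & q' & t & [e|hin] & ht & ->).
  + injection e as <- <-. eapply Rle_trans; [apply H2, ht|apply Rmax_r].
  + eapply Rle_trans; [apply H1; exists p', q', t; auto|apply Rmax_l].
Qed.

Lemma ex_derive_cdiff (f : C -> C) (z : C) : @ex_derive C_AbsRing C_NormedModule f z -> cdiff f z.
Proof.
intros [l [_ h]]. exists l. intros eps heps.
destruct (h z (fun P hP => hP) (mkposreal eps heps)) as [d hd].
exists d. split; [apply cond_pos|]. intros w hw.
specialize (hd w hw).
replace (f w - f z - l * (w - z))%C with (f w - f z - (w - z) * l)%C by ring. exact hd.
Qed.

Lemma open_copen (U : C -> Prop) : @open C_UniformSpace U -> copen U.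
Proof.
intros h z hz. destruct (h z hz) as [d hd]. exists d. split; [apply cond_pos|].
intros w hw. apply hd. split.
- eapply Rle_lt_trans; [|exact hw]. apply (re_le_Cmod (w - z)).
- eapply Rle_lt_trans; [|exact hw]. apply (im_le_Cmod (w - z)).
Qed.

Lemma functional_id : @is_linear C_AbsRing C_NormedModule C_NormedModule (fun z => z).
Proof. apply is_linear_id. Qed.

Lemma functional_coord (u : l2) (k : Z) :
  @is_linear C_AbsRing (op_NormedModule l2_NormedModule) C_NormedModule (fun T : BH => coord (T u) k).
Proof.
constructor; [reflexivity|reflexivity|].
exists (l2_norm u + 1). assert (h := l2_norm_ge0 u). split; [lra|]. intros T.
change (Cmod (coord ((T : BH) u) k) <= (l2_norm u + 1) * opnorm T).
generalize (coord_op_le T u k) (op_norm_ge0 l2_NormedModule T). nra.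
Qed.

Section Calculus.

Context (s : nat) (hs : (2 <= s)%nat) (a b : BH) (U : C -> Prop) (f : C -> C)
  (a0 : a (l2_basis 0) = zero)
  (hU : @open C_UniformSpace U) (hspec : forall z, spectrum s a z -> U z)
  (hf : forall z, U z -> @ex_derive C_AbsRing C_NormedModule f z)
  (hf0 : f (RtoC 0) = RtoC 0) (hb : is_holo_calc s a U f b).

(** An inverse of [0 - a] would send [a E_0 = 0] to [- E_0]. This keeps 0 off the contour and inside
    [U], where [f] is defined. *)
Lemma zero_in_spectrum : spectrum s a 0.
Proof.
intros [r hr]. assert (e := proj2 (resolvent_apply s a 0 r hr) (l2_basis 0) 0%Z).
rewrite a0, op_zero_apply, coord_zero, coord_basis, Z.eqb_refl in e.
replace (0 * coord (r (l2_basis 0)) 0%Z - 0)%C with (RtoC 0) in e by ring.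
apply RtoC_inj in e. lra.
Qed.

(** The hypothesis bounds an entry of [z r(z) - 1]; the missing factor is [f(z) / z], bounded on the
    contour. [K] collects the length of the contour, that bound and the bound for the resolvent, and
    is the same for all entries. *)
Lemma holo_calc_entries : exists K, 0 <= K /\ forall l k B,
  (forall r z, is_resolvent s a z r ->
    Cmod (z * coord (r (l2_basis l)) k - coord (l2_basis l) k) <= B * opnorm r) ->
  0 <= B -> Cmod (coord (b (l2_basis l)) k) <= K * B.
Proof.
destruct hb as (G & r & J & (hG & hon & _ & hout) & hr & hJ & ->).
destruct (resolvent_bounded s a r G hr) as [Br [hBr Hr]].
assert (h0G : forall z, on_contour G z -> z <> 0%C).
{ intros z hz ->. now apply (proj2 (hon _ hz)), zero_in_spectrum. }
assert (hcd : forall z, on_contour G z -> cdiff (fun z => f z / z)%C z).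
{ intros z hz. apply (cdiff_div f (fun z => z)); [apply ex_derive_cdiff, hf, hon, hz|apply cdiff_id|auto]. }
(* Cauchy's formula at the point 0, whose right-hand side has the factor [f 0 = 0]. *)
assert (hcauchy : path_int (fun z => f z / z)%C G = 0%C).
{ assert (h := cauchy_homology f U G (open_copen U hU) (fun z hz => ex_derive_cdiff f z (hf z hz)) hG
    (fun z hz => proj1 (hon z hz))).
  transitivity (path_int (fun z => f z / (z - 0))%C G).
  - apply path_int_ext. intros z _. f_equal. ring.
  - rewrite h.
    + rewrite hf0. ring.
    + intros z hz.
      destruct (contour_int_functional C_NormedModule (fun z => z) functional_id _ _ _ (hout z hz)) as [e _].
      symmetry. exact e.
    + apply hspec, zero_in_spectrum.
    + intros h0. now apply (h0G _ h0). }
destruct (path_bounded (fun z => f z / z)%C G) as [Mf [hMf HMf]].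
{ intros z hz. now apply cdiff_ccont, hcd. }
assert (hL := path_length_ge0 G).
exists (/ Cmod two_pi_i * (2 * (path_length G * (Mf * Br)))).
assert (h2 := two_pi_i_pos).
assert (hi : 0 < / Cmod two_pi_i) by now apply Rinv_0_lt_compat.
assert (hMB : 0 <= Mf * Br) by (apply Rmult_le_pos; lra).
split. { apply Rmult_le_pos; [lra|]. apply Rmult_le_pos; [lra|]. now apply Rmult_le_pos. }
intros l k B hB hB0.
destruct (contour_int_functional _ _ (functional_coord (l2_basis l) k) _ _ _ hJ) as [eJ iJ].
assert (eb : coord ((scal (/ two_pi_i)%C J : BH) (l2_basis l)) k = (/ two_pi_i * coord (J (l2_basis l)) k)%C)
  by reflexivity.
rewrite eb, Cmod_mult, Cmod_inv by apply two_pi_i_neq_0.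
rewrite Rmult_assoc. apply Rmult_le_compat_l; [lra|].
set (dl := coord (l2_basis l) k) in *.
assert (hd : path_int (fun z => dl * (f z / z))%C G = 0%C).
{ rewrite path_int_scal, hcauchy; [ring|]. intros z hz. now apply cdiff_ccont, hcd. }
(* Subtracting an integral that is 0 removes the scalar part [1 / z] of the resolvent. *)
replace (coord (J (l2_basis l)) k) with (coord (J (l2_basis l)) k - path_int (fun z => dl * (f z / z)) G)%C
  by (rewrite hd; ring).
rewrite (eJ : coord (J (l2_basis l)) k = _).
eapply Rle_trans; [apply (path_int_minus_le _ _ G (Mf * Br * B))|].
- exact iJ.
- apply path_cont_integrable. intros z hz. apply ccont_scal. now apply cdiff_ccont, hcd.
- intros z hz. specialize (hB (r z) z (hr z hz)).
  change (Cmod (f z * coord (r z (l2_basis l)) k - dl * (f z / z)) <= Mf * Br * B).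
  replace (f z * coord (r z (l2_basis l)) k - dl * (f z / z))%C
    with (f z / z * (z * coord (r z (l2_basis l)) k - dl))%C by (field; now apply h0G).
  rewrite Cmod_mult, Rmult_assoc. apply Rmult_le_compat; auto using Cmod_ge_0.
  eapply Rle_trans; [exact hB|]. rewrite Rmult_comm. apply Rmult_le_compat_r; auto.
- right. ring.
Qed.

(** In [z r - 1 = a r] the row [k] of [a] stands on the left, so its bound survives. *)
Lemma holo_calc_row : exists K, 0 <= K /\ forall k B, 0 <= B ->
  (forall v, Cmod (coord (a v) k) <= B * l2_norm v) ->
  forall l, Cmod (coord (b (l2_basis l)) k) <= K * B.
Proof.
destruct holo_calc_entries as [K [hK H]]. exists K. split; [exact hK|].
intros k B hB ha l. apply H; [|exact hB]. intros r z hr.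
rewrite <- (proj1 (resolvent_apply s a z r hr) (l2_basis l) k).
match goal with |- Cmod ?x <= _ => replace x with (coord (a (r (l2_basis l))) k) by ring end.
eapply Rle_trans; [apply ha|]. apply Rmult_le_compat_l; [exact hB|].
eapply Rle_trans; [apply op_norm_apply|].
generalize (op_norm_ge0 l2_NormedModule r) (l2_basis_norm l). nra.
Qed.

(** In [z r - 1 = r a] the column [l] of [a] is hit first, and [r] costs only its norm. *)
Lemma holo_calc_col : exists K, 0 <= K /\ forall l B, 0 <= B -> l2_norm (a (l2_basis l)) <= B ->
  forall k, Cmod (coord (b (l2_basis l)) k) <= K * B.
Proof.
destruct holo_calc_entries as [K [hK H]]. exists K. split; [exact hK|].
intros l B hB ha k. apply H; [|exact hB]. intros r z hr.
rewrite <- (proj2 (resolvent_apply s a z r hr) (l2_basis l) k).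
match goal with |- Cmod ?x <= _ => replace x with (coord (r (a (l2_basis l))) k) by ring end.
eapply Rle_trans; [apply coord_op_le|]. rewrite Rmult_comm.
apply Rmult_le_compat_r; [apply op_norm_ge0|exact ha].
Qed.

Lemma holo_calc_zero : b (l2_basis 0) = zero.
Proof.
destruct holo_calc_col as [K [hK H]]. apply l2_ext. intros k. apply Cmod_eq_0, Rle_antisym; [|apply Cmod_ge_0].
rewrite <- (Rmult_0_r K). apply H; [lra|]. rewrite a0.
right. exact (@norm_zero C_AbsRing l2_NormedModule).
Qed.

Lemma holo_calc_HS : HS s b.
Proof.
destruct hb as (G & r & J & _ & hr & hJ & ->). apply HS_scal.
apply (HS_contour_int s (fun z => scal (f z) (r z)) G J); [|exact hJ]. intros z hz. apply HS_scal. now apply hr.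
Qed.

End Calculus.

(** * Reconstruction of the symbols *)

Section Assembly.

Context (s : nat) (hs : (2 <= s)%nat).

Notation pw := (pw s).
Notation zunit := (zunit s).

(** * Compactness of finitely many levels of units *)

Lemma bounded_choice_list (I : Type) (Q : nat -> list I -> Prop) (m : nat) :
  (forall d l l', incl l l' -> Q d l -> Q d l') ->
  (forall d, (d < m)%nat -> exists l, Q d l) -> exists l, forall d, (d < m)%nat -> Q d l.
Proof.
intros hm. induction m as [|m IH]; intros h; [exists nil; intros; lia|].
destruct IH as [l1 h1]; [intros; apply h; lia|]. destruct (h m ltac:(lia)) as [l2 h2].
exists (l1 ++ l2). intros d hd. destruct (Nat.eq_dec d m) as [->|hne].
- apply (hm _ l2); [apply incl_appr, incl_refl|exact h2].
- apply (hm _ l1); [apply incl_appl, incl_refl|]. apply h1. lia.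
Qed.

Lemma open_agree (O : nat * Zs s -> Prop) (m : nat) (x : Zs s) :
  @open (nat_Zs_UniformSpace s) O -> O (m, x) ->
  exists n, forall y, agree s n x y -> O (m, y).
Proof.
intros hO hx. destruct (hO (m, x) hx) as [d hd].
destruct (inv_pow_small s hs d (cond_pos d)) as [n hn]. exists n. intros y hy.
apply hd. split; [reflexivity|]. exact (agree_ball s hs x y n d hn hy).
Qed.

Lemma units_slice_compact (m : nat) (I : Type) (O : I -> nat * Zs s -> Prop) :
  (forall i, @open (nat_Zs_UniformSpace s) (O i)) ->
  (forall x, Zs_units s x -> exists i, O i (m, x)) ->
  exists l : list I, forall x, Zs_units s x -> exists i, In i l /\ O i (m, x).
Proof.
intros hO hcov.
set (P := fun n x => exists l : list I, forall y, agree s n x y -> Zs_units s y ->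
   exists i, In i l /\ O i (m, y)).
assert (H : P 0%nat (Zs_zero s)).
{ apply Zs_bar_induction; unfold P.
  - intros n x y hxy [l hl]. exists l. intros z hz. apply hl. now apply (agree_trans s _ _ y).
  - intros n x h.
    destruct (bounded_choice_list I (fun d l => forall y, agree s (S n) (set_digit s x n d) y ->
        Zs_units s y -> exists i, In i l /\ O i (m, y)) s) as [l hl].
    + intros d l l' hll hl y hy hu. destruct (hl y hy hu) as (i & hi & hi'). exists i. split; auto.
    + intros d _. apply h, set_digit_agree_l.
    + exists l. intros y hy hu. apply (hl (y n)); [|now apply set_digit_agree|exact hu].
      generalize (digit_le s y n). lia.
  - intros x. destruct (classic (Zs_units s x)) as [hu|hu].
    + destruct (hcov x hu) as [i hi]. destruct (open_agree (O i) m x (hO i) hi) as [n hn].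
      exists n, (i :: nil). intros y hy _. exists i. split; [now left|auto].
    (* Being a unit depends on the first digit alone, so a cylinder of length 1 about a non-unit
       needs no cover. *)
    + exists 1%nat, nil. intros y hy hyu. exfalso. apply hu. unfold Zs_units in *.
      rewrite (hy 0%nat) by lia. exact hyu. }
destruct H as [l hl]. exists l. intros x hx. apply hl; [intros j hj; lia|exact hx].
Qed.

Lemma units_compact (m0 : nat) :
  @compact_set (nat_Zs_UniformSpace s) (fun p => (fst p < m0)%nat /\ Zs_units s (snd p)).
Proof.
intros I O hO hcov.
destruct (bounded_choice_list I (fun m l => forall x, Zs_units s x -> exists i, In i l /\ O i (m, x)) m0)
  as [l hl].
- intros m l l' hll hl x hu. destruct (hl x hu) as (i & hi & hi'). exists i. split; auto.
- intros m hm. apply units_slice_compact; [exact hO|]. intros x hx. now apply (hcov (m, x)).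
- exists l. intros [m x] [h1 h2]. now apply (hl m).
Qed.

Context (V W b : BH) (hV : is_shift s V) (hW : is_adjoint V W) (hb : HS s b)
  (hb0 : b (l2_basis 0) = zero)
  (hrow : forall j, exists C0, 0 <= C0 /\ forall m p l, zunit p ->
     Cmod (coord (b (l2_basis l)) (pw m * p)) <= C0 * / (1 + INR m) ^ j)
  (hcol : forall j, exists C0, 0 <= C0 /\ forall m p k, zunit p ->
     Cmod (coord (b (l2_basis (pw m * p))) k) <= C0 * / (1 + INR m) ^ j).

(** [m] is the smaller of the two levels on both sides of the diagonal. This matches the series,
    where the multiplication stands right of the powers of [V] and left of those of [W], and so
    always acts at the smaller level. *)
Definition diag_entry (n : Z) (m : nat) (p : Z) : C :=
  if (0 <=? n)%Z then entry s b (m + Z.abs_nat n) m p else entry s b m (m + Z.abs_nat n) p.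

(** The same diagonal indexed by all of [Z], 0 included, so that it can serve directly as the weight
    of a diagonal operator. *)
Definition diag_coef (n k : Z) : C :=
  if (0 <=? n)%Z then coord (b (l2_basis k)) (pw (Z.abs_nat n) * k)
  else coord (b (l2_basis (pw (Z.abs_nat n) * k))) k.

Lemma diag_coef_entry (n : Z) (m : nat) (p : Z) : diag_coef n (pw m * p) = diag_entry n m p.
Proof.
unfold diag_coef, diag_entry, entry.
replace (pw (Z.abs_nat n) * (pw m * p))%Z with (pw (m + Z.abs_nat n) * p)%Z; [reflexivity|].
rewrite Nat.add_comm, pw_plus. ring.
Qed.

Lemma diag_coef_0 (n : Z) : diag_coef n 0 = 0%C.
Proof. unfold diag_coef. rewrite Z.mul_0_r, hb0. now destruct (0 <=? n)%Z. Qed.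

Lemma INR_abs_nat (n : Z) : INR (Z.abs_nat n) = Rabs (IZR n).
Proof. rewrite INR_IZR_INZ, Zabs2Nat.id_abs, abs_IZR. reflexivity. Qed.

Lemma decay_split (m n j k : nat) :
  / (1 + INR (m + n)) ^ (j + k) <= / ((1 + INR m) ^ j * (1 + INR n) ^ k).
Proof.
generalize (pos_INR m) (pos_INR n). intros hm hn.
apply Rinv_le_contravar.
- apply Rmult_lt_0_compat; apply pow_lt; lra.
- rewrite pow_add, plus_INR.
  apply Rmult_le_compat; try (apply pow_le; lra); apply pow_incr; lra.
Qed.

(** The larger level [m + |n|] is that of the row for [n >= 0] and that of the column for [n < 0];
    order [j + k] there is split by [decay_split]. *)
Lemma diag_entry_decay (j k : nat) : exists C0, 0 <= C0 /\ forall n m p, zunit p ->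
  Cmod (diag_entry n m p) <= C0 * / ((1 + INR m) ^ j * (1 + Rabs (IZR n)) ^ k).
Proof.
destruct (hrow (j + k)) as [C1 [h1 H1]]. destruct (hcol (j + k)) as [C2 [h2 H2]].
exists (Rmax C1 C2). split; [eapply Rle_trans; [exact h1|apply Rmax_l]|].
intros n m p hp. rewrite <- INR_abs_nat.
assert (hd := decay_split m (Z.abs_nat n) j k).
assert (hpos : 0 < / (1 + INR (m + Z.abs_nat n)) ^ (j + k)).
{ apply Rinv_0_lt_compat, pow_lt. generalize (pos_INR (m + Z.abs_nat n)). lra. }
assert (hmax : forall C', C' <= Rmax C1 C2 -> 0 <= C' ->
  C' * / (1 + INR (m + Z.abs_nat n)) ^ (j + k)
  <= Rmax C1 C2 * / ((1 + INR m) ^ j * (1 + INR (Z.abs_nat n)) ^ k)).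
{ intros C' hC' h0. apply Rmult_le_compat; auto. lra. }
unfold diag_entry, entry. destruct (0 <=? n)%Z.
- eapply Rle_trans; [apply H1, hp|]. apply hmax; [apply Rmax_l|exact h1].
- eapply Rle_trans; [apply H2, hp|]. apply hmax; [apply Rmax_r|exact h2].
Qed.

Lemma diag_entry_unif (eps : R) : 0 < eps -> exists N, forall n m p q, zunit p -> zunit q ->
  (pw N | p - q)%Z -> Cmod (diag_entry n m p - diag_entry n m q) <= eps.
Proof.
intros heps. destruct (almost_comm_entry s hs b (HS_almost_comm s hs b hb) eps heps) as [N hN].
exists N. intros n m p q hp hq h. unfold diag_entry. destruct (0 <=? n)%Z; now apply hN.
Qed.

Definition symbol_lim (n : Z) (m : nat) (x : Zs s) (c : C) : Prop :=
  forall eps, 0 < eps -> exists N, forall M, (N <= M)%nat ->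
    Cmod (diag_entry n m (Zs_trunc s x M) - c) <= eps.

(* The limit along the integers [Zs_trunc s x M]; junk when [x] is not a unit. *)
Definition symbol (n : Z) (mx : nat * Zs s) : C :=
  epsilon (inhabits (RtoC 0)) (symbol_lim n (fst mx) (snd mx)).

Lemma symbol_spec (n : Z) (m : nat) (x : Zs s) : Zs_units s x -> symbol_lim n m x (symbol n (m, x)).
Proof.
intros hx. unfold symbol. apply epsilon_spec.
apply (C_complete (fun M => diag_entry n m (Zs_trunc s x M))). intros eps heps.
destruct (diag_entry_unif eps heps) as [N hN]. exists (max N 1). intros i j hi hj.
apply hN; try (apply (trunc_zunit s hs); [exact hx|lia]).
replace (Zs_trunc s x i - Zs_trunc s x j)%Z with
  ((Zs_trunc s x i - Zs_trunc s x N) - (Zs_trunc s x j - Zs_trunc s x N))%Z by ring.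
apply Z.divide_sub_r; apply trunc_mod; lia.
Qed.

Lemma symbol_repr (n : Z) (m : nat) (x : Zs s) (p : Z) : Zs_repr s x p -> Zs_units s x ->
  symbol n (m, x) = diag_entry n m p.
Proof.
intros hx hu. symmetry. apply Cminus_eq_0, Cmod_eq_0, Rle_antisym; [|apply Cmod_ge_0].
apply le_epsilon. intros eps heps. rewrite Rplus_0_l.
destruct (diag_entry_unif (eps / 2) ltac:(lra)) as [N1 h1].
destruct (symbol_spec n m x hu (eps / 2) ltac:(lra)) as [N2 h2].
set (M := max 1 (max N1 N2)). specialize (h2 M ltac:(lia)).
assert (hp : zunit p) by now apply (repr_zunit s hs x p hx).
assert (ht : zunit (Zs_trunc s x M)) by (apply (trunc_zunit s hs); [exact hu|lia]).
assert (hd : (pw N1 | p - Zs_trunc s x M)%Z).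
(* [Zs_repr] says precisely that [p] is congruent to the truncations, so the limit defining the
   symbol is the entry at [p] itself. *)
{ apply Z.divide_trans with (pw M); [apply pw_divide; lia|exact (hx M)]. }
generalize (h1 n m p _ hp ht hd) (Cmod_minus_triangle (diag_entry n m p) (diag_entry n m (Zs_trunc s x M)) (symbol n (m, x))).
lra.
Qed.

Lemma symbol_le (n : Z) (m : nat) (x : Zs s) (B : R) : Zs_units s x ->
  (forall p, zunit p -> Cmod (diag_entry n m p) <= B) -> Cmod (symbol n (m, x)) <= B.
Proof.
intros hu hB. apply le_epsilon. intros eps heps.
destruct (symbol_spec n m x hu eps heps) as [N h]. specialize (h (max 1 N) ltac:(lia)).
assert (ht : zunit (Zs_trunc s x (max 1 N))) by (apply (trunc_zunit s hs); [exact hu|lia]).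
generalize (hB _ ht) (Cmod_rev_triangle (symbol n (m, x)) (diag_entry n m (Zs_trunc s x (max 1 N)))).
rewrite Cmod_minus_sym. lra.
Qed.

Lemma symbol_unif (eps : R) : 0 < eps -> exists N, forall n m x y, Zs_units s x -> Zs_units s y ->
  agree s N x y -> Cmod (symbol n (m, x) - symbol n (m, y)) <= eps.
Proof.
intros heps. destruct (diag_entry_unif (eps / 3) ltac:(lra)) as [N hN].
exists N. intros n m x y hx hy hxy.
destruct (symbol_spec n m x hx (eps / 3) ltac:(lra)) as [N1 h1].
destruct (symbol_spec n m y hy (eps / 3) ltac:(lra)) as [N2 h2].
set (M := max (max 1 N) (max N1 N2)).
specialize (h1 M ltac:(lia)). specialize (h2 M ltac:(lia)).
assert (tx : zunit (Zs_trunc s x M)) by (apply (trunc_zunit s hs); [exact hx|lia]).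
assert (ty : zunit (Zs_trunc s y M)) by (apply (trunc_zunit s hs); [exact hy|lia]).
assert (hd : (pw N | Zs_trunc s x M - Zs_trunc s y M)%Z).
{ apply (trunc_agree s hs) in hxy.
  replace (Zs_trunc s x M - Zs_trunc s y M)%Z with
    ((Zs_trunc s x M - Zs_trunc s x N) - (Zs_trunc s y M - Zs_trunc s y N))%Z by lia.
  apply Z.divide_sub_r; apply trunc_mod; lia. }
specialize (hN n m _ _ tx ty hd).
rewrite Cmod_minus_sym in h1.
generalize (Cmod_minus_triangle (symbol n (m, x)) (diag_entry n m (Zs_trunc s x M)) (symbol n (m, y))).
generalize (Cmod_minus_triangle (diag_entry n m (Zs_trunc s x M)) (diag_entry n m (Zs_trunc s y M)) (symbol n (m, y))).
lra.
Qed.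

Lemma symbol_C0 (n : Z) : @C0_on (nat_Zs_UniformSpace s) (nat_units s) (symbol n).
Proof.
assert (h2 : 2 <= INR s) by (apply le_INR in hs; simpl in hs; lra).
split.
- intros [m x] hx P [eps hP].
  destruct (symbol_unif (eps / 2)) as [N hN]; [generalize (cond_pos eps); lra|].
  assert (hp : 0 < / INR s ^ N) by (apply Rinv_0_lt_compat, pow_lt; lra).
  exists (mkposreal _ hp). intros [m' y] [hm hy] hyD. apply hP.
  change (m = m') in hm. subst m'.
  assert (hxy : agree s N x y).
  { intros j hj. apply NNPP. intros hne. destruct hy as [_ hy]. specialize (hy j hne).
    simpl in hy. apply Rinv_lt_cancel in hy; [|apply pow_lt; lra].
    assert (INR s ^ j <= INR s ^ N) by (apply Rle_pow; [lra|lia]). lra. }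
  assert (hle := hN n m y x hyD hx (agree_sym s N x y hxy)).
  assert (hlt : Cmod (symbol n (m, y) - symbol n (m, x)) < eps)
    by (apply Rle_lt_trans with (eps / 2); [exact hle|generalize (cond_pos eps); lra]).
  split.
  + eapply Rle_lt_trans; [|exact hlt]. apply (re_le_Cmod (symbol n (m, y) - symbol n (m, x))).
  + eapply Rle_lt_trans; [|exact hlt]. apply (im_le_Cmod (symbol n (m, y) - symbol n (m, x))).
(* First-order decay in the level gives vanishing at infinity; the compact set consists of the
   levels below [m0]. *)
- intros eps. destruct (diag_entry_decay 1 0) as [C0 [hC0 H]].
  destruct (INR_unbounded (C0 / eps)) as [m0 hm0].
  exists (fun p => (fst p < m0)%nat /\ Zs_units s (snd p)).
  split; [apply units_compact|]. split; [intros x [_ hx]; exact hx|].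
  intros [m x] hx hK. change (Zs_units s x) in hx.
  assert (hm : (m0 <= m)%nat).
  { apply Nat.nlt_ge. intros h. apply hK. split; [exact h|exact hx]. }
  apply Rle_lt_trans with (C0 * / ((1 + INR m) ^ 1 * (1 + Rabs (IZR n)) ^ 0)).
  + apply symbol_le; [exact hx|]. intros p hp. now apply H.
  + apply le_INR in hm. apply Rlt_div_l in hm0; [|apply cond_pos]. generalize (pos_INR m) (cond_pos eps). intros q1 q2.
    replace (C0 * / ((1 + INR m) ^ 1 * (1 + Rabs (IZR n)) ^ 0)) with (C0 / (1 + INR m)) by (field; lra).
    apply Rlt_div_l; [lra|]. nra.
Qed.

Lemma symbol_rapid_decay : rapid_decay (fun m n => sup_units s (symbol n) m).
Proof.
intros j k. destruct (diag_entry_decay j k) as [C0 [hC0 H]]. exists C0. intros m n.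
unfold sup_units.
apply (proj2 (Lub_Rbar_correct _) (Finite (C0 / ((1 + INR m) ^ j * (1 + Rabs (IZR n)) ^ k)))).
intros y (x & hx & ->). simpl. apply symbol_le; [exact hx|]. intros p hp. now apply H.
Qed.

Lemma diag_op_exists : exists (M : Z -> BH) (C0 : R), 0 <= C0 /\
  (forall n u k, coord (M n u) k = (diag_coef n k * coord u k)%C) /\
  (forall n, opnorm (M n) <= C0 * / (1 + Rabs (IZR n)) ^ 2).
Proof.
(* Order 2 in [n] suffices for absolute convergence of the two operator series. *)
destruct (diag_entry_decay 0 2) as [C0 [hC0 H]].
assert (hB : forall n, 0 <= C0 * / (1 + Rabs (IZR n)) ^ 2).
{ intros n. apply Rmult_le_pos; [exact hC0|]. left. apply Rinv_0_lt_compat, pow_lt.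
  generalize (Rabs_pos (IZR n)). lra. }
assert (hd : forall n k, Cmod (diag_coef n k) <= C0 * / (1 + Rabs (IZR n)) ^ 2).
{ intros n k. destruct (Z.eq_dec k 0) as [->|hk].
  - rewrite diag_coef_0, Cmod_0. apply hB.
  - destruct (zdecomp s hs k hk) as (m & p & hp & ->). rewrite diag_coef_entry.
    eapply Rle_trans; [apply H, hp|]. right. f_equal. f_equal. simpl. ring. }
exists (fun n => wcomp (diag_coef n) (fun k => k) _ (hB n) (hd n) (fun j k _ _ e => e)), C0.
split; [exact hC0|]. split.
- reflexivity.
- intros n. apply wcomp_norm.
Qed.

Lemma series_coord_zero (T : nat -> BH) (S : BH) (u : l2) (k : Z) : is_series T S ->
  (forall n, coord (T n u) k = 0%C) -> coord (S u) k = 0%C.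
Proof.
intros hS h. apply Cmod_eq_0, Rle_antisym; [|apply Cmod_ge_0].
apply (seminorm_series (fun T => Cmod (coord (T u) k)) (l2_norm u) 0 T (fun _ => 0) S
  (seminorm_coord u k) (l2_norm_ge0 u) hS).
- intros n. rewrite h, Cmod_0. lra.
- intros n. rewrite sum_n_const. lra.
Qed.

Lemma series_coord_single (T : nat -> BH) (S : BH) (u : l2) (k : Z) (n0 : nat) : is_series T S ->
  (forall n, n <> n0 -> coord (T n u) k = 0%C) -> coord (S u) k = coord (T n0 u) k.
Proof.
intros hS h.
assert (hsum : forall n, (n < n0)%nat -> coord (sum_n T n u) k = 0%C).
{ induction n as [|n IH]; intros hn.
  - rewrite sum_O. apply h. lia.
  - rewrite sum_Sn. rewrite opplus_coord, IH, h by lia. ring. }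
assert (hsum' : forall n, (n0 <= n)%nat -> coord (sum_n T n u) k = coord (T n0 u) k).
{ intros n hn. induction hn as [|n hn IH].
  - destruct n0 as [|n0]; [now rewrite sum_O|].
    rewrite sum_Sn, opplus_coord, hsum by lia. ring.
  - rewrite sum_Sn, opplus_coord, IH, (h (Datatypes.S n)) by lia. ring. }
apply Cminus_eq_0, Cmod_eq_0, Rle_antisym; [|apply Cmod_ge_0].
apply le_epsilon. intros eps heps. rewrite Rplus_0_l.
assert (hu := l2_norm_ge0 u).
destruct (proj1 (is_series_op T S) hS (eps / (l2_norm u + 1)) ltac:(apply Rdiv_lt_0_compat; lra)) as [N hN].
specialize (hN (max N n0) ltac:(lia)).
rewrite <- (hsum' (max N n0)) by lia. rewrite Cmod_minus_sym, <- coord_minus.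
eapply Rle_trans; [apply (coord_op_le (minus (sum_n T (max N n0)) S) u k)|].
apply Rlt_div_r in hN; [|lra].
generalize (op_norm_ge0 l2_NormedModule (minus (sum_n T (max N n0)) S)). nra.
Qed.

(** The diagonals of [b] define two absolutely convergent series, and their sum is compared with [b]
    on basis vectors, coordinate by coordinate. Inside a block exactly one term of one series meets
    a given entry. *)
Lemma I_infty_of_decay : I_infty s b.
Proof.
destruct diag_op_exists as (M & C0 & hC0 & hM & hMn).
assert (hM2 : forall n, / (1 + Rabs (IZR (Z.of_nat n))) ^ 2 = / (1 + INR n) ^ 2).
{ intros n. rewrite <- INR_IZR_INZ, Rabs_pos_eq by apply pos_INR. reflexivity. }
assert (hMbasis : forall n l, M n (l2_basis l) = scal (diag_coef n l) (l2_basis l)).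
{ intros n l. apply l2_ext. intros k.
  change (coord (M n (l2_basis l)) k = coord (scal (diag_coef n l) (l2_basis l)) k).
  rewrite hM, coord_scal, coord_basis. destruct (Z.eqb_spec k l) as [->|h]; ring. }
destruct (op_series_exists (fun n => op_mult _ (op_pow _ V n) (M (Z.of_nat n)))
  (fun n => C0 * / (1 + INR n) ^ 2)) as [b1 hb1].
{ intros n. eapply Rle_trans; [apply opnorm_mult|].
  generalize (op_pow_norm V n (shift_norm s hs V hV)) (hMn (Z.of_nat n))
    (op_norm_ge0 l2_NormedModule (M (Z.of_nat n))). rewrite hM2. nra. }
{ now apply ex_series_inv_sq. }
destruct (op_series_exists (fun n => op_mult _ (M (- Z.of_nat (S n))%Z) (op_pow _ W (S n)))
  (fun n => C0 * / (1 + INR n) ^ 2)) as [c1 hc1].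
{ intros n. eapply Rle_trans; [apply opnorm_mult|].
  assert (h1 := op_pow_norm W (S n) (adjoint_shift_norm s hs V W hV hW)).
  assert (h2 := hMn (- Z.of_nat (S n))%Z). rewrite opp_IZR, Rabs_Ropp, hM2 in h2.
  assert (h3 := op_norm_ge0 l2_NormedModule (M (- Z.of_nat (S n))%Z)).
  assert (h4 : C0 * / (1 + INR (S n)) ^ 2 <= C0 * / (1 + INR n) ^ 2).
  { apply Rmult_le_compat_l; [exact hC0|]. generalize (pos_INR n). intros h.
    apply Rinv_le_contravar; [apply pow_lt; lra|]. apply pow_incr. rewrite S_INR. lra. }
  nra. }
{ now apply ex_series_inv_sq. }
split; [exact hb|].
exists V, W, symbol, M, b1, c1.
split; [exact hV|]. split; [exact hW|]. split; [apply symbol_C0|].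
split.
{ intros n. split.
  - rewrite hMbasis, diag_coef_0. apply l2_ext. intros k.
    transitivity (0 * coord (l2_basis 0) k)%C; [reflexivity|]. rewrite Cmult_0_l. reflexivity.
  - intros m l x hx hu. rewrite hMbasis.
    change (Z.of_nat s ^ Z.of_nat m)%Z with (pw m).
    now rewrite diag_coef_entry, (symbol_repr n m x l hx hu). }
split; [apply symbol_rapid_decay|]. split; [exact hb1|]. split; [exact hc1|].
assert (tb : forall n l k, coord (op_mult _ (op_pow _ V n) (M (Z.of_nat n)) (l2_basis l)) k =
   (diag_coef (Z.of_nat n) l * coord (l2_basis (pw n * l)) k)%C).
{ intros n l k. rewrite opmult_apply, hMbasis, op_scal_apply, (shift_pow_basis s V n l hV).
  apply coord_scal. }
assert (tc : forall n l k, coord (op_mult _ (M (- Z.of_nat (S n))%Z) (op_pow _ W (S n)) (l2_basis l)) k =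
   (diag_coef (- Z.of_nat (S n)) k * coord (l2_basis l) (pw (S n) * k))%C).
{ intros n l k. rewrite opmult_apply, hM, (adjoint_pow_coord s V W _ _ k hV hW). reflexivity. }
apply op_basis_ext. intros l k. rewrite opplus_coord.
destruct (Z.eq_dec l 0) as [->|hl].
{ rewrite hb0, (series_coord_zero _ b1 _ k hb1), (series_coord_zero _ c1 _ k hc1).
  - rewrite coord_zero. ring.
  - intros n. rewrite tc, coord_basis. destruct (Z.eqb_spec (pw (S n) * k) 0) as [e|e]; [|ring].
    assert (k = 0)%Z as -> by (generalize (pw_pos s hs (S n)); nia).
    rewrite diag_coef_0. ring.
  - intros n. rewrite tb, diag_coef_0. ring. }
destruct (zdecomp s hs l hl) as (j & p & hp & ->).
destruct (classic (zblock s p k)) as [[i ->]|hk].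
- destruct (Nat.le_gt_cases j i) as [hij|hij].
  + rewrite (series_coord_zero _ c1 _ _ hc1), (series_coord_single _ b1 _ _ (i - j) hb1), tb.
    * replace (pw (i - j) * (pw j * p))%Z with (pw i * p)%Z
        by (rewrite Z.mul_assoc, <- pw_plus; do 2 f_equal; lia).
      rewrite coord_basis, Z.eqb_refl. unfold diag_coef.
      replace (0 <=? Z.of_nat (i - j))%Z with true by (symmetry; apply Z.leb_le; lia).
      rewrite Zabs2Nat.id.
      replace (pw (i - j) * (pw j * p))%Z with (pw i * p)%Z
        by (rewrite Z.mul_assoc, <- pw_plus; do 2 f_equal; lia).
      ring.
    * intros n hn. rewrite tb, Z.mul_assoc, <- pw_plus, coord_basis.
      destruct (Z.eqb_spec (pw i * p) (pw (n + j) * p)) as [e|e]; [|ring].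
      apply (zdecomp_uniq s hs) in e; auto. lia.
    * intros n. rewrite tc, Z.mul_assoc, <- pw_plus, coord_basis.
      destruct (Z.eqb_spec (pw (S n + i) * p) (pw j * p)) as [e|e]; [|ring].
      apply (zdecomp_uniq s hs) in e; auto. lia.
  + rewrite (series_coord_zero _ b1 _ _ hb1), (series_coord_single _ c1 _ _ (j - i - 1) hc1), tc.
    * replace (pw (S (j - i - 1)) * (pw i * p))%Z with (pw j * p)%Z
        by (rewrite Z.mul_assoc, <- pw_plus; do 2 f_equal; lia).
      rewrite coord_basis, Z.eqb_refl. unfold diag_coef.
      replace (0 <=? - Z.of_nat (S (j - i - 1)))%Z with false by (symmetry; apply Z.leb_gt; lia).
      replace (Z.abs_nat (- Z.of_nat (S (j - i - 1)))) with (S (j - i - 1)) by lia.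
      replace (pw (S (j - i - 1)) * (pw i * p))%Z with (pw j * p)%Z
        by (rewrite Z.mul_assoc, <- pw_plus; do 2 f_equal; lia).
      ring.
    * intros n hn. rewrite tc, Z.mul_assoc, <- pw_plus, coord_basis.
      destruct (Z.eqb_spec (pw (S n + i) * p) (pw j * p)) as [e|e]; [|ring].
      apply (zdecomp_uniq s hs) in e; auto. lia.
    * intros n. rewrite tb, Z.mul_assoc, <- pw_plus, coord_basis.
      destruct (Z.eqb_spec (pw i * p) (pw (n + j) * p)) as [e|e]; [|ring].
      apply (zdecomp_uniq s hs) in e; auto. lia.
(* Outside the block of [p] the entry of [b] is 0, and both series preserve blocks. *)
- rewrite (almost_comm_block s hs b p k j (HS_almost_comm s hs b hb) hp hk),
    (series_coord_zero _ b1 _ _ hb1), (series_coord_zero _ c1 _ _ hc1).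
  + ring.
  + intros n. rewrite tc, coord_basis. destruct (Z.eqb_spec (pw (S n) * k) (pw j * p)) as [e|e]; [|ring].
    exfalso. apply hk.
    assert (hk0 : k <> 0%Z) by (intros ->; generalize (pw_pos s hs j) (zunit_neq_0 s p hp); nia).
    destruct (zdecomp s hs k hk0) as (i & q & hq & ->).
    rewrite Z.mul_assoc, <- pw_plus in e. apply (zdecomp_uniq s hs) in e; auto.
    destruct e as [_ ->]. now exists i.
  + intros n. rewrite tb, coord_basis. destruct (Z.eqb_spec k (pw n * (pw j * p))) as [e|e]; [|ring].
    exfalso. apply hk. exists (n + j)%nat. rewrite e, pw_plus. ring.
Qed.

End Assembly.

Theorem theorem3p4 (s : nat) (hs : (2 <= s)%nat) (a b : bounded_op l2_NormedModule)
  (ha : I_infty s a) (U : C -> Prop) (f : C -> C)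
  (hU : @open C_UniformSpace U) (hspec : forall z, spectrum s a z -> U z)
  (hf : forall z, U z -> @ex_derive C_AbsRing C_NormedModule f z)
  (hf0 : f (RtoC 0) = RtoC 0) (hb : is_holo_calc s a U f b) :
  I_infty s b.
Proof.
destruct (I_infty_decay s hs a ha) as [a0 hdecay].
(* The shift and its adjoint are reused from the representation of [a]; the symbols and the series
   are built anew from [b]. *)
destruct ha as (_ & V & W & _ & _ & _ & _ & hV & hW & _).
apply (I_infty_of_decay s hs V W b hV hW).
- now apply (holo_calc_HS s a b U f).
- now apply (holo_calc_zero s a b U f).
- intros j. destruct (hdecay j) as [C0 [hC0 H]].
  destruct (holo_calc_row s a b U f a0 hU hspec hf hf0 hb) as [K [hK HK]].
  exists (K * C0). split; [now apply Rmult_le_pos|]. intros m p l hp. rewrite Rmult_assoc.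
  apply HK; [|apply H, hp].
  apply Rmult_le_pos; [exact hC0|]. left. apply Rinv_0_lt_compat, pow_lt. generalize (pos_INR m). lra.
- intros j. destruct (hdecay j) as [C0 [hC0 H]].
  destruct (holo_calc_col s a b U f a0 hU hspec hf hf0 hb) as [K [hK HK]].
  exists (K * C0). split; [now apply Rmult_le_pos|]. intros m p k hp. rewrite Rmult_assoc.
  apply HK; [|apply H, hp].
  apply Rmult_le_pos; [exact hC0|]. left. apply Rinv_0_lt_compat, pow_lt. generalize (pos_INR m). lra.
Qed.
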